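(* Let ${\bf F}^<$ be a finite biconnected ordered graph that is not complete. Then the $\{{\bf F}^<\}$-free ordering problem and the induced $\{{\bf F}^<\}$-free ordering problem are both $NP$-complete.
   Context: An ordered graph ${\bf G}^<$ is a finite undirected graph ${\bf G}$ together with a fixed linear ordering $<$ of its vertices; it is biconnected if ${\bf G}$ is 2-connected. For a fixed set $\mathcal{F}^<$ of ordered graphs, the $\mathcal{F}^<$-free ordering problem is: given a finite graph ${\bf G}$, does there exist a linear ordering $<$ of its vertices such that ${\bf G}^<$ contains no ordered subgraph (not necessarily induced) isomorphic as an ordered graph to a member of $\mathcal{F}^<$? The induced $\mathcal{F}^<$-free ordering problem is the same with ''ordered induced subgraph'' in place of ''ordered subgraph''. The paper assumes $P\neq NP$ throughout. *)

(* Defs.v *)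
From HB Require Import structures.
From mathcomp Require Import all_boot.
Set Implicit Arguments.
Unset Strict Implicit.
Unset Printing Implicit Defensive.

Record TM := {
  tm_state : finType;
  tm_sym : finType;
  tm_blank : tm_sym;
  tm_zero : tm_sym;
  tm_one : tm_sym;
  tm_start : tm_state;
  tm_accept : tm_state;
  tm_reject : tm_state;
  (* next state, written symbol, move right (true) or left (false) *)
  tm_delta : tm_state -> tm_sym -> tm_state * tm_sym * bool
}.
Arguments tm_delta : clear implicits.

Definition tm_wf (M : TM) : bool :=
  uniq [:: tm_blank M; tm_zero M; tm_one M] && (tm_accept M != tm_reject M).

Definition tm_halting (M : TM) (q : tm_state M) : bool :=
  (q == tm_accept M) || (q == tm_reject M).

Arguments tm_halting : clear implicits.

Definition config (M : TM) : Type := (tm_state M * nat * (nat -> tm_sym M))%type.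

Definition bit_sym (M : TM) (b : bool) : tm_sym M :=
  if b then tm_one M else tm_zero M.

Definition init_config (M : TM) (x : seq bool) : config M :=
  (tm_start M, 0,
   fun i => if i < size x then bit_sym M (nth false x i) else tm_blank M).

Definition tm_step (M : TM) (c : config M) : config M :=
  let: (q, h, tape) := c in
  if tm_halting M q then c else
  let: (q', s', r) := tm_delta M q (tape h) in
  (q', (if r then h.+1 else h.-1), fun i => if i == h then s' else tape i).

Definition tm_run (M : TM) (x : seq bool) (t : nat) : config M :=
  iter t (@tm_step M) (init_config M x).

Definition tape_output (M : TM) (tape : nat -> tm_sym M) (y : seq bool) : Prop :=
  (forall i, i < size y -> tape i = bit_sym M (nth false y i)) /\
  tape (size y) != tm_zero M /\ tape (size y) != tm_one M.

Arguments tape_output : clear implicits.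

Definition language := seq bool -> Prop.

Definition decides_poly (M : TM) (L : language) : Prop :=
  tm_wf M /\
  exists c : nat, forall x : seq bool, exists t : nat,
    t <= size x ^ c + c /\
    tm_halting M (tm_run M x t).1.1 /\
    ((tm_run M x t).1.1 = tm_accept M <-> L x).

Definition computes_poly (M : TM) (f : seq bool -> seq bool) : Prop :=
  tm_wf M /\
  exists c : nat, forall x : seq bool, exists t : nat,
    t <= size x ^ c + c /\
    tm_halting M (tm_run M x t).1.1 /\
    tape_output M (tm_run M x t).2 (f x).

Definition in_P (L : language) : Prop := exists M : TM, decides_poly M L.

Definition poly_computable (f : seq bool -> seq bool) : Prop :=
  exists M : TM, computes_poly M f.

Definition pair_enc (x w : seq bool) : seq bool :=
  flatten [seq [:: b; b] | b <- x] ++ [:: false; true] ++ w.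

Definition in_NP (L : language) : Prop :=
  exists (V : language) (c : nat), in_P V /\
    forall x, L x <-> exists w : seq bool, size w <= size x ^ c + c /\ V (pair_enc x w).

Definition poly_reduces (L1 L2 : language) : Prop :=
  exists f, poly_computable f /\ forall x, L1 x <-> L2 (f x).

Definition NP_hard (L : language) : Prop :=
  forall L' : language, in_NP L' -> poly_reduces L' L.

Definition NP_complete (L : language) : Prop := in_NP L /\ NP_hard L.

Definition simple_graph (n : nat) (e : rel 'I_n) : Prop :=
  (forall i, ~~ e i i) /\ (forall i j, e i j = e j i).

Definition complete_graph (n : nat) (e : rel 'I_n) : Prop :=
  forall i j, i != j -> e i j.

Definition connected_graph (n : nat) (e : rel 'I_n) : Prop :=
  forall x y, connect e x y.

Definition biconnected (n : nat) (e : rel 'I_n) : Prop :=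
  2 < n /\ connected_graph e /\
  forall v : 'I_n, forall x y, x != v -> y != v ->
    connect (fun a b => [&& e a b, a != v & b != v]) x y.

Definition linear_order (n : nat) (lt : rel 'I_n) : Prop :=
  (forall i, ~~ lt i i) /\
  (forall i j k, lt i j -> lt j k -> lt i k) /\
  (forall i j, i != j -> lt i j || lt j i).

(* An ordered graph F^< is given on the vertex set 'I_k with the natural
   order of 'I_k.  [ord_contains induced f g lt] : the ordered graph
   (g, lt) contains an ordered subgraph (an ordered induced subgraph when
   [induced]) isomorphic to the ordered graph (f, <). *)
Definition ord_contains (induced : bool) (k n : nat) (f : rel 'I_k)
    (g : rel 'I_n) (lt : rel 'I_n) : Prop :=
  exists phi : 'I_k -> 'I_n,
    injective phi /\
    (forall i j : 'I_k, i < j -> lt (phi i) (phi j)) /\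
    (if induced then forall i j, g (phi i) (phi j) = f i j
     else forall i j, f i j -> g (phi i) (phi j)).

Definition graph_enc (n : nat) (g : rel 'I_n) : seq bool :=
  [seq g i j | i <- enum 'I_n, j <- enum 'I_n].

Definition free_ordering_problem (induced : bool) (k : nat) (f : rel 'I_k)
    : language :=
  fun x => exists (n : nat) (g : rel 'I_n),
    simple_graph g /\ x = graph_enc g /\
    exists lt : rel 'I_n, linear_order lt /\ ~ ord_contains induced f g lt.

(* Main.v *)
Require Import Defs.
From mathcomp Require Import all_boot all_fingroup boolp zify.
Set Implicit Arguments.
Unset Strict Implicit.
Unset Printing Implicit Defensive.

(* Membership in NP: no copy of F in increasing position is a bounded arithmetic formula over
   the input, and such formulas are decidable in polynomial time.

   Hardness is a reduction from the 3-satisfiability instance describing the runs of a verifier.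
   A gadget is a graph with pairwise distant terminals in which all copies of F are induced; by
   2-connectivity, gluing gadgets along terminals creates no new copy of F, so the constraints
   imposed by the gadgets on the order of the terminals simply accumulate, and subgraphs and
   induced subgraphs play the same role.  Adding sparse copies of F to a large graph until no
   F-free order is left produces a gadget whose k terminals must be ordered like F up to an
   automorphism of F.  Gluing it on all k-subsets of a set of 2k+2 terminals, and taking the most
   restrictive gadget of this kind, gives a frame which may be assumed to be in its natural
   order and which can express x < y.  As F is not complete, some transposition of consecutive
   vertices is not an automorphism, and forbidding a copy of F placed with two adjacent positions
   in doubt yields disjunctions of the form (y < x or z < y').  These encode 3-clauses, a literal
   being true when its vertex lies above the vertex of its negation. *)

(** The gadget that forces a copy of F is the last graph of the sparse process that still has an
    F-free order: an order placing the chosen tuple otherwise than F would stay F-free after the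
    next copy is added. Counting shows that this moment comes: each copy can be put on a tuple that
    is increasing in a fixed fraction of the surviving orders, so of the order of n log n copies
    destroy all of them, and the average degree stays logarithmic, which leaves room for pairwise
    distant vertices. Everything obtained in this way is known only up to automorphisms of F, so no
    order of the frame is imposed outright; minimality of the set of realizable orders takes the
    place of this. The number 2k+2 comes from two replaceable positions with k fixed ones on either
    side. Automorphisms also cause the two forms of the disjunction gadget: if of two adjacent
    transpositions only one lies outside the group, one copy of F gives a disjunction involving an
    auxiliary element, and two copies are linked through it. *)

Definition incr (k : nat) (s : 'I_k -> nat) : Prop := forall a b : 'I_k, a < b -> s a < s b.

(** The position of an element in the sorted order is the number of elements below it, which does
    not depend on the sorting permutation. *)
Lemma incr_uniq k (s : 'I_k -> nat) (g h : {perm 'I_k}) :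
  injective s -> incr (fun a => s (g a)) -> incr (fun a => s (h a)) -> g = h.
Proof.
move=> si; have key: forall g h : {perm 'I_k}, incr (fun a => s (g a)) ->
    incr (fun a => s (h a)) -> forall a b : 'I_k, g a = h b -> a <= b.
  move=> {}g {}h ig ih.
  move=> a b eab.
  have cnt (p : {perm 'I_k}) c : incr (fun a => s (p a)) ->
      #|[set x | s x < s (p c)]| = #|[set d : 'I_k | d < c]|.
    move=> ip; rewrite (_ : [set x | _] = p @: [set d : 'I_k | d < c]).
      by rewrite card_imset //; exact: perm_inj.
    apply/setP => x; rewrite !inE; apply/idP/imsetP.
      move=> h0; exists ((p^-1)%g x); last by rewrite permKV.
      rewrite inE; case: (ltngtP ((p^-1)%g x) c) => //.
        by move=> /ip; rewrite permKV; lia.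
      by move=> /val_inj E; move: h0; rewrite -E permKV ltnn.
    by case=> d; rewrite inE => dc ->; exact: ip.
  have : #|[set d : 'I_k | d < a]| = #|[set d : 'I_k | d < b]|.
    by rewrite -(cnt _ a ig) eab (cnt _ b ih).
  apply: contra_eqT; rewrite -ltnNge => ba; rewrite neq_ltn; apply/orP; right.
  apply: proper_card; apply/properP; split; last by exists b; rewrite !inE // ltnn.
  by apply/subsetP => x; rewrite !inE => /ltn_trans; apply.
move=> ig ih; apply/permP => a.
have [b hb] : exists b, h b = g a by exists ((h^-1)%g (g a)); rewrite permKV.
have ab := key _ _ ig ih _ _ (esym hb); have ba := key _ _ ih ig _ _ hb.
by rewrite -hb; congr (h _); apply/val_inj/eqP; rewrite eqn_leq ab ba.
Qed.

(** * Automorphisms of F and tuples ordered like F *)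

Section Pattern.
Variables (k : nat) (f : rel 'I_k).
Hypothesis fsimp : simple_graph f.
Hypothesis fbi : biconnected f.

Definition gAut (g : {perm 'I_k}) : Prop := forall a b, f (g a) (g b) = f a b.
(** A copy of F on a tuple can be read in every order that differs by an automorphism, so this is
    the condition under which a copy placed on positions [s] violates F-freeness. *)
Definition Apat (s : 'I_k -> nat) : Prop := exists g : {perm 'I_k}, gAut g /\ incr (fun a => s (g a)).

Lemma gAut1 : gAut 1%g. Proof. by move=> a b; rewrite !perm1. Qed.
Lemma gAutM g h : gAut g -> gAut h -> gAut (g * h)%g.
Proof. by move=> Hg Hh a b; rewrite !permM Hh Hg. Qed.
Lemma gAutV g : gAut g -> gAut (g^-1)%g.
Proof. by move=> Hg a b; rewrite -(Hg ((g^-1)%g a)) !permKV. Qed.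

(** On a finite set the inverse of a permutation is one of its powers, so preserving edges implies
    reflecting them. *)
Lemma hom_Aut (g : {perm 'I_k}) : (forall a b, f a b -> f (g a) (g b)) -> gAut g.
Proof.
move=> Hg a b; apply/idP/idP; last exact: Hg.
have Hn n x y : f x y -> f ((g ^+ n)%g x) ((g ^+ n)%g y).
  elim: n x y => [|n IH] x y xy; first by rewrite expg0 !perm1.
  by rewrite expgS !permM; apply/IH/Hg.
have E x : (g ^+ (#[g]%g).-1)%g (g x) = x.
  by rewrite -permM -expgS prednK ?order_gt0 // expg_order perm1.
by move=> /(Hn (#[g]%g).-1); rewrite !E.
Qed.

Lemma Apat_Aut s g : gAut g -> Apat s -> Apat (fun a => s (g a)).
Proof.
move=> Ag [h [Ah ih]]; exists (h * g^-1)%g; split; first by apply: gAutM => //; apply: gAutV.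
by move=> a b ab; rewrite !permM !permKV; apply: ih.
Qed.

Lemma Apat_incr s : incr s -> Apat s.
Proof. by move=> i; exists 1%g; split; [exact: gAut1|move=> a b; rewrite !perm1; exact: i]. Qed.

Lemma Apat_iso s s' : (forall a b, (s a < s b) = (s' a < s' b)) -> Apat s -> Apat s'.
Proof. by move=> E [g [Ag ig]]; exists g; split=> // a b ab; rewrite -E; apply: ig. Qed.

(** Sorting permutations are unique, so [g] is a quotient of two automorphisms. By contraposition,
    permutations outside the group yield tuples that avoid F. *)
Lemma Apat_swap s (g : {perm 'I_k}) : injective s -> Apat s -> Apat (fun a => s (g a)) -> gAut g.
Proof.
move=> si [h [Ah ih]] [h' [Ah' ih']].
have E : (h = h' * g)%g.
  by apply: (incr_uniq si) => // a b ab; rewrite !permM; apply: ih'.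
have -> : (g = h'^-1 * h)%g by rewrite E mulKg.
by apply: gAutM => //; apply: gAutV.
Qed.

Lemma f_irr a : f a a = false.
Proof. by case: fsimp => h _; apply/negbTE/h. Qed.
Lemma f_sym a b : f a b = f b a.
Proof. by case: fsimp => _ ->. Qed.
Lemma k_gt2 : 2 < k. Proof. by case: fbi. Qed.

Lemma f_nbr a : exists b, f a b.
Proof.
have k2 := k_gt2; case: fbi => _ [cn _].
have [c ac] : exists c : 'I_k, c != a.
  have h0 : 0 < k by lia.
  have h1 : 1 < k by lia.
  case: (altP (Ordinal h0 =P a)) => [<-|]; last by exists (Ordinal h0).
  by exists (Ordinal h1).
have /connectP [[|b p] /=] := cn a c; first by move=> _ E; rewrite E eqxx in ac.
by case/andP=> ab _ _; exists b.
Qed.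

Lemma f_ind (P : 'I_k -> Prop) a0 : P a0 -> (forall a b, P a -> f a b -> P b) -> forall a, P a.
Proof.
move=> P0 PS a; case: fbi => _ [cn _].
have /connectP [p pp ->] := cn a0 a.
elim: p a0 P0 pp => [|b p IH] a0 P0 //= /andP [ab pp]; apply: IH => //.
exact: PS ab.
Qed.

Lemma f_ind_del (P : 'I_k -> Prop) v a0 : a0 != v -> P a0 ->
  (forall a b, a != v -> b != v -> P a -> f a b -> P b) -> forall a, a != v -> P a.
Proof.
move=> a0v P0 PS a av; case: fbi => _ [_ bi].
have /connectP [p pp E] := bi v a0 a a0v av.
rewrite {}E in av *.
elim: p a0 a0v P0 pp {av} => [|b p IH] a0 a0v P0 //= /andP [/and3P [ab _ bv] pp].
by apply: IH => //; apply: PS ab.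
Qed.

(** * Graphs, copies and gadgets *)

Definition copy (V : Type) (e : rel V) (phi : 'I_k -> V) : Prop :=
  injective phi /\ forall a b, f a b -> e (phi a) (phi b).
Definition free (V : Type) (e : rel V) (r : V -> nat) : Prop :=
  forall phi, copy e phi -> ~ incr (fun a => r (phi a)).
Definition clean (V : Type) (e : rel V) : Prop :=
  forall phi, copy e phi -> forall a b, e (phi a) (phi b) -> f a b.
(** A path inside a copy of F has fewer than [k] edges, so it cannot join two terminals. *)
Definition far (V : eqType) (e : rel V) (X : eqType) (tau : X -> V) : Prop :=
  forall t t' p, t != t' -> path e (tau t) p -> last (tau t) p = tau t' -> k < size p.

Record gadget (V X : finType) (e : rel V) (tau : X -> V) : Prop := Gadget {
  gd_sym : symmetric e;
  gd_irr : irreflexive e;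
  gd_inj : injective tau;
  gd_far : far e tau;
  gd_clean : clean e }.

(* The orders of the terminals that extend to an F-free order of the gadget. *)
Definition rho (V X : Type) (e : rel V) (tau : X -> V) (s : X -> nat) : Prop :=
  exists r : V -> nat, [/\ injective r, free e r &
    forall t t', (r (tau t) < r (tau t')) = (s t < s t')].

Lemma copy_sub V (e e' : rel V) phi : (forall x y, e x y -> e' x y) -> copy e phi -> copy e' phi.
Proof. by move=> s [i h]; split=> // a b /h /s. Qed.

Lemma free_iso V (e : rel V) (r r' : V -> nat) :
  (forall x y, r' x < r' y -> r x < r y) -> free e r -> free e r'.
Proof. by move=> E fr phi cp ip; apply: (fr phi cp) => a b /ip /E. Qed.

Lemma far_edge (V X : finType) (e : rel V) (tau : X -> V) t t' :
  gadget e tau -> e (tau t) (tau t') = false.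
Proof.
move=> G; apply/negP => h; have [E|ne] := eqVneq t t'.
  by move: h; rewrite E (gd_irr G).
have := gd_far G (p := [:: tau t']) ne; rewrite /= h => /(_ isT erefl).
by have := k_gt2; lia.
Qed.

(** * Gluing copies of a gadget along their terminals *)

Section Glue.
Variables (V X : finType) (e : rel V) (tau : X -> V).
Hypothesis G : gadget e tau.
Variables (W : finType) (V0 : pred W) (bs : rel W) (J : finType).
Variables (theta : J -> X -> W) (pi : J -> V -> W) (E : rel W).

(** An interface rather than one construction: it is met by a graph to which a copy of F is added,
    by a sum type, and by a graph on numbers. Interiors are disjoint, whereas terminals may be
    shared. *)
Record gluing : Prop := Gluing {
  gl_V0 : forall j t, V0 (theta j t);
  gl_inj : forall j, injective (theta j);
  gl_tau : forall j t, pi j (tau t) = theta j t;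
  gl_int : forall j v, v \notin codom tau -> ~~ V0 (pi j v);
  gl_pi : forall j v j' v', v \notin codom tau -> pi j v = pi j' v' -> j = j' /\ v = v';
  gl_bs : forall x y, bs x y -> V0 x /\ V0 y;
  gl_bsym : symmetric bs;
  gl_birr : irreflexive bs;
  gl_E : forall x y, E x y <-> bs x y \/ exists j u v, [/\ e u v, x = pi j u & y = pi j v] }.
Hypothesis H : gluing.

Lemma pi_inj j : injective (pi j).
Proof.
move=> u v uv; case: (boolP (u \in codom tau)) => [/codomP [t Et]|un]; last first.
  by case: (gl_pi H un uv).
case: (boolP (v \in codom tau)) => [/codomP [t' Et']|vn]; last first.
  by case: (gl_pi H vn (esym uv)).
move: uv; rewrite Et Et' !(gl_tau H) => /(gl_inj H) ->; by [].
Qed.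

Lemma pi_V0 j v : V0 (pi j v) -> exists t, v = tau t.
Proof. by case: (boolP (v \in codom tau)) => [/codomP|/(gl_int H j)/negbTE ->]. Qed.

Lemma E_V0 x y : V0 x -> V0 y -> E x y -> bs x y.
Proof.
move=> x0 y0 /(gl_E H) [//|[j [u [v [uv Ex Ey]]]]].
rewrite Ex in x0; rewrite Ey in y0.
have [t Et] := pi_V0 x0; have [t' Et'] := pi_V0 y0.
by move: uv; rewrite Et Et' (far_edge _ _ G).
Qed.

Lemma E_int j v y : v \notin codom tau -> E (pi j v) y -> exists2 v', e v v' & y = pi j v'.
Proof.
move=> vn /(gl_E H) [/(gl_bs H) [h _]|[j' [u [v' [uv Ex ->]]]]].
  by move: (gl_int H j vn); rewrite h.
by have [<- Eu] := gl_pi H vn Ex; exists v' => //; rewrite Eu.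
Qed.

Lemma E_pi j u v : e u v -> E (pi j u) (pi j v).
Proof. by move=> uv; apply/(gl_E H); right; exists j, u, v. Qed.

Lemma E_sym : symmetric E.
Proof.
have h x y : E x y -> E y x; last by move=> x y; apply/idP/idP; exact: h.
move=> /(gl_E H) [h|[j [u [v [uv Ex Ey]]]]]; apply/(gl_E H).
  by left; rewrite (gl_bsym H).
by right; exists j, v, u; rewrite (gd_sym G).
Qed.

Lemma E_irr : irreflexive E.
Proof.
move=> x; apply/negP => /(gl_E H) [|[j [u [v [uv -> /pi_inj Eq]]]]].
  by rewrite (gl_birr H).
by move: uv; rewrite Eq (gd_irr G).
Qed.

(* A copy meeting the interior of a gadget can leave it only through terminals;
   two of them would be close, and a single one would be a cut vertex. *)
Lemma glue_copy phi : copy E phi ->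
  ((forall a, V0 (phi a)) /\ copy bs phi) \/
  exists j psi, [/\ copy e psi, forall a, phi a = pi j (psi a) &
     forall a b, V0 (phi a) -> V0 (phi b) -> a = b].
Proof.
move=> [phi_inj phiE].
have [all0|] := boolP [forall a, V0 (phi a)].
  left; split; first exact/forallP.
  split=> // a b ab; apply: E_V0; [exact: (forallP all0)|exact: (forallP all0)|exact: phiE].
rewrite negb_forall => /existsP [a0 a0n]; right.
have [j [v0 [v0n Ev0]]] : exists j v, v \notin codom tau /\ phi a0 = pi j v.
  have [b ab] := f_nbr a0; case/(gl_E H): (phiE _ _ ab) => [/(gl_bs H) [h _]|].
    by rewrite h in a0n.
  case=> j [u [v [_ Eu _]]]; exists j, u; split=> //; apply/negP => /codomP [t Et].
  by move: a0n; rewrite Eu Et (gl_tau H) (gl_V0 H).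
exists j.
pose In a := [exists v, (v \notin codom tau) && (phi a == pi j v)].
have InP a : reflect (exists2 v, v \notin codom tau & phi a = pi j v) (In a).
  by apply: (iffP existsP) => [[v /andP [h /eqP]]|[v h h']]; exists v => //; rewrite h h' eqxx.
have In_nV0 a : In a -> ~~ V0 (phi a) by case/InP => v vn ->; apply: (gl_int H).
pose fI := fun a b => [&& f a b, In a & In b].
(* [C] is the component of [a0] among the vertices of F that are sent into the interior of gadget
   [j]. *)
pose C a := connect fI a0 a.
have In0 : In a0 by apply/InP; exists v0.
have fIs : connect_sym fI by apply: sym_connect_sym => a b; rewrite /fI f_sym [In a && _]andbC.
have CIn a : C a -> In a.
  case/connectP => p pp ->; elim: p a0 In0 pp {a0n Ev0 C fIs} => [//|b p IH] a0 In0 /=.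
  by case/andP => /and3P [_ _ Ib] /(IH _ Ib).
have nxt a b : In a -> f a b -> exists2 v, phi b = pi j v & (exists2 u, phi a = pi j u & e u v).
  case/InP => u un Eu ab; have := phiE _ _ ab; rewrite Eu => /(E_int un) [v uv Ev].
  by exists v => //; exists u.
have CS a b : C a -> f a b -> In b -> C b.
  move=> Ca ab Ib; apply: (connect_trans Ca); apply: connect1.
  by rewrite /fI ab Ib (CIn _ Ca).
have bdterm a b : C a -> f a b -> ~~ In b -> exists t, phi b = pi j (tau t).
  move=> Ca ab; have [v Ev _] := nxt _ _ (CIn _ Ca) ab.
  move/InP => nb; case: (boolP (v \in codom tau)) => [/codomP [t Et]|vn].
    by exists t; rewrite Ev Et.
  by case: nb; exists v.
(* Two exits of [C] would be distinct terminals joined by a path with [size p + 2] edges, while the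
   exits and the vertices in between are [size p + 3] distinct vertices of F. *)
have bd1 a b a' b' : C a -> f a b -> ~~ In b -> C a' -> f a' b' -> ~~ In b' -> b = b'.
  move=> Ca ab nb Ca' ab' nb'; have [//|bb'] := eqVneq b b'.
  have [t Et] := bdterm _ _ Ca ab nb; have [t' Et'] := bdterm _ _ Ca' ab' nb'.
  have tt' : t != t' by apply: contra bb' => /eqP tt; apply/eqP/phi_inj; rewrite Et Et' tt.
  have /connectP [p0 pp0 Ea'] : connect fI a a'.
    by apply: (@connect_trans _ _ a0) => //; rewrite fIs.
  case/shortenP: pp0 Ea' => p pp up _ Ea'.
  have [psi psiP] : {psi | forall c, In c -> phi c = pi j (psi c)}.
    have h c : exists v, In c -> phi c = pi j v.
      by case: (boolP (In c)) => [/InP [v _ ->]|_]; [exists v|exists v0].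
    by have [psi] := choice h; exists psi.
  have pe : forall q c, In c -> path fI c q -> path e (psi c) (map psi q).
    elim=> [//|d q IH] c Ic /= /andP [/and3P [cd _ Id] qq]; rewrite IH // andbT.
    have [v Ev [u Eu uv]] := nxt _ _ Ic cd.
    by move: Ev Eu; rewrite !psiP // => /pi_inj -> /pi_inj ->.
  have Ia := CIn _ Ca; have Ia' := CIn _ Ca'.
  have := gd_far G (p := psi a :: rcons (map psi p) (tau t')) tt'.
  rewrite /= rcons_path last_rcons pe // last_map -Ea' size_rcons size_map.
  have -> : e (tau t) (psi a).
    rewrite (gd_sym G); have [v Ev [u Eu uv]] := nxt _ _ Ia ab.
    by move: Ev Eu; rewrite (psiP _ Ia) Et => /pi_inj -> /pi_inj ->.
  have -> : e (psi a') (tau t').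
    have [v Ev [u Eu uv]] := nxt _ _ Ia' ab'.
    by move: Ev Eu; rewrite (psiP _ Ia') Et' => /pi_inj -> /pi_inj ->.
  move=> /(_ isT erefl).
  have allIn : all In (a :: p).
    rewrite /= Ia /=; elim: p a Ia pp {Ca ab up Ea'} => [//|c p IH] a Ia /=.
    by case/andP => /and3P [_ _ Ic] /(IH _ Ic) ->; rewrite Ic.
  have : size (b :: b' :: a :: p) <= k.
    have bn : b \notin a :: p by apply: contra nb => h; apply: (allP allIn).
    have bn' : b' \notin a :: p by apply: contra nb' => h; apply: (allP allIn).
    have u : uniq (b :: b' :: a :: p).
      by rewrite cons_uniq in_cons negb_or bb' bn /= bn' //= -cons_uniq.
    have := max_card [in b :: b' :: a :: p]; rewrite (card_uniqP u) => /leq_trans; apply.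
    by rewrite card_ord.
  by move=> /= h2 h1; move: (leq_trans h1 (ltnW h2)); rewrite ltnn.
(* If there is an exit [b], connectivity of F minus [b] puts every other vertex into [C]; if there
   is none, connectivity of F does so for all vertices. *)
have all_in : (forall b, exists v, phi b = pi j v) /\ (forall a b, ~~ In a -> ~~ In b -> a = b).
  have [/existsP [a /existsP [b /and3P [Ca ab nb]]]|nobd] :=
      boolP [exists a, exists b, [&& C a, f a b & ~~ In b]].
    have a0b : a0 != b by apply: contra nb => /eqP <-.
    have CC c : c != b -> C c.
      apply: (f_ind_del (P := C) a0b); first exact: connect0.
      move=> x y _ yb Cx xy; apply: (CS x y Cx xy); apply: contraT => ny.
      by move: yb; rewrite (bd1 _ _ _ _ Cx xy ny Ca ab nb) eqxx.
    have NI c : ~~ In c -> c = b.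
      by move=> nc; have [//|/CC /CIn h] := eqVneq c b; rewrite h in nc.
    split; last by move=> x y /NI -> /NI ->.
    move=> c; have [->|/CC /CIn /InP [v _ ->]] := eqVneq c b; last by exists v.
    by have [t ->] := bdterm _ _ Ca ab nb; exists (tau t).
  have CC c : C c.
    apply: (f_ind (P := C) (a0 := a0)); first exact: connect0.
    move=> x y Cx xy; apply: (CS x y Cx xy); apply: contraT => ny.
    by case/existsP: nobd; exists x; apply/existsP; exists y; rewrite Cx xy.
  split; last by move=> x y; rewrite (CIn _ (CC x)).
  by move=> c; have /CIn/InP [v _ ->] := CC c; exists v.
have [all_in1 NI] := all_in; have [psi psiP] := choice all_in1.
exists psi; split=> //; last first.
  move=> a b a1 b1; apply: NI; [apply: contraL a1|apply: contraL b1]; exact: In_nV0.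
split; first by move=> a b ab; apply: phi_inj; rewrite !psiP ab.
move=> a b ab; have [Ia|nIa] := boolP (In a).
  have [v Ev [u Eu uv]] := nxt _ _ Ia ab.
  by move: Ev Eu; rewrite !psiP => /pi_inj -> /pi_inj ->.
have [Ib|nIb] := boolP (In b); last by move: ab; rewrite (NI _ _ nIa nIb) f_irr.
rewrite f_sym in ab; have [v Ev [u Eu uv]] := nxt _ _ Ib ab.
by move: Ev Eu; rewrite !psiP (gd_sym G) => /pi_inj -> /pi_inj ->.
Qed.

Lemma copy_pi j psi : copy e psi -> copy E (fun a => pi j (psi a)).
Proof. by move=> [i h]; split; [move=> a b /pi_inj /i|move=> a b /h; apply: E_pi]. Qed.

Lemma copy_bs phi : copy bs phi -> copy E phi.
Proof. by apply: copy_sub => x y xy; apply/(gl_E H); left. Qed.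

Lemma glue_free r : (forall j, free e (fun v => r (pi j v))) -> free bs r -> free E r.
Proof.
move=> fj fb phi /glue_copy [[_ cb]|[j [psi [cp Ep _]]]]; first exact: fb.
by move=> i; apply: (fj j psi cp) => a b /i; rewrite !Ep.
Qed.

Lemma free_glue_pi j r : free E r -> free e (fun v => r (pi j v)).
Proof. by move=> fr psi cp; apply: (fr (fun a => pi j (psi a))); apply: copy_pi. Qed.

Lemma free_glue_bs r : free E r -> free bs r.
Proof. by move=> fr phi cp; apply: fr; apply: copy_bs. Qed.

(** By [glue_copy], a copy meeting an interior has at most one vertex in [V0]. An edge between two
    of its vertices therefore has an interior end and belongs to the gadget. *)
Lemma glue_clean : clean bs -> clean E.
Proof.
move=> cb phi cp a b Eab; case: (glue_copy cp) => [[h0 c]|[j [psi [c Ep u]]]].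
  by apply: (cb phi c); apply: E_V0.
have [Eq|ab] := eqVneq a b; first by move: Eab; rewrite Eq E_irr.
apply: (gd_clean G c); move: Eab; rewrite !Ep => Eab.
have tm : forall x, psi x \in codom tau -> V0 (phi x).
  by move=> x /codomP [t Et]; rewrite Ep Et (gl_tau H) (gl_V0 H).
have [xa|xa] := boolP (psi a \in codom tau); last first.
  by have [v' uv /pi_inj ->] := E_int xa Eab.
have [xb|xb] := boolP (psi b \in codom tau); last first.
  rewrite E_sym in Eab; have [v' uv /pi_inj ->] := E_int xb Eab.
  by rewrite (gd_sym G).
by move: ab; rewrite (u _ _ (tm _ xa) (tm _ xb)) eqxx.
Qed.

(** The first edge from [tau' t] is not in [bs], so it enters a gadget at a terminal. The path, made
    simple, does not return there and must reach a second terminal of that gadget, which is already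
    far away. *)
Lemma glue_far (X' : finType) (tau' : X' -> W) : injective tau' -> (forall t, V0 (tau' t)) ->
  (forall t x, bs (tau' t) x = false) -> far E tau'.
Proof.
move=> ti tV nb t t' p0 tt' pp lp.
case/shortenP: pp lp => p pp up sp lp.
suff: k < size p by move/leq_trans; apply; case/andP: up => _ up; exact: uniq_leq_size.
have := lp; case: p pp up {sp} lp => [|y p] /=; first by move=> _ _ _ /ti E'; rewrite E' eqxx in tt'.
case/andP => ty pp /andP [tn up] lp _.
have [j [u [v [uv Eu Ev]]]] : exists j u v, [/\ e u v, tau' t = pi j u & y = pi j v].
  by case/(gl_E H): ty => //; rewrite nb.
have [x Ex] : exists x, u = tau x by apply: (@pi_V0 j); rewrite -Eu.
have key : forall q z, path E (pi j z) q -> uniq (pi j z :: q) -> pi j u \notin pi j z :: q ->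
    V0 (last (pi j z) q) ->
    exists q' x', [/\ path e z q', last z q' = tau x', x' != x & size q' <= size q].
  elim=> [|w q IH] z /=.
    move=> _ _ zn /pi_V0 [x' Ez]; exists [::], x'; split=> //.
    by apply: contra zn; rewrite Ex Ez inE => /eqP ->.
  case/andP => zw pq /andP [_ uq] zn l0.
  have [/codomP [x' Ez]|zi] := boolP (z \in codom tau).
    exists [::], x'; split=> //; apply: contra zn; rewrite Ex Ez inE => /eqP ->.
    by rewrite eqxx.
  have [w' zw' Ew] := E_int zi zw.
  rewrite Ew in pq uq l0 zn *; have [] := IH w' pq uq _ l0.
    by apply: contra zn => zn; rewrite in_cons zn orbT.
  move=> q' [x' [h1 h2 h3 h4]]; exists (w' :: q'), x'; split=> //=; exact/andP.
have [] := key p v; rewrite -?Ev //; rewrite ?lp //; first by rewrite -Eu.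
move=> q' [x' [h1 h2 h3 h4]].
have := gd_far G (t := x) (t' := x') (p := v :: q'); rewrite eq_sym h3 /= -Ex uv h1.
by move=> /(_ isT isT h2) /leq_trans; apply.
Qed.

(* Interior vertices are placed just above the largest terminal below them;
   ties are broken by the gadget index and the order inside the gadget. *)
Lemma glue_extend (r0 : W -> nat) : {in V0 &, injective r0} -> free bs r0 ->
  (forall j, rho e tau (fun t => r0 (theta j t))) ->
  exists r : W -> nat, [/\ injective r, free E r &
    forall x y, V0 x -> V0 y -> (r x < r y) = (r0 x < r0 y)].
Proof.
move=> r0i fb0 /choice [rj rjP].
pose own x := [pick jv : J * V | (jv.2 \notin codom tau) && (x == pi jv.1 jv.2)].
have ownE j v : v \notin codom tau -> own (pi j v) = Some (j, v).
  move=> vn; rewrite /own; case: pickP => [[j' v'] /= /andP [vn' /eqP Ep]|/(_ (j, v))].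
    by have [-> ->] := gl_pi H vn Ep.
  by rewrite /= vn eqxx.
pose S := (\max_(jv : J * V) rj jv.1 jv.2).+1.
have rjS j v : rj j v < S by rewrite ltnS (leq_bigmax (j, v)).
(* Outer vertices get even and interior ones odd values, so an interior vertex lies strictly between
   the largest terminal below it and every higher outer vertex. *)
pose av x := if V0 x then (r0 x).+1.*2 else
  if own x is Some jv then
    (\max_(t | rj jv.1 (tau t) < rj jv.1 jv.2) (r0 (theta jv.1 t)).+1).*2.+1 else 0.
pose bv x := if V0 x then 0 else
  if own x is Some jv then enum_rank jv.1 * S + rj jv.1 jv.2 else 0.
pose P := (\max_x bv x).+1.
have bP x : bv x < P by rewrite ltnS leq_bigmax.
(* A lexicographic code; the enumeration rank in the last place only serves injectivity. *)
pose r x := (av x * P + bv x) * #|W| + enum_rank x.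
have lexi A1 A2 c1 c2 n (b1 b2 p : nat) : b1 < p -> c1 < n -> A1 < A2 \/ A1 = A2 /\ b1 < b2 ->
    (A1 * p + b1) * n + c1 < (A2 * p + b2) * n + c2.
  move=> h1 h2 h3; have h : A1 * p + b1 < A2 * p + b2.
    case: h3 => [h3|[-> h3]]; last by rewrite ltn_add2l.
    have : A1.+1 * p <= A2 * p by rewrite leq_mul2r h3 orbT.
    by rewrite mulSnr; lia.
  have : (A1 * p + b1).+1 * n <= (A2 * p + b2) * n by rewrite leq_mul2r h orbT.
  by rewrite mulSnr; lia.
have rlt1 x y : av x < av y -> r x < r y.
  by move=> h; apply: lexi; [exact: bP|exact: ltn_ord|left].
have rlt2 x y : av x = av y -> bv x < bv y -> r x < r y.
  by move=> Ea h; apply: lexi; [exact: bP|exact: ltn_ord|right].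
have av0 x : V0 x -> av x = (r0 x).+1.*2 by rewrite /av => ->.
have avi j v : v \notin codom tau ->
    av (pi j v) = (\max_(t | rj j (tau t) < rj j v) (r0 (theta j t)).+1).*2.+1.
  by move=> vn; rewrite /av (negbTE (gl_int H j vn)) ownE.
have bvi j v : v \notin codom tau -> bv (pi j v) = enum_rank j * S + rj j v.
  by move=> vn; rewrite /bv (negbTE (gl_int H j vn)) ownE.
have mono j u v : rj j u < rj j v -> r (pi j u) < r (pi j v).
  have [_ _ rs] := rjP j.
  have [/codomP [t ->]|un] := boolP (u \in codom tau);
    have [/codomP [t' ->]|vn] := boolP (v \in codom tau) => h.
  - apply: rlt1; rewrite !(gl_tau H) !av0 ?(gl_V0 H) //.
    by rewrite rs in h; rewrite ltn_double ltnS.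
  - apply: rlt1; rewrite (gl_tau H) av0 ?(gl_V0 H) // avi //.
    rewrite ltnS leq_double.
    exact: (leq_bigmax_cond (P := fun t => rj j (tau t) < rj j v) (F := fun t => (r0 (theta j t)).+1)).
  - apply: rlt1; rewrite (gl_tau H) (av0 (theta j t')) ?(gl_V0 H) // avi // doubleS !ltnS leq_double.
    apply/bigmax_leqP => t ht; rewrite -rs; exact: ltn_trans h.
  - have le : av (pi j u) <= av (pi j v).
      rewrite !avi // ltnS leq_double; apply/bigmax_leqP => t ht.
      apply: (leq_bigmax_cond (P := fun t => rj j (tau t) < rj j v) (F := fun t => (r0 (theta j t)).+1)).
      exact: ltn_trans h.
    move: le; rewrite leq_eqVlt => /orP [/eqP Ea|]; last exact: rlt1.
    by apply: rlt2 => //; rewrite !bvi // ltn_add2l.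
have ord0 x y : V0 x -> V0 y -> (r x < r y) = (r0 x < r0 y).
  move=> x0 y0; case: (ltngtP (r0 x) (r0 y)) => h.
  - by apply: rlt1; rewrite !av0 // ltn_double.
  - by apply/negbTE; rewrite -leqNgt; apply/ltnW/rlt1; rewrite !av0 // ltn_double.
  - by rewrite (r0i _ _ x0 y0 h) ltnn.
have ri : injective r.
  move=> x y /(congr1 (modn^~ #|W|)).
  by rewrite /r !modnMDl !modn_small ?ltn_ord // => /ord_inj /enum_rank_inj.
exists r; split=> //; apply: glue_free.
  move=> j; have [rji frj _] := rjP j; apply: free_iso frj => u v h.
  rewrite ltnNge; apply/negP; rewrite leq_eqVlt => /orP [/eqP/rji Eq|/mono]; last by lia.
  by rewrite Eq ltnn in h.
move=> phi cp ip; apply: (fb0 phi cp) => a b ab; rewrite -ord0; first exact: ip.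
  by have [c ac] := f_nbr a; case: (gl_bs H (proj2 cp _ _ ac)).
by have [c bc] := f_nbr b; case: (gl_bs H (proj2 cp _ _ bc)).
Qed.

Lemma glue_gadget (X' : finType) (tau' : X' -> W) : clean bs -> injective tau' ->
  (forall t, V0 (tau' t)) -> (forall t x, bs (tau' t) x = false) -> gadget E tau'.
Proof.
move=> cb ti tV tb; split=> //; [exact: E_sym|exact: E_irr|exact: glue_far|exact: glue_clean].
Qed.

End Glue.

(** * Disjoint copies of F *)

Section Base.
Variables (W : finType) (C : finType) (cc : C -> 'I_k -> W).
Hypothesis cci : forall c a c' a', cc c a = cc c' a' -> c = c' /\ a = a'.

Definition base : rel W := fun x y =>
  [exists c, exists a, exists b, [&& f a b, x == cc c a & y == cc c b]].

Lemma baseP x y : reflect (exists c a b, [/\ f a b, x = cc c a & y = cc c b]) (base x y).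
Proof.
apply: (iffP existsP) => [[c /existsP [a /existsP [b /and3P [ab /eqP -> /eqP ->]]]]|[c [a [b [ab -> ->]]]]].
  by exists c, a, b.
by exists c; apply/existsP; exists a; apply/existsP; exists b; rewrite ab !eqxx.
Qed.

Lemma base_sym : symmetric base.
Proof.
have h x y : base x y -> base y x; last by move=> x y; apply/idP/idP; exact: h.
by case/baseP => c [a [b [ab -> ->]]]; apply/baseP; exists c, b, a; rewrite f_sym.
Qed.

Lemma base_irr : irreflexive base.
Proof. by move=> x; apply/baseP => -[c [a [b [ab -> /cci [_ Eq]]]]]; rewrite Eq f_irr in ab. Qed.

(** F is connected and the tuples are disjoint, so a copy stays inside one tuple, where it is an
    edge-preserving permutation. *)
Lemma base_copyE phi : copy base phi ->
  exists c (g : {perm 'I_k}), gAut g /\ forall a, phi a = cc c (g a).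
Proof.
move=> [pinj pE]; have k2 := k_gt2; have k0 : 0 < k by lia.
pose a0 := Ordinal k0.
have [c [a1 Ea1]] : exists c a1, phi a0 = cc c a1.
  have [b /pE /baseP [c [a [_ [_ -> _]]]]] := f_nbr a0; by exists c, a.
have al : forall a, exists a', phi a = cc c a'.
  apply: (f_ind (a0 := a0)); first by exists a1.
  move=> a b [a' Ea] /pE /baseP [c' [x [y [_]]]]; rewrite Ea => /cci [<- _] ->.
  by exists y.
have [h hP] := choice al.
have hi : injective h by move=> a b ab; apply: pinj; rewrite !hP ab.
exists c, (perm hi); split; last by move=> a; rewrite permE.
apply: hom_Aut => a b /pE; rewrite !hP !permE => /baseP [c' [x [y [xy]]]].
by move=> /cci [_ ->] /cci [_ ->].
Qed.

Lemma base_clean : clean base.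
Proof.
move=> phi /base_copyE [c [g [Ag Ep]]] a b; rewrite !Ep => /baseP [c' [x [y [xy]]]].
by move=> /cci [_ Ex] /cci [_ Ey]; rewrite -Ag Ex Ey.
Qed.

Lemma base_free (r : W -> nat) : (forall c, ~ Apat (fun a => r (cc c a))) -> free base r.
Proof.
move=> h phi /base_copyE [c [g [Ag Ep]]] i; apply: (h c); exists g; split=> // a b /i.
by rewrite !Ep.
Qed.

Lemma base_copy c (g : {perm 'I_k}) : gAut g -> copy base (fun a => cc c (g a)).
Proof.
move=> Ag; split; first by move=> a b /cci [_ /perm_inj].
by move=> a b ab; apply/baseP; exists c, (g a), (g b); rewrite Ag.
Qed.

Lemma free_base (r : W -> nat) c : free base r -> ~ Apat (fun a => r (cc c a)).
Proof. by move=> fr [g [Ag ig]]; apply: (fr _ (base_copy c Ag)). Qed.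

End Base.

End Pattern.

(** * A gadget forcing a copy of F *)

(** Bernoulli's inequality [(1 + 1/m) ^ j >= 1 + j/m] with denominators cleared. *)
Lemma expn_succ_ge m j : m ^ j * (m + j) <= m.+1 ^ j * m.
Proof.
elim: j => [|j IH]; first by rewrite !expn0 addn0.
rewrite !expnS -!mulnA; apply: (@leq_trans (m.+1 * (m ^ j * (m + j)))); last by rewrite leq_mul2l IH orbT.
nia.
Qed.

(** With [q = m.+1] this reads [(1 - 1/q) ^ q <= 1/2]: removing a fraction 1/q in each of [q] rounds
    halves a set. *)
Lemma double_expn_le m : 2 * m ^ m.+1 <= m.+1 ^ m.+1.
Proof.
case: m => // m; have := expn_succ_ge m.+1 m.+2.
move: (m.+1 ^ m.+2) (m.+2 ^ m.+2) => A B; nia.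
Qed.

Lemma exp2_beats_linear A B : exists j, A + B * j <= 2 ^ j.
Proof.
pose m := A + 2 * B; exists (m + m); rewrite expnD.
have : m < 2 ^ m by rewrite ltn_expl.
move: (2 ^ m) => X h; have : m.+1 * m.+1 <= X * X by rewrite leq_mul.
rewrite /m; nia.
Qed.

Lemma exp2_beats_poly k a C : exists p, C * (a * p.+1) ^ k <= 2 ^ p.
Proof.
have [j hj] := exp2_beats_linear (C + a * k + 1) k.
have j0 : 0 < 2 ^ j by rewrite expn_gt0.
(* For this choice of [p] the left side is below a power of 2 whose exponent is linear in [j]. *)
exists (2 ^ j).-1; rewrite prednK //.
have : C * (a * 2 ^ j) ^ k <= 2 ^ (C + (a + j) * k).
  rewrite expnD leq_mul //; first exact/ltnW/ltn_expl.
  case: k {hj} => [|k]; rewrite ?muln0 ?expn0 // expnM leq_exp2r // expnD leq_mul2r; apply/orP; right; exact/ltnW/ltn_expl.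
move/leq_trans; apply; rewrite leq_exp2l //; lia.
Qed.

(** Double counting of the pairs of an element [r] of [R] and a vertex of [c r]. *)
Lemma pigeonhole (T : finType) n (R : {set T}) (c : T -> {set 'I_n}) a :
  0 < n -> (forall r, r \in R -> a <= #|c r|) ->
  exists v, #|R| * a <= #|[set r in R | v \in c r]| * n.
Proof.
move=> n0 h; pose F v := #|[set r in R | v \in c r]|.
have [[v hv]|no] := pselect (exists v, #|R| * a <= F v * n); first by exists v.
exfalso.
have lt v : F v * n < #|R| * a by rewrite ltnNge; apply/negP => hv; apply: no; exists v.
have : \sum_v F v = \sum_(r in R) #|c r|.
  rewrite /F; under eq_bigr => v _ do rewrite -sum1dep_card big_mkcondr.
  rewrite exchange_big; apply: eq_bigr => r _.
  by rewrite -sum1_card [RHS]big_mkcond.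
have : \sum_(r in R) #|c r| >= #|R| * a by rewrite -sum_nat_const; exact: leq_sum.
have : \sum_v (F v * n) < n * (#|R| * a).
  have -> : n * (#|R| * a) = \sum_(v < n) (#|R| * a) by rewrite sum_nat_const card_ord.
  have [i0] : exists i : 'I_n, true by exists (Ordinal n0).
  rewrite (bigD1 i0) //= [X in _ < X](bigD1 i0) //= => _.
  by rewrite -addSn; apply: leq_add (lt i0) _; apply: leq_sum => i _; exact/ltnW/lt.
rewrite -big_distrl /= => h1 h2 h3; rewrite h3 in h1; nia.
Qed.

(** * Balls in graphs of bounded degree *)

Section Ball.
Variables (V : finType) (g : rel V).
Definition deg v := #|[set w | g v w]|.
Fixpoint ball i x : {set V} :=
  if i is i'.+1 then \bigcup_(y in ball i' x) (y |: [set w | g y w]) else [set x].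

Lemma ball_path p x i : path g x p -> size p <= i -> last x p \in ball i x.
Proof.
elim: i p => [|i IH] p; first by case: p => //= _ _; rewrite inE.
case/lastP: p => [|p y].
  by move=> _ _ /=; apply/bigcupP; exists x; [exact: (IH [::])|rewrite !inE eqxx].
rewrite rcons_path size_rcons ltnS last_rcons => /andP [pp l] sp /=.
by apply/bigcupP; exists (last x p); [exact: IH|rewrite !inE l orbT].
Qed.

Lemma card_bigcup (I : finType) (A : {set I}) (F : I -> {set V}) D :
  (forall i, i \in A -> #|F i| <= D) -> #|\bigcup_(i in A) F i| <= #|A| * D.
Proof.
move=> h; rewrite -sum_nat_const.
apply: (@leq_trans (\sum_(i in A) #|F i|)); last exact: leq_sum.
apply: (big_ind2 (fun (B : {set V}) m => #|B| <= m)); first by rewrite cards0.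
  by move=> B m B' m' h1 h2; rewrite cardsU; lia.
by [].
Qed.

Lemma card_ball D i x : (forall v, deg v <= D) -> #|ball i x| <= D.+1 ^ i.
Proof.
move=> h; elim: i => [|i IH] /=; first by rewrite cards1.
apply: leq_trans (card_bigcup (D := D.+1) _) _.
  by move=> y _; rewrite cardsU1; have := h y; rewrite /deg; lia.
by rewrite expnSr leq_mul2r IH orbT.
Qed.
End Ball.

(** * Blocks of consecutive vertices in an order *)

Section Chunk.
Variables (n : nat) (U : {set 'I_n}) (c : nat).
Definition sorted_by (r : 'I_n -> nat) := sort (relpre r leq) (enum U).
(** One vertex from each of the successive blocks gives a tuple that is increasing for [r], whatever
    the choices inside the blocks. *)
Definition chunk r i : {set 'I_n} := [set x in take c (drop (i * c) (sorted_by r))].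

Lemma card_chunk r i : i.+1 * c <= #|U| -> #|chunk r i| = c.
Proof.
move=> h; rewrite cardsE; set s := take _ _.
have us : uniq s by rewrite take_uniq // drop_uniq // sort_uniq enum_uniq.
have sz : size (sorted_by r) = #|U| by rewrite size_sort -cardE.
rewrite (card_uniqP us) size_take size_drop sz; move: #|U| h => N.
by rewrite mulSn; case: ltnP => //; lia.
Qed.

Lemma chunk_sub r i x : x \in chunk r i -> x \in U.
Proof. by rewrite inE => /mem_take /mem_drop; rewrite mem_sort mem_enum. Qed.

Lemma chunk_lt (r : 'I_n -> nat) i j x y : injective r -> i < j -> x \in chunk r i -> y \in chunk r j -> r x < r y.
Proof.
move=> ri ij; rewrite !inE; set s := sorted_by r.
have idx l z : z \in take c (drop (l * c) s) -> exists2 a, l * c <= a < l.+1 * c & (a < size s) && (z == nth x s a).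
  move=> /(nthP x) [a]; rewrite size_take size_drop => ha <-.
  rewrite nth_take; last by move: ha; case: ifP; lia.
  rewrite nth_drop; exists (l * c + a); first by rewrite mulSn; move: ha; case: ifP; lia.
  rewrite eqxx andbT; move: ha; case: ifP; by move: (size s) => N; lia.
move=> /idx [a ha /andP [sa /eqP Ex]] /idx [b hb /andP [sb /eqP Ey]].
have ab : a < b.
  have : i.+1 * c <= j * c by rewrite leq_mul2r ij orbT.
  by case/andP: ha; case/andP: hb; lia.
have so : sorted (relpre r leq) s by apply: sort_sorted => u v; apply: leq_total.
have le : r (nth x s a) <= r (nth x s b).
  have tr : transitive (relpre r leq) by move=> u v w; apply: leq_trans.
  have rf : reflexive (relpre r leq) by move=> u /=.
  by apply: (sorted_leq_nth tr rf x so); rewrite ?inE //; exact: ltnW.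
have ne : nth x s a != nth x s b.
  by rewrite nth_uniq // ?sort_uniq ?enum_uniq // neq_ltn ab.
rewrite Ex Ey ltn_neqAle le andbT; apply: contra ne => /eqP /ri /eqP.
by [].
Qed.
End Chunk.

(* Pick the vertices of the tuple one after the other, each time one that is in
   the right chunk for a positive proportion of the remaining orders. *)
Lemma choose_tuple n (g : rel 'I_n) (T : finType) (R : {set T}) (ch : T -> nat -> {set 'I_n})
    k d b c a Q j :
  0 < n -> 0 < #|R| -> (forall x, #|ball g d x| <= b) ->
  (forall r i, r \in R -> i < k -> c <= #|ch r i|) -> a + k * b <= c -> n <= Q * a -> j <= k ->
  exists (s : seq 'I_n) (R' : {set T}),
   [/\ size s = j, R' \subset R, #|R| <= #|R'| * Q ^ j,
       forall x0 r i, r \in R' -> i < j -> nth x0 s i \in ch r i &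
       forall x0 i i', i < j -> i' < i -> nth x0 s i \notin ball g d (nth x0 s i')].
Proof.
move=> n0 R0 hb hc ha hQ; elim: j => [|j IH] jk.
  by exists [::], R; split=> //; rewrite expn0 muln1.
have [s [R' [ss sR cR mem nb]]] := IH (ltnW jk).
(* The balls around earlier choices cover at most [k * b] of the [c] vertices of a chunk; the [a]
   vertices left over are at least a fraction 1/Q of all vertices. *)
pose Bs := \bigcup_(x in [set x in s]) ball g d x.
have cB : #|Bs| <= k * b.
  apply: leq_trans (card_bigcup (D := b) _) _ => //.
  by rewrite leq_mul2r cardsE; apply/orP; right; apply: leq_trans (card_size s) _; rewrite ss ltnW.
have hcard r : r \in R' -> a <= #|ch r j :\: Bs|.
  move=> rR'; rewrite cardsD.
  have : #|ch r j :&: Bs| <= #|Bs| by apply: subset_leq_card; exact: subsetIr.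
  have := hc r j (subsetP sR _ rR') jk; move: cB ha; clear.
  by move: #|_ :&: _| #|Bs| #|ch r j|; lia.
have [v hv] := pigeonhole n0 hcard.
  exists (rcons s v), [set r in R' | v \in ch r j :\: Bs]; split.
  - by rewrite size_rcons ss.
  - by apply/subsetP => r; rewrite inE => /andP [/(subsetP sR)].
  - move: hv; set Z := #|[set r in R' | _]| => hv; apply: leq_trans cR _.
    have : #|R'| <= Z * Q.
      have : #|R'| * a <= Z * (Q * a) by apply: leq_trans hv _; rewrite leq_mul2l hQ orbT.
      by rewrite mulnA leq_pmul2r //; case: (a) hQ => //; rewrite muln0; lia.
    by rewrite expnS mulnA => h; rewrite leq_mul2r h orbT.
  - move=> x0 r i; rewrite inE => /andP [rR']; rewrite inE => /andP [vB vc].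
    rewrite ltnS leq_eqVlt nth_rcons ss => /orP [/eqP ->|ij]; first by rewrite ltnn eqxx.
    by rewrite ij; exact: mem.
  - move=> x0 i i'; rewrite ltnS leq_eqVlt !nth_rcons ss => /orP [/eqP ->|ij] i'i.
      rewrite ltnn eqxx i'i.
      have /set0Pn [r] : [set r in R' | v \in ch r j :\: Bs] != set0.
        rewrite -card_gt0; move: hv; case: #|[set r in R' | _]| => //; rewrite mul0n.
        have : 0 < #|R'| by move: R0 cR; case: #|R'| => //; rewrite mul0n; lia.
        have : 0 < a by case: (a) hQ => //; rewrite muln0; lia.
        by nia.
      rewrite !inE => /and3P [_ vB _]; apply: contra vB => h.
      by apply/bigcupP; exists (nth x0 s i') => //; rewrite inE mem_nth // ss.
    by rewrite ij (ltn_trans i'i ij); exact: nb.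
Qed.

(** * Adding sparse copies of F until no order is left *)

Section Sparse.
Variables (k : nat) (f : rel 'I_k).
Hypothesis fsimp : simple_graph f.
Hypothesis fbi : biconnected f.
Let kgt := k_gt2 fbi.

Definition orderable (V : Type) (g : rel V) := exists r : V -> nat, injective r /\ free f g r.
Definition add_copy (V : finType) (g : rel V) (e : 'I_k -> V) : rel V :=
  fun x y => g x y || base f (fun _ : unit => e) x y.

(** The old graph plays the role of the gadget, and the new copy that of the base graph on its
    terminals. *)
Lemma add_copy_gluing (V : finType) (g : rel V) (e : 'I_k -> V) : gadget f g e ->
  gluing g e (mem (codom e)) (base f (fun _ : unit => e)) (fun _ : unit => e)
    (fun _ : unit => id) (add_copy g e).
Proof.
move=> G; have ei c a c' a' : (fun _ : unit => e) c a = (fun _ : unit => e) c' a' -> c = c' /\ a = a'.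
  by move=> /(gd_inj G) ->; case: c; case: c'.
split=> //.
- by move=> _ t; exact: codom_f.
- by move=> _; exact: gd_inj G.
- by move=> [] v [] v'.
- by move=> x y /baseP [_ [a [b [_ -> ->]]]]; split; exact: codom_f.
- exact: base_sym.
- exact: base_irr.
- move=> x y; rewrite /add_copy; split.
    by case/orP => [xy|->]; [right; exists tt, x, y|left].
  by case=> [->|[_ [u [v [uv -> ->]]]]]; rewrite ?orbT ?uv.
Qed.

Section Greedy.
Variables (n p : nat).
(** Each of the [k] choices keeps at least a fraction 1/Q of the orders, hence a fraction 1/q in
    total. The process adds at most [q * (n * p.+1)] copies, each raising the degree sum by at most
    [k * k]; [Delta] is twice the resulting bound on the average degree, and [D] allows for one more
    copy at a vertex of degree [Delta]. *)
Let Q := 8 * k.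
Let q := Q ^ k.
Let Delta := 2 * q * k * k * p.+1.
Let D := Delta + k.
Let b := D.+1 ^ k.
Hypothesis n_def : n = 2 ^ p.
Hypothesis n_big : 8 * k * (1 + k * b) <= n.
(** The assumption to be refuted: a failure of it provides the forcing gadget. *)
Hypothesis noS : forall (g : rel 'I_n) (e : 'I_k -> 'I_n), gadget f g e ->
  orderable g -> orderable (add_copy g e).

Definition surv (g : rel 'I_n) : {set {ffun 'I_n -> 'I_n}} :=
  [set r : {ffun 'I_n -> 'I_n} | injectiveb r && `[<free f g (fun x => r x : nat)>]].

Lemma q_gt0 : 0 < q.
Proof. by rewrite /q expn_gt0 /Q; lia. Qed.

Lemma rank_normalize (V : finType) (r : V -> nat) m : injective r -> #|V| = m ->
  exists r' : V -> 'I_m, forall x y, (r' x < r' y) = (r x < r y).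
Proof.
move=> ri Em; pose A x := [set y | r y < r x].
have lt x : #|A x| < m.
  rewrite -Em -cardsT; apply: proper_card; apply/properP; split; first exact: subsetT.
  by exists x; rewrite ?inE // ltnn.
exists (fun x => Ordinal (lt x)) => x y /=.
have mono u v : r u < r v -> #|A u| < #|A v|.
  move=> uv; apply: proper_card; apply/properP; split; last by exists u; rewrite !inE ?ltnn.
  by apply/subsetP => z; rewrite !inE => /ltn_trans; apply.
case: (ltngtP (r x) (r y)) => [/mono //|/mono|/ri ->]; last by rewrite ltnn.
by move=> h; apply/negbTE; rewrite -leqNgt; apply: ltnW.
Qed.

Lemma orderable_surv g : orderable g -> 0 < #|surv g|.
Proof.
case=> r [ri fr]; have [r' r'P] := rank_normalize ri (card_ord n).
apply/card_gt0P; exists [ffun x => r' x]; rewrite inE; apply/andP; split.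
  apply/injectiveP => x y; rewrite !ffunE => Exy; apply: ri; apply/eqP.
  have := r'P x y; have := r'P y x; rewrite Exy ltnn; case: ltngtP => //.
apply/asboolP; apply: free_iso fr => x y; rewrite !ffunE.
by rewrite r'P.
Qed.

(** State after [s] copies; the last bound says that at most a fraction [(1 - 1/q) ^ s] of the
    [n ^ n] maps are still F-free orders. *)
Definition inv s (g : rel 'I_n) : Prop :=
  [/\ symmetric g, irreflexive g, clean f g & orderable g] /\
  [/\ forall v, deg g v <= D, \sum_v deg g v <= s * (k * k) &
      #|surv g| * q ^ s <= n ^ n * q.-1 ^ s].

Lemma inv0 : inv 0 (fun _ _ => false).
Proof.
have nocp : forall phi, ~ copy f (fun _ _ : 'I_n => false) phi.
  move=> phi [_ h]; have k0 : 0 < k by lia.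
  by have [y /h] := f_nbr fbi (Ordinal k0).
have dg v : deg (fun _ _ : 'I_n => false) v = 0.
  by rewrite /deg; apply/eqP; rewrite cards_eq0; apply/eqP/setP => x; rewrite !inE.
split; split=> //; try by move=> phi /nocp.
- by exists (fun x => x : nat); split; [exact: ord_inj|move=> phi /nocp].
- by move=> v; rewrite dg.
- by rewrite big1.
- by rewrite !expn0 !muln1; apply: leq_trans (max_card _) _; rewrite card_ffun card_ord.
Qed.

(** The new copy goes on a tuple that is increasing in at least a fraction 1/q of the surviving
    orders, and it destroys all of these. The tuple is taken among the vertices of degree at most
    [Delta], which by the degree sum are at least half of all. *)
Lemma invS s g : s < q * (n * p).+1 -> inv s g -> exists g', inv s.+1 g'.
Proof.
move=> st [[gs gi gc go] [gd gsum gq]].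
have n0 : 0 < n by rewrite n_def expn_gt0.
pose U := [set v | deg g v <= Delta].
have q0 := q_gt0.
have cU : n <= 2 * #|U|.
  have h1 : #|~: U| * Delta.+1 <= \sum_v deg g v.
    rewrite -sum_nat_const big_mkcond /=; apply: leq_sum => v _.
    by rewrite !inE -ltnNge; case: ifP.
  have := cardsC U; rewrite card_ord.
  have h2 : \sum_v deg g v <= q * (n * p.+1) * (k * k).
    apply: leq_trans gsum _; rewrite leq_mul2r; apply/orP; right.
    apply: leq_trans (ltnW st) _; rewrite leq_mul2l; apply/orP; right; rewrite mulnS; lia.
  have : 2 * #|~: U| <= n.
    have h : #|~: U| * Delta.+1 <= q * (n * p.+1) * (k * k) := leq_trans h1 h2.
    rewrite leqNgt; apply/negP => h3.
    have : n * Delta < 2 * (q * (n * p.+1) * (k * k)) + 1.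
      rewrite addn1 ltnS; apply: (@leq_trans (2 * (#|~: U| * Delta.+1))).
        rewrite mulnA; apply: leq_mul => //; exact: ltnW.
      by rewrite leq_mul2l h orbT.
    have : 2 * #|~: U| * Delta.+1 <= 2 * (q * (n * p.+1) * (k * k)) by rewrite -mulnA leq_mul2l h orbT.
    have : n.+1 * Delta.+1 <= 2 * #|~: U| * Delta.+1 by rewrite leq_mul2r h3 orbT.
    have -> : 2 * (q * (n * p.+1) * (k * k)) = n * Delta by rewrite /Delta; nia.
    move: (2 * #|~: U| * Delta.+1) Delta => A B; nia.
  by move: #|U| #|~: U|; lia.
pose c := n %/ (2 * k).
have kc : k * c <= #|U|.
  have : 2 * (k * c) <= 2 * #|U| by apply: leq_trans cU; rewrite mulnA mulnC leq_divM.
  by rewrite leq_pmul2l.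
pose a := c - k * b.
have hc : n < (c + 1) * (2 * k) by rewrite addn1 ltn_ceil // muln_gt0 /=; apply: ltn_trans kgt.
have kbc : k * b <= c.
  rewrite leqNgt; apply/negP => h.
  have : (c + 1) * (2 * k) <= k * b * (2 * k) by rewrite leq_mul2r; apply/orP; right; lia.
  move: hc n_big kgt; move: (k * b) => kb; clear; nia.
have ha : a + k * b <= c by rewrite /a subnK.
have hQ : n <= Q * a.
  rewrite /Q; have Ea : a + k * b = c by rewrite /a subnK.
  move: hc n_big kgt; rewrite -Ea; move: (k * b) => kb; clear; lia.
have R0 := orderable_surv go.
have chc r i : r \in surv g -> i < k -> c <= #|chunk U c (fun x => r x : nat) i|.
  by move=> _ ik; rewrite card_chunk //; apply: leq_trans kc; rewrite leq_mul2r ik orbT.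
have [sq [R' [ss sR cR mem nb]]] := choose_tuple n0 R0 (fun x => card_ball k x gd) chc ha hQ (leqnn k).
pose x0 := Ordinal n0.
pose e (i : 'I_k) := nth x0 sq i.
have R'0 : exists r, r \in R'.
  by apply/card_gt0P; move: cR; case: #|R'| => // h; move: (leq_trans R0 h); rewrite mul0n.
have incr_e r : r \in R' -> incr (fun i => r (e i)).
  move=> rR i j ij; have := subsetP sR _ rR; rewrite inE => /andP [/injectiveP ri _].
  apply: (@chunk_lt _ U c (fun x => r x : nat) i j) ij _ _.
  - by move=> x y /ord_inj /ri.
  - exact: (mem x0 r i rR (ltn_ord i)).
  - exact: (mem x0 r j rR (ltn_ord j)).
have eU i : e i \in U.
  by have [r rR'] := R'0; exact: (chunk_sub (mem x0 r i rR' (ltn_ord i))).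
have ei : injective e.
  have [r rR'] := R'0; move=> i j Eij; apply/ord_inj.
  by case: (ltngtP i j) => // /(incr_e _ rR'); rewrite Eij ltnn.
have efar : far k g e.
  have h (i j : 'I_k) pp : i < j -> path g (e i) pp -> last (e i) pp = e j -> k < size pp.
    move=> ij hp hl; rewrite ltnNge; apply/negP => sp.
    by have := ball_path hp sp; rewrite hl; apply/negP; exact: nb.
  move=> i j pp ij hp hl; case: (ltngtP i j) => [|ji|/ord_inj Eij].
  - by move=> ij'; exact: h hl.
  - have -> : size pp = size (rev (belast (e i) pp)) by rewrite size_rev size_belast.
    apply: (h j i) => //.
      by rewrite -hl rev_path; rewrite (@eq_path _ _ g) // => x y; rewrite gs.
    rewrite -hl; case: pp {hp hl} => //= y pp; by rewrite rev_cons last_rcons.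
  - by rewrite Eij eqxx in ij.
have G : gadget f g e by split.
have GL := add_copy_gluing G.
have ecc (c1 : unit) a1 (c2 : unit) a2 : (fun _ : unit => e) c1 a1 = (fun _ : unit => e) c2 a2 -> c1 = c2 /\ a1 = a2.
  by move=> /ei ->; case: c1; case: c2.
exists (add_copy g e); split; split.
- exact: (E_sym G GL).
- exact: (E_irr G GL).
- exact: (glue_clean fsimp fbi G GL (base_clean fbi ecc)).
- exact: noS.
- move=> v; have sub : [set w | add_copy g e v w] \subset
      [set w | g v w] :|: (if v \in codom e then [set e i | i : 'I_k] else set0).
    apply/subsetP => w; rewrite !inE => /orP [->//|/baseP [_ [x [y [_ -> ->]]]]].
    by rewrite codom_f; apply/orP; right; apply: imset_f.
  apply: leq_trans (subset_leq_card sub) _; rewrite cardsU.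
  case: (boolP (v \in codom e)) => [/codomP [i Ei]|_]; last first.
    by rewrite cards0; apply: leq_trans (leq_subr _ _) _; rewrite addn0; exact: gd.
  have := eU i; rewrite -Ei inE /deg /D => h.
  have h' : #|[set e i | i : 'I_k]| <= k by rewrite card_imset // card_ord.
  by apply: leq_trans (leq_subr _ _) _; exact: leq_add.
- have sub v : deg (add_copy g e) v <= deg g v + (if v \in codom e then k else 0).
    have sub : [set w | add_copy g e v w] \subset
        [set w | g v w] :|: (if v \in codom e then [set e i | i : 'I_k] else set0).
      apply/subsetP => w; rewrite !inE => /orP [->//|/baseP [_ [x [y [_ -> ->]]]]].
      by rewrite codom_f; apply/orP; right; apply: imset_f.
    apply: leq_trans (subset_leq_card sub) _; rewrite cardsU /deg.
    apply: leq_trans (leq_subr _ _) _; rewrite leq_add2l.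
    case: (v \in codom e); last by rewrite cards0.
    by rewrite card_imset // card_ord.
  apply: leq_trans (leq_sum _ (fun v _ => sub v)) _.
  rewrite big_split /= -big_mkcond /= sum_nat_const mulSn addnC.
  apply: leq_add => //; rewrite leq_mul2r card_codom // card_ord leqnn orbT //.
- have sub : surv (add_copy g e) \subset surv g :\: R'.
    apply/subsetP => r; rewrite !inE => /andP [ri /asboolP fr].
    rewrite ri /=; apply/andP; split; last first.
      by apply/asboolP; exact: (free_glue_pi GL (j := tt) fr).
    apply/negP => /incr_e ie; apply: (@free_base _ f _ _ (fun _ : unit => e) ecc (fun x => r x : nat) tt).
      exact: (free_glue_bs GL fr).
    exact: Apat_incr.
  have := subset_leq_card sub; rewrite cardsD (setIidPr sR).
  have := subset_leq_card sR.
  move: cR gq; rewrite -/q; move: #|surv g| #|R'| #|surv (add_copy g e)| => A B C cR gq h1 h2.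
  rewrite !expnS.
  have h3 : C * q <= A * q.-1.
    apply: (@leq_trans ((A - B) * q)); first by rewrite leq_mul2r h2 orbT.
    by rewrite mulnBl -subn1 mulnBr muln1; exact: leq_sub2l.
  move: gq h3; move: (q ^ s) (q.-1 ^ s) (n ^ n) => X Y Z gq h3.
  apply: (@leq_trans (A * q.-1 * X)); first by rewrite mulnA leq_mul2r h3 orbT.
  rewrite [Z * _]mulnCA -mulnA mulnCA leq_mul2l gq orbT //.
Qed.

(** The [n ^ n = 2 ^ (n * p)] maps are halved every [q] rounds, so less than one survives
    [q * (n * p).+1] rounds, although the graph is still orderable. *)
Lemma greedy_false : False.
Proof.
have n0 : 0 < n by rewrite n_def expn_gt0.
have q0 := q_gt0.
pose t := q * (n * p).+1.
have [g [[_ _ _ go] [_ _ gq]]] : exists g, inv t g.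
  have : t <= t by []; move: {1 3}t; elim=> [|s IH] h; first by exists (fun _ _ => false); exact: inv0.
  by have [g ig] := IH (ltnW h); exact: invS ig.
have := orderable_surv go; move: gq; move: #|_| => A gq A0.
have h1 : 2 ^ (n * p).+1 * q.-1 ^ t <= q ^ t.
  rewrite /t !expnM -expnMn leq_exp2r //.
  by have := double_expn_le q.-1; rewrite prednK.
have h2 : q ^ t <= n ^ n * q.-1 ^ t by apply: leq_trans gq; rewrite leq_pmull.
have E : n ^ n = 2 ^ (n * p) by rewrite {1}n_def -expnM mulnC.
move: h1; rewrite expnS -E => h1.
have : 0 < q ^ t by rewrite expn_gt0 q0.
move: h1 h2; rewrite -mulnA; move: (n ^ n * _) (q ^ t) => X Y; lia.
Qed.
End Greedy.

(** If adding a copy destroys orderability, the graph before the addition is the gadget: an F-free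
    order with the tuple not placed like F would remain F-free, as gluing creates no further copies.
    The tuple is then renumbered along one F-free order. *)
Lemma forcing_gadget : exists (n : nat) (g : rel 'I_n) (e : 'I_k -> 'I_n),
  [/\ gadget f g e, rho f g e (fun i => i : nat) &
      forall s, rho f g e s -> Apat f s].
Proof.
(* Chosen so that [a * p.+1] bounds the number [D.+1] of the greedy process, which makes the lower
   bound on [n] polynomial in [p], while [n = 2 ^ p]. *)
pose a := 2 * (8 * k) ^ k * k * k + k + 1.
have [p hp] := exp2_beats_poly k a (8 * k * (1 + k)).
have [[n [g [e [G [go ngo]]]]]|no] := pselect (exists n (g : rel 'I_n) (e : 'I_k -> 'I_n),
    gadget f g e /\ orderable g /\ ~ orderable (add_copy g e)).
  have GL := add_copy_gluing G.
  have ecc (c1 : unit) a1 (c2 : unit) a2 : (fun _ : unit => e) c1 a1 = (fun _ : unit => e) c2 a2 -> c1 = c2 /\ a1 = a2.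
    by move=> /(gd_inj G) ->; case: c1; case: c2.
  have ap r : injective r -> free f g r -> Apat f (fun i => r (e i)).
    move=> ri fr; apply: contrapT => nap; apply: ngo; exists r; split=> //.
    apply: (glue_free fsimp fbi G GL) => [[]//|].
    by apply: (base_free fbi ecc) => -[].
  have [r [ri fr]] := go; have [h [Ah ih]] := ap r ri fr.
  exists n, g, (fun i => e (h i)); split.
  - split; [exact: gd_sym G|exact: gd_irr G| | |exact: gd_clean G].
      by move=> i j /(gd_inj G) /perm_inj.
    move=> i j pp ij; apply: (gd_far G); by rewrite (inj_eq perm_inj).
  - exists r; split=> // i j; apply/idP/idP; last exact: ih.
    apply: contraTT; rewrite -!leqNgt leq_eqVlt => /orP [/eqP/ord_inj -> //|/ih /ltnW //].
  - move=> s [r' [r'i fr' E]].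
    apply: (Apat_iso (s := fun i => r' (e (h i)))); first by move=> i j; rewrite E.
    exact: (Apat_Aut Ah (ap r' r'i fr')).
exfalso; apply: (@greedy_false (2 ^ p) p) => //.
- apply: leq_trans hp.
  set D1 := (2 * _ * k * k * p.+1 + k).+1.
  have h1 : D1 <= a * p.+1 by rewrite /D1 /a; move: ((8 * k) ^ k) => B; nia.
  have h2 : D1 ^ k <= (a * p.+1) ^ k by rewrite leq_exp2r //; lia.
  have h3 : 0 < (a * p.+1) ^ k by rewrite expn_gt0 /a; lia.
  rewrite -[X in _ <= X]mulnA leq_mul2l; apply/orP; right; move: h2 h3; move: (D1 ^ k) ((a * p.+1) ^ k) => A B; nia.
- move=> g e G go; apply: contrapT => ng; apply: no; exists (2 ^ p), g, e; by [].
Qed.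
End Sparse.

(** * Transpositions outside the automorphism group *)

Section Switches.
Variables (k : nat) (f : rel 'I_k).
Hypothesis fsimp : simple_graph f.
Hypothesis fbi : biconnected f.
Hypothesis fnc : ~ complete_graph f.

(** Conjugating the transposition of [y], [z] by that of [x], [y] gives that of [x], [z]. *)
Lemma twin_trans x y z : gAut f (tperm x y) -> gAut f (tperm y z) -> gAut f (tperm x z).
Proof.
have [->//|xy] := eqVneq x y; have [->//|yz] := eqVneq y z.
have [-> _ _|xz] := eqVneq x z; first by rewrite tperm1; exact: gAut1.
move=> h1 h2; have -> : tperm x z = (tperm y z ^ tperm x y)%g.
  by rewrite tpermJ tpermR tpermD // eq_sym.
by rewrite /conjg; apply: gAutM; [apply: gAutV|apply: gAutM].
Qed.

Lemma chain_twin lo hi :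
  (forall a b : 'I_k, b = a.+1 :> nat -> lo <= a -> b <= hi -> gAut f (tperm a b)) ->
  forall x y : 'I_k, lo <= x <= hi -> lo <= y <= hi -> gAut f (tperm x y).
Proof.
move=> h; have key d : forall x y : 'I_k, y = x + d :> nat -> lo <= x -> y <= hi -> gAut f (tperm x y).
  elim: d => [|d IH] x y.
    by rewrite addn0 => /ord_inj -> _ _; rewrite tperm1; exact: gAut1.
  move=> Ey lx yh; have yk : x + d < k by have := ltn_ord y; lia.
  apply: (@twin_trans x (Ordinal yk)); first by apply: IH => //=; lia.
  by apply: h => /=; lia.
move=> x y /andP [lx xh] /andP [ly yh]; case: (leqP x y) => xy.
  by apply: (key (y - x)); lia.
by rewrite tpermC; apply: (key (x - y)); lia.
Qed.

(** [v] has a neighbour, hence is joined to every vertex by the transpositions. F minus [v] is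
    connected and so has an edge, which the transpositions carry to all other pairs. *)
Lemma twins_complete v : ~ (forall x y, x != v -> y != v -> gAut f (tperm x y)).
Proof.
move=> tw; apply: fnc.
have vall y : y != v -> f v y.
  have [z vz] := f_nbr fbi v; move=> yv.
  have zv : z != v by apply: contraL vz => /eqP ->; rewrite f_irr.
  by have := tw z y zv yv v z; rewrite tpermL tpermD // vz.
have k2 := k_gt2 fbi.
have [x1 x1v] : exists x1, x1 != v.
  by have [z vz] := f_nbr fbi v; exists z; apply: contraL vz => /eqP ->; rewrite f_irr.
have [x2 x2v x12] : exists2 x2, x2 != v & x2 != x1.
  apply: contrapT => no; have : #|[set: 'I_k]| <= #|[set v; x1]|.
    apply: subset_leq_card; apply/subsetP => z _; rewrite !inE; apply: contraT.
    by rewrite negb_or => /andP [zv zx]; case: no; exists z.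
  by rewrite cardsT card_ord cards2; case: (v != x1); lia.
have [a [b [av bv ab]]] : exists a b, [/\ a != v, b != v & f a b].
  case: fbi => _ [_ /(_ v x1 x2 x1v x2v) /connectP [[|y p] /=]].
    by move=> _ E; rewrite E eqxx in x12.
  by case/andP => /and3P [h1 h2 h3] _ _; exists x1, y.
have ab' : a != b by apply: contraL ab => /eqP ->; rewrite f_irr.
have step x y z : f x y -> y != v -> z != v -> x != z -> f x z.
  move=> xy yv zv xz; have [<-//|yz] := eqVneq y z.
  have xy' : y != x by apply: contraL xy => /eqP ->; rewrite f_irr.
  rewrite eq_sym in xz.
  by have := tw y z yv zv x y; rewrite tpermL (tpermD xy' xz) xy.
move=> x y xy; have [E|xv] := eqVneq x v; first by rewrite E vall // -E eq_sym.
have [->|yv] := eqVneq y v; first by rewrite f_sym // vall.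
have [Eya|ya] := eqVneq y a.
  by rewrite f_sym //; apply: (step _ b); rewrite ?Eya // -Eya eq_sym.
have := step _ _ _ ab bv yv; rewrite eq_sym => /(_ ya) ay.
rewrite (f_sym fsimp) in ay; rewrite (f_sym fsimp).
by apply: (step y a x ay av xv); rewrite eq_sym.
Qed.

(** Otherwise all vertices but the last would be exchangeable, against [twins_complete]; the next
    lemma leaves out the first vertex instead. *)
Lemma adj_nonaut_below : exists a b : 'I_k, [/\ b = a.+1 :> nat, b.+1 < k & ~ gAut f (tperm a b)].
Proof.
have k2 := k_gt2 fbi; have k1 : k.-1 < k by lia.
apply: contrapT => no; apply: (@twins_complete (Ordinal k1)) => x y xv yv.
have lt (z : 'I_k) : z != Ordinal k1 -> z < k.-1.
  move=> zv; have : z != k.-1 :> nat by apply: contra zv => /eqP Ez; apply/eqP/ord_inj.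
  by have := ltn_ord z; lia.
apply: (@chain_twin 0 k.-2); try by have := lt _ xv; have := lt _ yv; lia.
move=> a b Eb _ hb; apply: contrapT => na; apply: no; exists a, b; split=> //; lia.
Qed.

Lemma adj_nonaut_above : exists a b : 'I_k, [/\ b = a.+1 :> nat, 0 < a & ~ gAut f (tperm a b)].
Proof.
have k2 := k_gt2 fbi; have k1 : 0 < k by lia.
apply: contrapT => no; apply: (@twins_complete (Ordinal k1)) => x y xv yv.
have lt (z : 'I_k) : z != Ordinal k1 -> 0 < z.
  by rewrite lt0n; apply: contra => /eqP Ez; apply/eqP; apply: ord_inj.
apply: (@chain_twin 1 k.-1); try by have := lt _ xv; have := lt _ yv; have := ltn_ord x; have := ltn_ord y; lia.
move=> a b Eb ha _; apply: contrapT => na; apply: no; exists a, b; split=> //.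
Qed.

Definition consec (a b c : 'I_k) := b = a.+1 :> nat /\ c = b.+1 :> nat.

(** The pair from [adj_nonaut_below] has a vertex above it and that from [adj_nonaut_above] one
    below it. If neither of the two resulting triples has two non-automorphisms, they show the two
    mixed patterns. *)
Lemma switches :
  (exists a b c, [/\ consec a b c, ~ gAut f (tperm a b) & ~ gAut f (tperm b c)]) \/
  (exists a b c, [/\ consec a b c, ~ gAut f (tperm a b) & gAut f (tperm b c)]) /\
  (exists a b c, [/\ consec a b c, gAut f (tperm a b) & ~ gAut f (tperm b c)]).
Proof.
case: (pselect (exists a b c, [/\ consec a b c, ~ gAut f (tperm a b) & ~ gAut f (tperm b c)])) => h.
  by left.
right; split.
  have [a [b [Eb hb na]]] := adj_nonaut_below; exists a, b, (Ordinal hb); split=> //.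
  by apply: contrapT => nb; apply: h; exists a, b, (Ordinal hb).
have [b [c [Ec hb nb]]] := adj_nonaut_above.
have ha : b.-1 < k by have := ltn_ord b; lia.
exists (Ordinal ha), b, c; split=> //; first by split=> //=; rewrite prednK.
apply: contrapT => na; apply: h; exists (Ordinal ha), b, c; split=> //.
by split=> //=; rewrite prednK.
Qed.
End Switches.

(** * Canonical gluing *)

Section Canon.
Variables (V X Z J : finType) (e : rel V) (tau : X -> V) (theta : J -> X -> Z).

Definition cpi (j : J) (v : V) : Z + J * V :=
  if [pick t | tau t == v] is Some t then inl (theta j t) else inr (j, v).
Definition isl (w : Z + J * V) : bool := if w is inl _ then true else false.
Definition cglue (bs : rel (Z + J * V)) : rel (Z + J * V) := fun x y =>
  bs x y || [exists j, exists u, exists v, [&& e u v, x == cpi j u & y == cpi j v]].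

Lemma canon_gluing (bs : rel (Z + J * V)) : injective tau -> (forall j, injective (theta j)) ->
  (forall x y, bs x y -> isl x /\ isl y) -> symmetric bs -> irreflexive bs ->
  gluing e tau isl bs (fun j t => inl (theta j t)) cpi (cglue bs).
Proof.
move=> ti thi hb bss bsi.
have cint j v : v \notin codom tau -> cpi j v = inr (j, v).
  move=> vn; rewrite /cpi; case: pickP => // t /eqP E; rewrite -E codom_f in vn; by [].
have cter j t : cpi j (tau t) = inl (theta j t).
  by rewrite /cpi; case: pickP => [t' /eqP /ti ->//|/(_ t)]; rewrite eqxx.
split=> //.
- by move=> j x y [] /thi.
- by move=> j v /(cint j) ->.
- move=> j v j' v' vn; rewrite (cint j) //.
  have [/codomP [t ->]|vn'] := boolP (v' \in codom tau); first by rewrite cter.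
  by rewrite cint // => -[-> ->].
- move=> x y; rewrite /cglue; split.
    case/orP => [->|/existsP [j /existsP [u /existsP [v /and3P [uv /eqP -> /eqP ->]]]]]; first by left.
    by right; exists j, u, v.
  case=> [->//|[j [u [v [uv -> ->]]]]]; apply/orP; right.
  by apply/existsP; exists j; apply/existsP; exists u; apply/existsP; exists v; rewrite uv !eqxx.
Qed.
End Canon.

(** * The frame *)

Section Frame.
Variables (k : nat) (f : rel 'I_k).
Hypothesis fsimp : simple_graph f.
Hypothesis fbi : biconnected f.
Hypothesis fnc : ~ complete_graph f.

(** The two positions [k] and [k.+1] will be replaced by other vertices; [k] positions remain on
    either side. *)
Definition M := (k + k).+2.
Definition natural : 'I_M -> nat := fun i => i.

Lemma rho_iso (V X : Type) (e : rel V) (tau : X -> V) (s s' : X -> nat) :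
  (forall t t', (s t < s t') = (s' t < s' t')) -> rho f e tau s -> rho f e tau s'.
Proof. by move=> E [r [h1 h2 h3]]; exists r; split=> // t t'; rewrite h3. Qed.

Lemma rho_inj (V X : finType) (e : rel V) (tau : X -> V) (s : X -> nat) :
  injective tau -> rho f e tau s -> injective s.
Proof.
move=> ti [r [h1 h2 h3]] t t' E; apply/ti/h1/eqP; have := h3 t t'; have := h3 t' t.
by rewrite E ltnn; case: ltngtP.
Qed.

(** Two realizable orders differ on each [k]-subset by an automorphism of F. In this form, which
    does not mention the natural order, the property survives a renumbering of the terminals. *)
Definition coherent (V : finType) (e : rel V) (tau : 'I_M -> V) : Prop :=
  forall s s', rho f e tau s -> rho f e tau s' -> forall h : 'I_k -> 'I_M,
    incr (fun a => s (h a)) -> Apat f (fun a => s' (h a)).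

Lemma sort_perm m (s : 'I_m -> nat) : injective s -> exists h : {perm 'I_m}, incr (fun a => s (h a)).
Proof.
move=> si; have [r rP] := rank_normalize si (card_ord m).
have ri : injective r.
  by move=> x y E; apply: si; apply/eqP; have := rP x y; have := rP y x; rewrite E ltnn; case: ltngtP.
by exists (perm ri)^-1%g => a b ab; rewrite -rP -!(permE ri) !permKV.
Qed.

(** The forcing gadget is glued on all increasing [k]-tuples. A tuple increasing for [s] differs
    from one of these by a permutation, which is an automorphism because the unique permutation
    sorting [s] on the tuple is one. *)
Lemma coherent_gadget : exists (V : finType) (e : rel V) (tau : 'I_M -> V),
  [/\ gadget f e tau, rho f e tau natural & coherent e tau].
Proof.
have [n [g [e [G nat_g ap]]]] := forcing_gadget fsimp fbi.
pose J : finType := {h : {ffun 'I_k -> 'I_M} | [forall a : 'I_k, forall b : 'I_k, (a < b) ==> (h a < h b)]}.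
have Jlt (h : J) (a b : 'I_k) : a < b -> val h a < val h b.
  by move=> ab; have /forallP /(_ a) /forallP /(_ b) /implyP := valP h; apply.
pose theta (h : J) := (val h : 'I_k -> 'I_M).
have thi h : injective (theta h).
  move=> a b E; apply/ord_inj; case: (ltngtP a b) => // /(Jlt h); rewrite /theta in E; by rewrite E ltnn.
pose bs : rel ('I_M + J * 'I_n)%type := fun _ _ => false.
have GL : gluing g e (@isl _ _ _) bs (fun j t => inl (theta j t)) (cpi e theta) (cglue g e theta bs).
  by apply: canon_gluing => //; exact: gd_inj G.
have nocp phi : ~ copy f bs phi.
  move=> [_ h]; have k0 : 0 < k by have := k_gt2 fbi; lia.
  by have [y /h] := f_nbr fbi (Ordinal k0).
exists ('I_M + J * 'I_n)%type, (cglue g e theta bs), inl; split.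
- by apply: (glue_gadget fsimp fbi G GL) => // x y [].
- pose r0 (w : 'I_M + J * 'I_n) := if w is inl i then nat_of_ord i else 0.
  have [] := glue_extend fsimp fbi G GL (r0 := r0).
  + by move=> [x|//] [y|//] _ _ /ord_inj ->.
  + by move=> phi cp; case: (nocp _ cp).
  + move=> j; apply: rho_iso nat_g => a b /=; apply/idP/idP; first exact: Jlt.
    apply: contraTT; rewrite -!leqNgt leq_eqVlt => /orP [/eqP/ord_inj -> //|/(Jlt j) /ltnW //].
  + by move=> r [h1 h2 h3]; exists r; split=> // t t'; rewrite h3.
- move=> s s' hs hs' h ih.
  have key s1 : rho f (cglue g e theta bs) inl s1 -> forall j : J, Apat f (fun a => s1 (theta j a)).
    move=> [r [ri fr Er]] j; apply: ap; exists (fun v => r (cpi e theta j v)); split.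
    - by apply: inj_comp ri _; exact: (pi_inj GL).
    - exact: (free_glue_pi GL).
    - by move=> t t'; rewrite !(gl_tau GL) Er.
  have si : injective s by apply: (rho_inj _ hs) => x y [].
  have hi : injective h.
    by move=> a b E; apply/ord_inj; case: (ltngtP a b) => // /ih; rewrite E ltnn.
  have [p ip] := sort_perm (s := fun a => h a : nat) (inj_comp (@ord_inj _) hi).
  pose h0 : {ffun 'I_k -> 'I_M} := [ffun a => h (p a)].
  have jP : [forall a : 'I_k, forall b : 'I_k, (a < b) ==> (h0 a < h0 b)].
    by apply/forallP => a; apply/forallP => b; apply/implyP => ab; rewrite !ffunE; exact: ip.
  pose j : J := Sub h0 jP.
  have Ej a : theta j a = h (p a) by rewrite /theta SubK ffunE.
  have [g1 [A1 i1]] := key _ hs j; have [g2 [A2 i2]] := key _ hs' j.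
  have E : (g1 * p = 1)%g.
    apply: (@incr_uniq _ (fun a => s (h a))) => //; first by apply: inj_comp.
      by move=> a b /i1; rewrite !Ej !permM.
    by move=> a b /ih; rewrite !perm1.
  exists (g2 * p)%g; split; last by move=> a b /i2; rewrite !Ej !permM.
  have -> : p = (g1^-1)%g by apply: (mulgI g1); rewrite E mulgV.
  by apply: gAutM => //; apply: gAutV.
Qed.

Definition otype (s : 'I_M -> nat) : {ffun 'I_M * 'I_M -> bool} := [ffun ij => s ij.1 < s ij.2].
Definition rhos (V : Type) (e : rel V) (tau : 'I_M -> V) : {set {ffun 'I_M * 'I_M -> bool}} :=
  [set o | `[<exists2 s, rho f e tau s & o = otype s>]].

(* Among coherent gadgets choose one with the fewest realizable orders: then no
   further constraints can exclude the natural order of the frame alone. *)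
Lemma frame_gadget : exists (V : finType) (e : rel V) (tau : 'I_M -> V),
  [/\ gadget f e tau, rho f e tau natural, coherent e tau &
   forall (V' : finType) (e' : rel V') (tau' : 'I_M -> V'), gadget f e' tau' ->
     (forall s, rho f e' tau' s -> rho f e tau s) -> (exists s, rho f e' tau' s) ->
     rho f e' tau' natural].
Proof.
pose P m := `[<exists (V : finType) (e : rel V) (tau : 'I_M -> V),
  [/\ gadget f e tau, rho f e tau natural, coherent e tau & #|rhos e tau| = m]>].
have exP : exists m, P m.
  have [V [e [tau [h1 h2 h3]]]] := coherent_gadget.
  by exists #|rhos e tau|; apply/asboolP; exists V, e, tau.
case: (ex_minnP exP) => m /asboolP [V [e [tau [G nat_e coh cm]]]] mmin.
exists V, e, tau; split=> // V' e' tau' G' sub [s hs]; apply: contrapT => nnat.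
have si := rho_inj (gd_inj G') hs.
have [h ih] := sort_perm si.
(* Renumbering along the realizable [s] makes the natural order realizable. As [tau'] misses the
   natural order, the renumbered gadget is coherent with strictly fewer realizable orders than the
   minimum. *)
pose tau2 t := tau' (h t).
have G2 : gadget f e' tau2.
  split; [exact: gd_sym G'|exact: gd_irr G'| | |exact: gd_clean G'].
    by move=> i j /(gd_inj G') /perm_inj.
  by move=> i j pp ij; apply: (gd_far G'); rewrite (inj_eq perm_inj).
have rho2 u : rho f e' tau2 u -> rho f e' tau' (fun t => u ((h^-1)%g t)).
  by move=> [r [h1 h2 h3]]; exists r; split=> // t t'; rewrite -h3 /tau2 !permKV.
have nat2 : rho f e' tau2 natural.
  case: hs => r [h1 h2 h3]; exists r; split=> // t t'; rewrite /tau2 h3.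
  apply/idP/idP; last exact: ih.
  by apply: contraTT; rewrite -!leqNgt leq_eqVlt => /orP [/eqP/ord_inj -> //|/ih /ltnW //].
have coh2 : coherent e' tau2.
  move=> u u' /rho2 /sub hu /rho2 /sub hu' h0 i0.
  have := coh _ _ hu hu' (fun a => h (h0 a)).
  have E w a : w ((h^-1)%g (h (h0 a))) = w (h0 a) :> nat by rewrite permK.
  move=> /(_ _) H; apply: Apat_iso (H _); first by move=> a b; rewrite !permK.
  by move=> a b ab; rewrite !permK; exact: i0.
have /mmin : P #|rhos e' tau2| by apply/asboolP; exists V', e', tau2.
rewrite -cm leqNgt => /negP; apply.
pose F (o : {ffun 'I_M * 'I_M -> bool}) : {ffun 'I_M * 'I_M -> bool} :=
  [ffun ij => o ((h^-1)%g ij.1, (h^-1)%g ij.2)].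
have Fi : injective F.
  move=> o o' /ffunP E; apply/ffunP => -[i j]; have := E (h i, h j).
  by rewrite !ffunE /= !permK.
rewrite -(card_imset _ Fi); apply: proper_card; apply/properP; split.
  apply/subsetP => o /imsetP [o0]; rewrite !inE => /asboolP [u hu ->] ->.
  apply/asboolP; exists (fun t => u ((h^-1)%g t)); first by apply/sub/rho2.
  by apply/ffunP => -[i j]; rewrite !ffunE.
exists (otype natural); first by rewrite inE; apply/asboolP; exists natural.
apply/imsetP => -[o]; rewrite inE => /asboolP [u hu ->] E.
apply: nnat; apply: rho_iso (rho2 _ hu) => t t'.
by have /ffunP /(_ (t, t')) := E; rewrite !ffunE /= => ->.
Qed.

Definition frame_index m : 'I_M := inord m.

(* Exchanging the i-th and (i+1)-th entries of [T (k-1) x] gives a tuple ordered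
   like [T x (k+2)], unless [s] puts [x] between its two neighbours. *)
Lemma frame_insert (s : 'I_M -> nat) : injective s ->
  (forall h : 'I_k -> 'I_M, incr (fun a => h a : nat) -> Apat f (fun a => s (h a))) ->
  (forall a b : 'I_M, a < b -> ~~ (k <= a <= k.+1) -> ~~ (k <= b <= k.+1) -> s a < s b) ->
  incr s.
Proof.
move=> si ap so.
have k2 := k_gt2 fbi.
have [i [i1 [Ei1 ik na]]] := adj_nonaut_below fsimp fbi fnc.
(* Lower entries stay below [k.-1] and higher ones go above [k.+2], so the entries [x] and [y] may
   use the four middle positions. *)
pose T (x y : nat) (a : 'I_k) : 'I_M := inord (if a < i then nat_of_ord a else
  if a == i then x else if a == i1 then y else a + k.+1 - i).
have TE x y a : y <= k.+2 -> x <= k.+2 -> T x y a = (if a < i then nat_of_ord a else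
    if a == i then x else if a == i1 then y else a + k.+1 - i) :> nat.
  move=> hy hx; rewrite inordK //; have := ltn_ord a; have := ltn_ord i; rewrite /M; clear -k2 hx hy.
  by case: ifP => //; [lia|case: ifP => _; [lia|case: ifP => _; lia]].
have lt_i (a : 'I_k) : a != i -> a != i1 -> ~~ (a < i) -> i1 < a.
  move=> h1 h2; rewrite -leqNgt leq_eqVlt => /orP [/eqP E|].
    by case/eqP: h1; apply: ord_inj.
  rewrite leq_eqVlt -Ei1 => /orP [/eqP E|//].
  by case/eqP: h2; apply: ord_inj.
have Tincr x y : k.-1 <= x -> x < y -> y <= k.+2 -> incr (fun a => T x y a : nat).
  move=> h1 h2 h3 a b ab; rewrite !TE; try lia.
  have [ai|ai] := boolP (a < i).
    case: ifP => [//|bi]; case: ifP => [_|/negbT bi']; first lia.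
    case: ifP => [_|/negbT bi1]; first lia.
    have := lt_i b bi' bi1 (negbT bi); lia.
  have bi : b < i = false by lia.
  rewrite bi; have [Ea|ai'] := eqVneq a i.
    have [Eb|bi'] := eqVneq b i; first by rewrite Ea Eb ltnn in ab.
    have [//|bi1] := eqVneq b i1.
    have := lt_i b bi' bi1 (negbT bi); lia.
  have bi' : b == i = false by apply/eqP => Eb; rewrite Eb in ab; lia.
  rewrite bi'; have [Ea|ai1] := eqVneq a i1.
    have [Eb|bi1] := eqVneq b i1; first by rewrite Ea Eb ltnn in ab.
    have := lt_i b (negbT bi') bi1 (negbT bi); lia.
  have := lt_i a ai' ai1 ai => h4.
  have bi1 : b == i1 = false by apply/eqP => Eb; rewrite Eb in ab; lia.
  rewrite bi1; lia.
have apT x y : k.-1 <= x -> x < y -> y <= k.+2 -> Apat f (fun a => s (T x y a)).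
  by move=> h1 h2 h3; apply: ap; exact: Tincr.
have ii1 : i != i1 by apply/eqP => E; move: Ei1; rewrite -E; lia.
have oth x y (a : 'I_k) : a != i -> a != i1 -> ~~ (k <= T x y a <= k.+1).
  move=> h1 h2; rewrite /T; have := ltn_ord a; have := ltn_ord i.
  rewrite (negbTE h1) (negbTE h2); case: ifP => [ai|/negbT /(lt_i a h1 h2)] *; rewrite inordK /M; lia.
have Tsame x y x' y' (a : 'I_k) : a != i -> a != i1 -> T x y a = T x' y' a.
  by move=> h1 h2; rewrite /T (negbTE h1) (negbTE h2).
have vi n (h : n < M) : frame_index n = n :> nat by rewrite inordK.
have Ti x y : T x y i = frame_index x by rewrite /T ltnn eqxx.
have Ti1 x y : T x y i1 = frame_index y.
  by rewrite /T Ei1 ltnNge leqnSn /= eq_sym (negbTE ii1) eqxx.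
have low x y (a : 'I_k) : a < i -> T x y a < k.-1.
  by move=> ai; rewrite /T ai inordK /M; lia.
have high x y (a : 'I_k) : i1 < a -> k.+2 < T x y a.
  move=> ai; have h1 : a == i = false by apply/eqP => E; rewrite E in ai; lia.
  have h2 : a == i1 = false by apply/eqP => E; rewrite E ltnn in ai.
  rewrite /T h1 h2; have -> : a < i = false by lia.
  by move: (ltn_ord a) ai; rewrite Ei1 => ? ?; rewrite inordK /M; lia.
have mid x : k <= x <= k.+1 ->
   s (frame_index k.-1) < s (frame_index x) < s (frame_index k.+2).
  move=> hx.
  have pm : k.-1 < M by rewrite /M; lia.
  have p2 : k.+2 < M by rewrite /M; lia.
  have px : x < M by rewrite /M; lia.
  have e12 : s (frame_index k.-1) < s (frame_index k.+2).
    by apply: so; rewrite !vi //; lia.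
  apply: contrapT => nb; apply: na.
  (* Outside the interval, [x] does not separate [k.-1] from [k.+2], so one of these can replace the
     other without changing a comparison. *)
  have bad : (s (frame_index x) < s (frame_index k.-1)) = (s (frame_index x) < s (frame_index k.+2)) /\
             (s (frame_index k.-1) < s (frame_index x)) = (s (frame_index k.+2) < s (frame_index x)).
    have n1 : s (frame_index x) != s (frame_index k.-1).
      by apply/eqP => /si /(congr1 (@nat_of_ord _)); rewrite !vi //; lia.
    have n2 : s (frame_index x) != s (frame_index k.+2).
      by apply/eqP => /si /(congr1 (@nat_of_ord _)); rewrite !vi //; lia.
    move/negP: nb; move: e12 n1 n2; clear.
    move: (s _) (s (frame_index x)) (s _); lia.
  have T1i : injective (T k.-1 x).
    have h := Tincr k.-1 x; move=> a b E; apply/ord_inj.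
    by case: (ltngtP a b) => // /h; rewrite E ltnn => h'; exfalso; apply: Bool.diff_false_true; apply: h'; lia.
  apply: (@Apat_swap _ f (fun a => s (T k.-1 x a))); first exact: inj_comp.
    by apply: apT; lia.
  apply: (Apat_iso _ (apT x k.+2 _ _ _)); try lia.
  have cmp (b : 'I_k) : b != i1 -> (s (T x k.+2 b) < s (frame_index k.-1)) = (s (T x k.+2 b) < s (frame_index k.+2)) /\
     (s (frame_index k.-1) < s (T x k.+2 b)) = (s (frame_index k.+2) < s (T x k.+2 b)).
    move=> bi1; have [->|bi] := eqVneq b i; first by rewrite Ti.
    have [bl|bh] := boolP (b < i).
      have h1 : s (T x k.+2 b) < s (frame_index k.-1).
        by apply: so; [rewrite (vi _ pm); exact: low|exact: oth|rewrite (vi _ pm); lia].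
      by move: h1 e12; clear; move: (s _) (s _) (s _); lia.
    have h1 : s (frame_index k.+2) < s (T x k.+2 b).
      apply: so; [|rewrite (vi _ p2); lia|exact: oth].
      by rewrite (vi _ p2); apply: high; apply: lt_i.
    by move: h1 e12; clear; move: (s _) (s _) (s _); lia.
  have L : forall a, s (T k.-1 x (tperm i i1 a)) = if a == i1 then s (frame_index k.-1) else s (T x k.+2 a).
    move=> a; case: tpermP => [->|->|/eqP h1 /eqP h2].
    - by rewrite (negbTE ii1) Ti Ti1.
    - by rewrite eqxx Ti.
    - by rewrite (negbTE h2) (Tsame _ _ x k.+2).
  move=> a b; rewrite !L; have [->|ha] := eqVneq a i1; have [->|hb] := eqVneq b i1 => //.
  - by rewrite !ltnn.
  - by rewrite Ti1; case: (cmp b hb).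
  - by rewrite Ti1; case: (cmp a ha).
have pM n : n <= k.+2 -> n < M by rewrite /M; lia.
(* If the two were inverted, exchanging the entries [i] and [i1] of [T k k.+1] would give an
   increasing tuple, and the transposition would be an automorphism. *)
have k_k1 : s (frame_index k) < s (frame_index k.+1).
  rewrite ltnNge; apply/negP => h.
  have h' : s (frame_index k.+1) < s (frame_index k).
    rewrite ltn_neqAle h andbT; apply/eqP => /si /(congr1 (@nat_of_ord _)); rewrite !vi ?pM //; lia.
  apply: na; apply: (@Apat_swap _ f (fun a => s (T k k.+1 a))).
  - apply: inj_comp => //; have hh := Tincr k k.+1; move=> a b E; apply/ord_inj.
    by case: (ltngtP a b) => // /hh; rewrite E ltnn => h''; exfalso; apply: Bool.diff_false_true; apply: h''; lia.
  - by apply: apT; lia.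
  apply: Apat_incr.
  have mk : k <= k <= k.+1 by lia.
  have mk1 : k <= k.+1 <= k.+1 by lia.
  have /andP [a1 a2] := mid k mk.
  have /andP [b1 b2] := mid k.+1 mk1.
  have L a : s (T k k.+1 (tperm i i1 a)) = if a == i then s (frame_index k.+1) else
       if a == i1 then s (frame_index k) else s (T k k.+1 a).
    case: tpermP => [->|->|/eqP h1 /eqP h2].
    - by rewrite eqxx Ti1.
    - by rewrite eqxx eq_sym (negbTE ii1) Ti.
    - by rewrite (negbTE h1) (negbTE h2).
  have lowv (a : 'I_k) : a < i -> s (T k k.+1 a) < s (frame_index k.-1).
    have pm := pM k.-1; move=> ai; apply: so.
    - by rewrite (vi _ (pm _)); [exact: low|lia].
    - by apply: oth; apply/eqP => E; rewrite E in ai; lia.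
    - by rewrite (vi _ (pm _)); lia.
  have highv (a : 'I_k) : i1 < a -> s (frame_index k.+2) < s (T k k.+1 a).
    have p2 := pM k.+2 (leqnn _); move=> ai; apply: so.
    - by rewrite (vi _ p2); exact: high.
    - by rewrite (vi _ p2); lia.
    - by apply: oth; apply/eqP => E; rewrite E in ai; lia.
  have ok (a : 'I_k) : a != i -> a != i1 -> (a < i) || (i1 < a).
    by move=> h1 h2; case: (boolP (a < i)) => //= h3; exact: lt_i.
  move=> a b ab; rewrite !L; have [Ea|ai] := eqVneq a i.
    have [Eb|bi] := eqVneq b i; first by rewrite Ea Eb ltnn in ab.
    have [//|bi1] := eqVneq b i1.
    have /orP [|/highv] := ok b bi bi1; first by rewrite Ea in ab; lia.
    by apply: ltn_trans.
  have [Ea|ai1] := eqVneq a i1.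
    have [Eb|bi] := eqVneq b i; first by rewrite Ea Eb in ab; lia.
    have [Eb|bi1] := eqVneq b i1; first by rewrite Ea Eb ltnn in ab.
    have /orP [|/highv] := ok b bi bi1; first by rewrite Ea in ab; lia.
    by apply: ltn_trans.
  have [Eb|bi] := eqVneq b i.
    have /orP [/lowv h1|] := ok a ai ai1; last by rewrite Eb in ab; lia.
    exact: ltn_trans h1 _.
  have [Eb|bi1] := eqVneq b i1.
    have /orP [/lowv h1|] := ok a ai ai1; last by rewrite Eb in ab; lia.
    exact: ltn_trans h1 _.
  apply: so => //; [|exact: oth|exact: oth].
  by apply: Tincr => //; lia.
have fi (a : 'I_M) : frame_index a = a by rewrite /frame_index inord_val.
move=> a b ab.
have [ma|na'] := boolP (k <= a <= k.+1); have [mb|nb'] := boolP (k <= b <= k.+1).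
- have Ea : a = k :> nat by lia.
  have Eb : b = k.+1 :> nat by lia.
  by rewrite -(fi a) -(fi b) Ea Eb.
- have /andP [_ h] := mid a ma; rewrite fi in h.
  have [Eb|b2] := eqVneq (b : nat) k.+2; first by rewrite -(fi b) Eb.
  apply: ltn_trans h _; apply: so => //; rewrite vi ?pM //; lia.
- have /andP [h _] := mid b mb; rewrite fi in h.
  have [Ea|a2] := eqVneq (a : nat) k.-1; first by rewrite -(fi a) Ea.
  apply: ltn_trans _ h; apply: so => //; rewrite vi ?pM //; lia.
- exact: so.
Qed.

End Frame.

Lemma incr_iso m (s s' : 'I_m -> nat) : incr s -> incr s' ->
  forall a b, (s a < s b) = (s' a < s' b).
Proof.
move=> i i' a b; case: (ltngtP a b) => [ab|ab|/ord_inj ->]; last by rewrite !ltnn.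
  by rewrite i // i'.
by have := i _ _ ab; have := i' _ _ ab; lia.
Qed.

(** * The clause gadget *)

Section Clause.
Variables (k : nat) (f : rel 'I_k).
Hypothesis fsimp : simple_graph f.
Hypothesis fbi : biconnected f.
Hypothesis fnc : ~ complete_graph f.
Let kgt := k_gt2 fbi.

Lemma not_Apat s (g : {perm 'I_k}) : injective s -> incr (fun a => s (g a)) -> ~ gAut f g -> ~ Apat f s.
Proof. by move=> si i na ap; apply: na; apply: (Apat_swap si ap); exact: Apat_incr. Qed.

(** * Rearranging three consecutive vertices of F *)

Section Mids.
Variables (a b c : 'I_k).
Hypothesis con : consec a b c.
Definition mid (d : 'I_k) := a <= d <= c.
(** Only the mutual order of [a], [b], [c] is left open; the lemmas below decide which arrangements
    avoid F. *)
Definition resp (u : 'I_k -> nat) := forall d d' : 'I_k, d < d' -> ~~ (mid d && mid d') -> u d < u d'.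

Lemma midP d : mid d -> [\/ d = a, d = b | d = c].
Proof.
rewrite /mid; case: con => E1 E2 h.
have : [|| nat_of_ord d == a, nat_of_ord d == b | nat_of_ord d == c] by lia.
by case/or3P => /eqP /ord_inj ->; [constructor 1|constructor 2|constructor 3].
Qed.

Lemma mid_a : mid a. Proof. by rewrite /mid; case: con; lia. Qed.
Lemma mid_b : mid b. Proof. by rewrite /mid; case: con; lia. Qed.
Lemma mid_c : mid c. Proof. by rewrite /mid; case: con; lia. Qed.

Lemma resp_incr u : resp u -> u a < u b -> u b < u c -> incr u.
Proof.
move=> ru h1 h2 d d' dd'; case: (boolP (mid d && mid d')) => [|/ru -> //].
case: con => E1 E2; case/andP => /midP [] Ed /midP [] Ed'; subst d d'; try by move: dd'; lia.
Qed.

Lemma resp_tperm u x y : mid x -> mid y -> resp u -> resp (fun d => u (tperm x y d)).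
Proof.
move=> mx my ru; have tm d : mid (tperm x y d) = mid d.
  by case: tpermP => [->|->|//]; rewrite ?mx ?my.
have tn d : ~~ mid d -> tperm x y d = d.
  by move=> nd; rewrite tpermD //; apply: contraNneq nd => <-.
have lt d d' : ~~ mid d -> mid d' -> forall d2, mid d2 -> (d < d2) = (d < d').
  by rewrite /mid => h1 h2 d2 h3; lia.
have lt' d d' : ~~ mid d -> mid d' -> forall d2, mid d2 -> (d2 < d) = (d' < d).
  by rewrite /mid => h1 h2 d2 h3; lia.
move=> d d' dd'; rewrite negb_and => nm; apply: ru; last by rewrite !tm negb_and.
case: (boolP (mid d)) nm => md /= nm; first by rewrite (tn d') // (lt' d' d) ?tm.
rewrite (tn d) //; case: (boolP (mid d')) => md'; first by rewrite (lt d d') ?tm.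
by rewrite (tn d').
Qed.

Lemma resp_bac u : injective u -> resp u -> u b < u a -> u a < u c ->
  ~ gAut f (tperm a b) -> ~ Apat f u.
Proof.
move=> ui ru h1 h2; apply: not_Apat => //; apply: resp_incr.
- by apply: resp_tperm => //; [exact: mid_a|exact: mid_b].
- by rewrite tpermL tpermR.
- rewrite tpermR tpermD //; case: con => E1 E2; apply/eqP => E; move: E1 E2; rewrite ?E; lia.
Qed.

Lemma resp_acb u : injective u -> resp u -> u a < u c -> u c < u b ->
  ~ gAut f (tperm b c) -> ~ Apat f u.
Proof.
move=> ui ru h1 h2; apply: not_Apat => //; apply: resp_incr.
- by apply: resp_tperm => //; [exact: mid_b|exact: mid_c].
- rewrite tpermL tpermD //; case: con => E1 E2; apply/eqP => E; move: E1 E2; rewrite ?E; lia.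
- by rewrite tpermL tpermR.
Qed.

(** The automorphism exchanging [b] and [c] turns the arrangement c < a < b into b < a < c. *)
Lemma resp_cab u : injective u -> resp u -> u c < u a -> u a < u b ->
  gAut f (tperm b c) -> ~ gAut f (tperm a b) -> ~ Apat f u.
Proof.
move=> ui ru h1 h2 A1 A2 ap.
have := Apat_Aut A1 ap; apply: resp_bac => //.
- by apply: inj_comp => //; exact: perm_inj.
- by apply: resp_tperm => //; [exact: mid_b|exact: mid_c].
- rewrite tpermL tpermD //; case: con => E1 E2; apply/eqP => E; move: E1 E2; rewrite ?E; lia.
- rewrite tpermR tpermD //; case: con => E1 E2; apply/eqP => E; move: E1 E2; rewrite ?E; lia.
Qed.

Lemma resp_bca u : injective u -> resp u -> u b < u c -> u c < u a ->
  gAut f (tperm a b) -> ~ gAut f (tperm b c) -> ~ Apat f u.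
Proof.
move=> ui ru h1 h2 A1 A2 ap.
have := Apat_Aut A1 ap; apply: resp_acb => //.
- by apply: inj_comp => //; exact: perm_inj.
- by apply: resp_tperm => //; [exact: mid_a|exact: mid_b].
- rewrite tpermL tpermD //; case: con => E1 E2; apply/eqP => E; move: E1 E2; rewrite ?E; lia.
- rewrite tpermR tpermD //; case: con => E1 E2; apply/eqP => E; move: E1 E2; rewrite ?E; lia.
Qed.

(** Vertices below [a] take values under [k] and those above [c] values over [B]; the interval from
    [k] to [B] is left to the three movable vertices. *)
Definition place (x y z B : nat) (d : 'I_k) : nat :=
  if d < a then nat_of_ord d else if d == a then x else if d == b then y else if d == c then z else B + d.

Lemma place_a x y z B : place x y z B a = x.
Proof. by rewrite /place ltnn eqxx. Qed.
Lemma place_b x y z B : place x y z B b = y.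
Proof.
rewrite /place eqxx; case: con => E1 E2; rewrite ifN; last by lia.
by rewrite ifN //; apply/eqP => E; move: E1; rewrite E; lia.
Qed.
Lemma place_c x y z B : place x y z B c = z.
Proof.
rewrite /place eqxx; case: con => E1 E2; rewrite ifN; last by lia.
by rewrite !ifN //; apply/eqP => E; move: E1 E2; rewrite E; lia.
Qed.

Lemma place_resp x y z B : k <= x < B -> k <= y < B -> k <= z < B -> resp (place x y z B).
Proof.
move=> hx hy hz.
have hm d : mid d -> k <= place x y z B d < B.
  by case/midP => ->; rewrite ?place_a ?place_b ?place_c.
have hl (d : 'I_k) : d < a -> place x y z B d = d by move=> h; rewrite /place h.
have hh (d : 'I_k) : c < d -> place x y z B d = B + d.
  case: con => E1 E2 h; rewrite /place ifN; last by lia.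
  by rewrite !ifN //; apply/eqP => E; rewrite E in h; lia.
move=> d d' dd' nm.
have := ltn_ord d; have := ltn_ord d'.
case: (ltnP d a) => da; case: (ltnP c d') => dc.
- by rewrite hl // hh //; lia.
- rewrite (hl d) //; case: (ltnP d' a) => da'; first by rewrite hl.
  by have := hm d'; rewrite /mid da' dc => /(_ isT); lia.
- rewrite (hh d') //; case: (ltnP c d) => dc'; first by rewrite hh //; lia.
  by have := hm d; rewrite /mid da dc' => /(_ isT); lia.
- by exfalso; move: nm; rewrite /mid; lia.
Qed.

Lemma place_inj x y z B : k <= x < B -> k <= y < B -> k <= z < B ->
  x != y -> y != z -> x != z -> injective (place x y z B).
Proof.
move=> hx hy hz n1 n2 n3 d d' E; have rs := place_resp hx hy hz.
apply/ord_inj; case: (ltngtP d d') => // dd'.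
  case: (boolP (mid d && mid d')) => [|/(rs _ _ dd')]; last by rewrite E ltnn.
  case/andP => /midP [] Ed /midP [] Ed'; subst d d'; move: E dd'; rewrite ?place_a ?place_b ?place_c => E;
    rewrite ?ltnn // => _; move: n1 n2 n3; rewrite E ?eqxx //.
case: (boolP (mid d' && mid d)) => [|/(rs _ _ dd')]; last by rewrite E ltnn.
case/andP => /midP [] Ed /midP [] Ed'; subst d d'; move: E dd'; rewrite ?place_a ?place_b ?place_c => E;
  rewrite ?ltnn // => _; move: n1 n2 n3; rewrite E ?eqxx //.
Qed.
End Mids.

(** * Switches: disjunctions of two comparisons *)

Let L := k + 4.
Definition o4 m : 'I_4 := inord m.
Definition o6 m : 'I_6 := inord m.
(** The spacing leaves free values just above each terminal, and the values [k] to [k + 3] below all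
    of them for auxiliary elements. *)
Definition scale (w : 'I_4 -> nat) (i : 'I_4) := L * (w i).+1.

(** [P] lists the comparisons that frames will enforce and [cc] the tuples that will carry copies of
    F, so the orders can be studied apart from the graphs. *)
Definition net_ok (T Y C : finType) (P : rel (T + Y)) (cc : C -> 'I_k -> Y) (u : T + Y -> nat) : Prop :=
  (forall x y, P x y -> u x < u y) /\
  forall c, injective (fun a => u (inr (cc c a))) /\ ~ Apat f (fun a => u (inr (cc c a))).

Definition sumfun (A B : Type) (g : A -> nat) (h : B -> nat) (x : A + B) :=
  match x with inl a => g a | inr b => h b end.

(** The terminals 0, 1, 2, 3 are x, y, y', z of the disjunction (y < x or z < y'). An extension is
    only required when x and y lie below y' and z, as will be the case in clauses. *)
Definition switch_net (Y C : finType) (P : rel ('I_4 + Y)) (cc : C -> 'I_k -> Y) : Prop :=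
  [/\ forall c a c' a', cc c a = cc c' a' -> c = c' /\ a = a',
      irreflexive P,
      forall u, injective u -> net_ok P cc u -> u (inl (o4 1)) < u (inl (o4 0)) \/ u (inl (o4 3)) < u (inl (o4 2)) &
      forall w : 'I_4 -> nat, [/\ w (o4 0) < w (o4 2), w (o4 0) < w (o4 3), w (o4 1) < w (o4 2) & w (o4 1) < w (o4 3)] ->
        w (o4 1) < w (o4 0) \/ w (o4 3) < w (o4 2) ->
        exists v : Y -> nat, net_ok P cc (sumfun (scale w) v)].

Lemma scale_facts w : exists B, [/\ forall i, L <= scale w i, forall i, scale w i + 4 < B &
  forall i j, w i < w j -> scale w i + 4 <= scale w j].
Proof.
exists (L * (\max_i w i).+2 + L); split.
- by move=> i; rewrite /scale leq_pmulr.
- move=> i; rewrite /scale.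
  have : L * (w i).+1 <= L * (\max_i w i).+1 by rewrite leq_mul2l ltnS (leq_bigmax i) orbT.
  by rewrite [L * _.+2]mulnS /L; move: (_ * _) (_ * _) kgt; lia.
- move=> i j ij; rewrite /scale.
  have : L * (w i).+2 <= L * (w j).+1 by rewrite leq_mul2l ltnS ij orbT.
  by rewrite [L * _.+2]mulnS; move: (_ * _) (_ * _); rewrite /L; lia.
Qed.

(** [P] imposes a < x, y < b < y' and z < c. If both disjuncts fail, a < b < c and F appears. If y <
    x, the arrangement b < a < c is possible, and if z < y', a < c < b is. *)
Lemma switch_net1 a b c : consec a b c -> ~ gAut f (tperm a b) -> ~ gAut f (tperm b c) ->
  exists (Y C : finType) (P : rel ('I_4 + Y)) (cc : C -> 'I_k -> Y), switch_net P cc.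
Proof.
move=> con na nb.
pose P : rel ('I_4 + 'I_k) := fun x y => match x, y with
  | inr d, inr d' => (d < d') && ~~ (mid a c d && mid a c d')
  | inr d, inl i => (d == a) && (i == o4 0) || (d == b) && (i == o4 2)
  | inl i, inr d => (d == b) && (i == o4 1) || (d == c) && (i == o4 3)
  | inl i, inl j => (i == o4 0) && (j == o4 3) end.
exists 'I_k, unit, P, (fun _ => id); split.
- by move=> [] x [] y.
- move=> [i|d] /=; last by rewrite ltnn.
  by apply/negP => /andP [/eqP -> /eqP /(congr1 val)]; rewrite /= !inordK.
- move=> u ui [uP /(_ tt) [_ nap]].
  case: (ltnP (u (inl (o4 1))) (u (inl (o4 0)))) => [|h1]; first by left.
  case: (ltnP (u (inl (o4 3))) (u (inl (o4 2)))) => [|h2]; first by right.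
  exfalso; apply: nap; apply: Apat_incr; apply: (resp_incr con).
  + by move=> d d' dd' nm; apply: uP; rewrite /= dd' nm.
  + have e1 : u (inr a) < u (inl (o4 0)) by apply: uP; rewrite /= !eqxx.
    have e2 : u (inl (o4 1)) < u (inr b) by apply: uP; rewrite /= !eqxx.
    exact: ltn_trans e1 (leq_ltn_trans h1 e2).
  + have e1 : u (inr b) < u (inl (o4 2)) by apply: uP; rewrite /= !eqxx orbT.
    have e2 : u (inl (o4 3)) < u (inr c) by apply: uP; rewrite /= !eqxx orbT.
    exact: ltn_trans e1 (leq_ltn_trans h2 e2).
- move=> w [w02 w03 w12 w13] lit; have [B [lo hi sp]] := scale_facts w.
  have hi0 := hi (o4 0); have hi1 := hi (o4 1); have hi2 := hi (o4 2); have hi3 := hi (o4 3).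
  have lo0 := lo (o4 0); have lo1 := lo (o4 1); have lo2 := lo (o4 2); have lo3 := lo (o4 3).
  have s02 := sp _ _ w02; have s03 := sp _ _ w03; have s12 := sp _ _ w12; have s13 := sp _ _ w13.
  have fin x y z : k <= x < B.+1 -> k <= y < B.+1 -> k <= z < B.+1 -> x != y -> y != z -> x != z ->
     x < scale w (o4 0) -> scale w (o4 1) < y -> y < scale w (o4 2) -> scale w (o4 3) < z ->
     ~ Apat f (place a b c x y z B.+1) -> exists v : 'I_k -> nat, net_ok P (fun _ : unit => id) (sumfun (scale w) v).
    move=> h1 h2 h3 n1 n2 n3 c1 c2 c3 c4 nap; exists (place a b c x y z B.+1); split.
      move=> [i|d] [j|d'] /=.
      - by case/andP => /eqP -> /eqP ->; lia.
      - by case/orP => /andP [/eqP -> /eqP ->]; rewrite ?(place_b con) ?(place_c con).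
      - by case/orP => /andP [/eqP -> /eqP ->]; rewrite ?place_a ?(place_b con).
      - by case/andP; exact: (place_resp con).
    by move=> _; split=> //; exact: (place_inj con).
  case: lit => /sp lit.
  + apply: (fin (scale w (o4 1) + 2) (scale w (o4 1) + 1) B); move: hi0 hi1 hi2 hi3 lo0 lo1 lo2 lo3 s02 s03 s12 s13 lit; rewrite /L; try lia.
    move=> *; apply: (resp_bac con) => //; rewrite ?place_a ?(place_b con) ?(place_c con); try lia.
      by apply: (place_inj con); lia.
    by apply: (place_resp con); lia.
  + apply: (fin k (scale w (o4 3) + 2) (scale w (o4 3) + 1)); move: hi0 hi1 hi2 hi3 lo0 lo1 lo2 lo3 s02 s03 s12 s13 lit; rewrite /L; try lia.
    move=> *; apply: (resp_acb con) => //; rewrite ?place_a ?(place_b con) ?(place_c con); try lia.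
      by apply: (place_inj con); lia.
    by apply: (place_resp con); lia.
Qed.

(* Element [m] links the constraints [y < x \/ m < x] and [z < y' \/ z < m]. *)
Lemma switch_net2 a b c a' b' c' : consec a b c -> ~ gAut f (tperm a b) -> gAut f (tperm b c) ->
  consec a' b' c' -> gAut f (tperm a' b') -> ~ gAut f (tperm b' c') ->
  exists (Y C : finType) (P : rel ('I_4 + Y)) (cc : C -> 'I_k -> Y), switch_net P cc.
Proof.
move=> con na ab con' ab' nb'.
pose Y : finType := option (bool * 'I_k).
pose mm (t : bool) d := if t then mid a' c' d else mid a c d.
pose P : rel ('I_4 + Y) := fun x y => match x, y with
  | inr (Some (t, d)), inr (Some (t', d')) => [&& t == t', d < d' & ~~ (mm t d && mm t d')]
  | inr (Some (t, d)), inl i => [&& t == false, d == a & i == o4 0] || [&& t == true, d == a' & i == o4 2]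
  | inl i, inr (Some (t, d)) => [&& t == false, d == b & i == o4 1] || [&& t == true, d == c' & i == o4 3]
  | inr None, inr (Some (t, d)) => (t == false) && (d == c)
  | inr (Some (t, d)), inr None => (t == true) && (d == b')
  | inl i, inl j => (i == o4 0) && (j == o4 3)
  | _, _ => false end.
pose cc (t : bool) (d : 'I_k) : Y := Some (t, d).
exists Y, bool, P, cc; split.
- by move=> t d t' d' [-> ->].
- move=> [i|[[t d]|]] //=; last by rewrite ltnn andbF.
  by apply/negP => /andP [/eqP -> /eqP /(congr1 val)]; rewrite /= !inordK.
- move=> u ui [uP uC].
  case: (ltnP (u (inl (o4 1))) (u (inl (o4 0)))) => [|h1]; first by left.
  case: (ltnP (u (inl (o4 3))) (u (inl (o4 2)))) => [|h2]; first by right.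
  exfalso.
  have e1 : u (inr (cc false a)) < u (inl (o4 0)) by apply: uP; rewrite /= !eqxx.
  have e2 : u (inl (o4 1)) < u (inr (cc false b)) by apply: uP; rewrite /= !eqxx.
  have e3 : u (inr None) < u (inr (cc false c)) by apply: uP; rewrite /= !eqxx.
  have e4 : u (inr (cc true a')) < u (inl (o4 2)) by apply: uP; rewrite /= !eqxx.
  have e5 : u (inr (cc true b')) < u (inr None) by apply: uP; rewrite /= !eqxx.
  have e6 : u (inl (o4 3)) < u (inr (cc true c')) by apply: uP; rewrite /= !eqxx.
  have e7 : u (inl (o4 0)) < u (inl (o4 3)) by apply: uP; rewrite /= !eqxx.
  have rs : resp a c (fun d => u (inr (cc false d))).
    by move=> d d' dd' nm; apply: uP; rewrite /= dd' nm.
  have rs' : resp a' c' (fun d => u (inr (cc true d))).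
    by move=> d d' dd' nm; apply: uP; rewrite /= dd' nm.
  have [inj1 nap1] := uC false; have [inj2 nap2] := uC true.
  (* Once a < b, both a < b < c and a < c < b spell F, the latter by the automorphism exchanging [b]
     and [c]; so c < a. *)
  have f1 : u (inr (cc false c)) < u (inr (cc false a)).
    rewrite ltnNge leq_eqVlt; apply/negP => /orP [/eqP/inj1 E|h].
      by case: con => E1 E2; move: E1 E2; rewrite E; lia.
    apply: nap1; case: (ltnP (u (inr (cc false b))) (u (inr (cc false c)))) => h'.
      by apply: Apat_incr; apply: (resp_incr con) => //; exact: ltn_trans e1 (leq_ltn_trans h1 e2).
    have hbc : u (inr (cc false c)) < u (inr (cc false b)).
      rewrite ltn_neqAle h' andbT; apply/eqP => /inj1 E; case: con => E1 E2; move: E2; rewrite E; lia.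
    have := Apat_Aut (gAutV ab) (s := fun d => u (inr (cc false (tperm b c d)))).
    move=> /(_ _) H; apply: Apat_iso (H _); first by move=> x y; rewrite !permKV.
    apply: Apat_incr; apply: (resp_incr con).
    - by apply: (@resp_tperm a c ( fun d => u (inr (cc false d)))) => //; [exact: (mid_b con)|exact: (mid_c con)].
    - by rewrite tpermL tpermD //; case: con => E1 E2; apply/eqP => E; move: E1 E2; rewrite ?E; lia.
    - by rewrite tpermL tpermR.
  have f2 : u (inr (cc true c')) < u (inr (cc true b')).
    rewrite ltnNge leq_eqVlt; apply/negP => /orP [/eqP/inj2 E|h].
      by case: con' => E1 E2; move: E2; rewrite E; lia.
    apply: nap2; case: (ltnP (u (inr (cc true a'))) (u (inr (cc true b')))) => h'.
      by apply: Apat_incr; apply: (resp_incr con').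
    have hab : u (inr (cc true b')) < u (inr (cc true a')).
      rewrite ltn_neqAle h' andbT; apply/eqP => /inj2 E; case: con' => E1 E2; move: E1; rewrite E; lia.
    have := Apat_Aut (gAutV ab') (s := fun d => u (inr (cc true (tperm a' b' d)))).
    move=> /(_ _) H; apply: Apat_iso (H _); first by move=> x y; rewrite !permKV.
    apply: Apat_incr; apply: (resp_incr con').
    - by apply: (@resp_tperm a' c' ( fun d => u (inr (cc true d)))) => //; [exact: (mid_a con')|exact: (mid_b con')].
    - by rewrite tpermL tpermR.
    - rewrite tpermR tpermD; first exact: ltn_trans e4 (leq_ltn_trans h2 e6).
        by case: con' => E1 E2; apply/eqP => E; move: E1 E2; rewrite ?E; lia.
      by case: con' => E1 E2; apply/eqP => E; move: E1 E2; rewrite ?E; lia.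
  (* The cycle m < c < a < x < z < c' < b' < m, with x < z taken from [P]. *)
  by move: e1 e3 e5 e6 e7 f1 f2; clear; lia.
- move=> w [w02 w03 w12 w13] lit; have [B [lo hi sp]] := scale_facts w.
  have hi0 := hi (o4 0); have hi1 := hi (o4 1); have hi2 := hi (o4 2); have hi3 := hi (o4 3).
  have lo0 := lo (o4 0); have lo1 := lo (o4 1); have lo2 := lo (o4 2); have lo3 := lo (o4 3).
  have s02 := sp _ _ w02; have s03 := sp _ _ w03; have s12 := sp _ _ w12; have s13 := sp _ _ w13.
  have fin m x y z x' y' z' : k <= x < B.+2 -> k <= y < B.+2 -> k <= z < B.+2 -> x != y -> y != z -> x != z ->
     k <= x' < B.+2 -> k <= y' < B.+2 -> k <= z' < B.+2 -> x' != y' -> y' != z' -> x' != z' ->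
     x < scale w (o4 0) -> scale w (o4 1) < y -> m < z ->
     x' < scale w (o4 2) -> y' < m -> scale w (o4 3) < z' ->
     ~ Apat f (place a b c x y z B.+2) -> ~ Apat f (place a' b' c' x' y' z' B.+2) ->
     exists v : Y -> nat, net_ok P cc (sumfun (scale w) v).
    move=> h1 h2 h3 n1 n2 n3 h1' h2' h3' n1' n2' n3' c1 c2 c3 c4 c5 c6 nap nap'.
    exists (fun q : Y => if q is Some (t, d) then
       if t then place a' b' c' x' y' z' B.+2 d else place a b c x y z B.+2 d else m); split.
      move=> [i|[[t d]|]] [j|[[t' d']|]] //=.
      - by case/andP => /eqP -> /eqP ->; lia.
      - case/orP => /and3P [/eqP -> /eqP -> /eqP ->]; first by rewrite (place_b con).
        by rewrite (place_c con').
      - by case/orP => /and3P [/eqP -> /eqP -> /eqP ->]; rewrite place_a.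
      - by case/and3P => /eqP <- dd' nm; case: t nm => nm; [apply: (place_resp con')|apply: (place_resp con)].
      - by case/andP => /eqP -> /eqP ->; rewrite (place_b con').
      - by case/andP => /eqP -> /eqP ->; rewrite (place_c con).
    by move=> [] /=; split=> //; [exact: (place_inj con')|exact: (place_inj con)].
  case: lit => /sp lit.
  (* Here m lies above all terminals, and the copies are placed as b < a < c and a' < c' < b'. *)
  + apply: (fin B (scale w (o4 1) + 2) (scale w (o4 1) + 1) B.+1 k (scale w (o4 3) + 2) (scale w (o4 3) + 1));
      move: hi0 hi1 hi2 hi3 lo0 lo1 lo2 lo3 s02 s03 s12 s13 lit; rewrite /L; try lia.
    * move=> *; apply: (resp_bac con) => //; rewrite ?place_a ?(place_b con) ?(place_c con); try lia.
        by apply: (place_inj con); lia.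
      by apply: (place_resp con); lia.
    * move=> *; apply: (resp_acb con') => //; rewrite ?place_a ?(place_b con') ?(place_c con'); try lia.
        by apply: (place_inj con'); lia.
      by apply: (place_resp con'); lia.
  (* Here m lies below all terminals, and the copies are placed as c < a < b and b' < c' < a'. *)
  + apply: (fin k.+1 k.+3 B k.+2 (scale w (o4 3) + 2) k (scale w (o4 3) + 1));
      move: hi0 hi1 hi2 hi3 lo0 lo1 lo2 lo3 s02 s03 s12 s13 lit; rewrite /L; try lia.
    * move=> *; apply: (resp_cab con) => //; rewrite ?place_a ?(place_b con) ?(place_c con); try lia.
        by apply: (place_inj con); lia.
      by apply: (place_resp con); lia.
    * move=> *; apply: (resp_bca con') => //; rewrite ?place_a ?(place_b con') ?(place_c con'); try lia.
        by apply: (place_inj con'); lia.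
      by apply: (place_resp con'); lia.
Qed.

Lemma switch_net_ex : exists (Y C : finType) (P : rel ('I_4 + Y)) (cc : C -> 'I_k -> Y), switch_net P cc.
Proof.
case: (switches fsimp fbi fnc) => [[a [b [c [h1 h2 h3]]]]|[[a [b [c [h1 h2 h3]]]] [a' [b' [c' [h1' h2' h3']]]]]].
  exact: switch_net1 h1 h2 h3.
exact: switch_net2 h1 h2 h3 h1' h2' h3'.
Qed.
End Clause.

(** * Three-literal clauses from four switches *)

Section ClauseNet.
Variables (k : nat) (f : rel 'I_k).
Hypothesis fsimp : simple_graph f.
Hypothesis fbi : biconnected f.
Hypothesis fnc : ~ complete_graph f.

(* Elements 0..5 are [p1 q1 p2 q2 p3 q3], and 6..9 are auxiliary elements [m r z z'].
   The rows read (m < p1 \/ z < r), (q2 < p2 \/ r < z), (q1 < m \/ z' < r), (q3 < p3 \/ r < z'). *)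
Definition rows : seq (seq nat) := [:: [:: 0; 6; 7; 8]; [:: 2; 3; 8; 7]; [:: 6; 1; 7; 9]; [:: 4; 5; 9; 7]].
Definition row (d i : 'I_4) : 'I_10 := inord (nth 0 (nth [::] rows d) i).

Lemma rowE d i : row d i = nth 0 (nth [::] rows d) i :> nat.
Proof. by rewrite inordK //; case: d => [[|[|[|[|//]]]] hd]; case: i => [[|[|[|[|//]]]] hi]. Qed.

Lemma row_inj d : injective (row d).
Proof.
move=> i j /(congr1 (@nat_of_ord _)); rewrite !rowE => E; apply: ord_inj; move: E.
by case: d => [[|[|[|[|//]]]] hd]; case: i => [[|[|[|[|//]]]] hi]; case: j => [[|[|[|[|//]]]] hj].
Qed.

Definition lits (g : nat -> nat) := [\/ g 1 < g 0, g 3 < g 2 | g 5 < g 4].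

Record clause_net (Z C : finType) (t : 'I_6 -> Z) (P : rel Z) (cc : C -> 'I_k -> Z) : Prop := {
  cn_inj : injective t;
  cn_cc : forall c a c' a', cc c a = cc c' a' -> c = c' /\ a = a';
  cn_t : forall i c a, t i != cc c a;
  cn_irr : irreflexive P;
  cn_sound : forall u : Z -> nat, injective u -> (forall x y, P x y -> u x < u y) ->
    (forall c, ~ Apat f (fun a => u (cc c a))) -> lits (fun n => u (t (o6 n)));
  cn_complete : forall w : 'I_6 -> nat, injective w -> lits (fun n => w (o6 n)) ->
    exists u : Z -> nat, [/\ forall x y, P x y -> u x < u y,
      forall c, injective (fun a => u (cc c a)) /\ ~ Apat f (fun a => u (cc c a)) &
      forall i j, (u (t i) < u (t j)) = (w i < w j)] }.

(** If q2 < p2 and q3 < p3 fail, the second and fourth rows give r < z and r < z', and then the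
    first and third give q1 < m < p1. *)
Lemma clause_net_ex : exists (Z C : finType) (t : 'I_6 -> Z) (P : rel Z) (cc : C -> 'I_k -> Z),
  clause_net t P cc.
Proof.
have [Y [C [P [cc [cci Pirr snd cmp]]]]] := switch_net_ex fsimp fbi fnc.
pose Z : finType := ('I_10 + 'I_4 * Y)%type.
pose lam (d : 'I_4) (x : 'I_4 + Y) : Z := match x with inl i => inl (row d i) | inr y => inr (d, y) end.
have lami d : injective (lam d).
  by move=> [i|y] [j|y'] //= [] => [/row_inj|] ->.
pose PZ : rel Z := fun x y => [exists d, exists s, exists t, [&& P s t, x == lam d s & y == lam d t]].
have PZP x y : PZ x y -> exists d s t, [/\ P s t, x = lam d s & y = lam d t].
  by case/existsP => d /existsP [s /existsP [t /and3P [h /eqP -> /eqP ->]]]; exists d, s, t.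
have PZI d s t : P s t -> PZ (lam d s) (lam d t).
  by move=> h; apply/existsP; exists d; apply/existsP; exists s; apply/existsP; exists t; rewrite h !eqxx.
pose t (i : 'I_6) : Z := inl (widen_ord (isT : 6 <= 10) i).
pose cZ (dc : 'I_4 * C) (a : 'I_k) : Z := inr (dc.1, cc dc.2 a).
have tE n : n < 6 -> t (o6 n) = inl (inord n).
  by move=> h; congr inl; apply: ord_inj; rewrite /= !inordK //; lia.
have rE d i : d < 4 -> i < 4 -> row (o4 d) (o4 i) = inord (nth 0 (nth [::] rows d) i).
  by move=> hd hi; apply: ord_inj; rewrite rowE !inordK //; move: d i hd hi; do 4 (case=> [|]; [do 4 (case=> //) |]); lia.
exists Z, ('I_4 * C)%type, t, PZ, cZ; split.
- by move=> i j [] /ord_inj.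
- by move=> [d c] a [d' c'] a' [] -> /cci [-> ->].
- by [].
- move=> x; case E0: (PZ x x) => //.
  by have [d [s [s' [h -> /lami E]]]] := PZP _ _ E0; rewrite E Pirr in h.
- move=> u ui uP uC.
  have key d : u (inl (row d (o4 1))) < u (inl (row d (o4 0))) \/ u (inl (row d (o4 3))) < u (inl (row d (o4 2))).
    apply: (snd (fun x => u (lam d x))); first by apply: inj_comp => //; exact: lami.
    split; first by move=> x y /(PZI d) /uP.
    move=> c; split; last exact: (uC (d, c)).
    by move=> a b /ui [] /cci [].
  rewrite /lits !tE //; move: (key (o4 0)) (key (o4 1)) (key (o4 2)) (key (o4 3)); rewrite !rE //=.
  pose g n := u (inl (inord n)); rewrite -!/(g _).
  case: (ltnP (g 3) (g 2)) => [_|h2]; first by constructor 2.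
  case: (ltnP (g 5) (g 4)) => [_|h3]; first by constructor 3.
  by move=> k0 k1 k2 k3; constructor 1; lia.
- move=> w wi lw; pose g n := w (o6 n).
  pose B := 2 * (\max_i w i) + 5.
  pose L2 := g 3 < g 2; pose L3 := g 5 < g 4.
  (* Doubling opens a gap just above q1, used for m when neither of the last two literals holds;
     otherwise m goes above or below all literals. The values from [B] on, for r, z and z', put the
     last two terminals of every row above the first two. *)
  pose W (n : nat) := if n < 6 then 2 * g n + 2 else
    if n == 6 then (if L2 then B.-1 else if L3 then 0 else 2 * g 1 + 3) else
    if n == 7 then B + 2 else
    if n == 8 then (if L2 then B else B + 3) else (if L3 then B + 1 else B + 4).
  have gB n : 2 * g n + 5 <= B by rewrite leq_add2r leq_mul2l (leq_bigmax (o6 n)).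
  pose wd d (i : 'I_4) := W (nth 0 (nth [::] rows d) i).
  have wdE (d : 'I_4) n : n < 4 -> wd d (o4 n) = W (nth 0 (nth [::] rows d) n).
    by move=> hn; rewrite /wd inordK.
  have ex (d : 'I_4) : exists v : Y -> nat, net_ok f P cc (sumfun (scale k (wd d)) v).
    have g0 := gB 0; have g1 := gB 1; have g2 := gB 2; have g3 := gB 3; have g4 := gB 4; have g5 := gB 5.
    have lw' : [\/ g 1 < g 0, L2 | L3] := lw.
    apply: cmp; rewrite !wdE //.
      by case: d => [[|[|[|[|//]]]] hd]; rewrite /= /W /=; case: (L2); case: (L3); split; lia.
    case: d => [[|[|[|[|//]]]] hd]; rewrite /= /W /=.
    - case: (boolP L2) lw' => h2; case: (boolP L3) => h3 lw'; try by [left; lia|right; lia].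
      by left; case: lw' => //; lia.
    - by case: (boolP L2) => h2; [left; move: h2; rewrite /L2|right]; lia.
    - by case: (boolP L2) => h2; case: (boolP L3) => h3; try by [left; lia|right; lia].
    - by case: (boolP L3) => h3; [left; move: h3; rewrite /L3|right]; lia.
  have [v vP] := choice ex.
  pose u (z : Z) := match z with inl x => (k + 4) * (W x).+1 | inr dy => v dy.1 dy.2 end.
  have uE d x : u (lam d x) = sumfun (scale k (wd d)) (v d) x.
    by case: x => [i|y] //=; rewrite /scale /wd rowE.
  exists u; split.
  + by move=> x y /PZP [d [s [s' [h -> ->]]]]; rewrite !uE; apply: (proj1 (vP d)).
  + by move=> [d c]; have [_ /(_ c)] := vP d.
  + move=> i j; rewrite /u /t /= ltn_pmul2l; last by lia.
    by rewrite ltnS /W !ltn_ord /g /o6 !inord_val; lia.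
Qed.
End ClauseNet.

(** * From the clause net to a gadget *)

Section ClauseGadget.
Variables (k : nat) (f : rel 'I_k).
Hypothesis fsimp : simple_graph f.
Hypothesis fbi : biconnected f.
Hypothesis fnc : ~ complete_graph f.
Variables (VB : finType) (eB : rel VB) (tauB : 'I_(M k) -> VB).
Hypothesis GB : gadget f eB tauB.
Hypothesis natB : rho f eB tauB (@natural k).
Hypothesis cohB : coherent f eB tauB.

(** For each comparison in [P] a frame gadget is glued with the two elements in positions [k] and
    [k.+1], and [frame_insert] makes it enforce the comparison. For the converse, elements lying
    between positions [k.+1] and [k.+2] keep all these frames in natural order. *)
Lemma clause_gadget : exists (V : finType) (e : rel V) (tau : 'I_(M k) + 'I_6 -> V),
  [/\ gadget f e tau,
      forall s, rho f e tau s -> rho f eB tauB (fun a => s (inl a)),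
      forall s, rho f e tau s -> incr (fun a => s (inl a)) -> lits (fun n => s (inr (o6 n))) &
      forall s, injective s -> incr (fun a => s (inl a)) ->
        (forall i, s (inl (frame_index k k.+1)) < s (inr i) < s (inl (frame_index k k.+2))) ->
        lits (fun n => s (inr (o6 n))) -> rho f e tau s].
Proof.
have [Z [C [t [P [cc N]]]]] := clause_net_ex fsimp fbi fnc.
have kgt := k_gt2 fbi.
pose Z0 : finType := ('I_(M k) + Z)%type.
(* Pairs outside [P], in particular diagonal ones, put the gadget on the frame itself; this passes
   the frame constraints on to the new gadget. *)
pose theta (xy : Z * Z) (i : 'I_(M k)) : Z0 :=
  if P xy.1 xy.2 then
    if i == k :> nat then inr xy.1 else if i == k.+1 :> nat then inr xy.2 else inl i
  else inl i.
have thi j : injective (theta j).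
  move=> a b; rewrite /theta; case: (boolP (P _ _)) => [h|_]; last by move=> [].
  have ne : j.1 != j.2 by apply: contraTN h => /eqP ->; rewrite (cn_irr N).
  have [Ea|na] := eqVneq (a : nat) k; have [Eb|nb] := eqVneq (b : nat) k.
  - by move=> _; apply: ord_inj; rewrite Ea Eb.
  - by case: eqP => // _ [] E; rewrite E eqxx in ne.
  - by case: eqP => // _ [] E; rewrite E eqxx in ne.
  - have [Ea|na1] := eqVneq (a : nat) k.+1; have [Eb|nb1] := eqVneq (b : nat) k.+1 => //.
      by move=> _; apply: ord_inj; rewrite Ea Eb.
    by move=> [].
pose cW c a : Z0 + (Z * Z) * VB := inl (inr (cc c a)).
have cWi c a c' a' : cW c a = cW c' a' -> c = c' /\ a = a' by move=> [] /(cn_cc N).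
pose bs := base f cW.
have GL : gluing eB tauB (@isl _ _ _) bs (fun j i => inl (theta j i)) (cpi tauB theta) (cglue eB tauB theta bs).
  apply: canon_gluing => //; first exact: gd_inj GB.
  - by move=> x y /baseP [c [a [b [_ -> ->]]]].
  - exact: base_sym.
  - exact: base_irr.
pose tau (x : 'I_(M k) + 'I_6) : Z0 + (Z * Z) * VB :=
  match x with inl a => inl (inl a) | inr i => inl (inr (t i)) end.
have GQ : gadget f (cglue eB tauB theta bs) tau.
  apply: (glue_gadget fsimp fbi GB GL).
  - exact: base_clean.
  - by move=> [a|i] [b|j] //= [] => [->|/(cn_inj N) ->].
  - by case.
  - move=> x y; case E0: (bs _ _) => //; case/baseP: E0 => c [a [b [_ + _]]].
    by case: x => [a'|i] //= [] /eqP; rewrite (negbTE (cn_t N _ _ _)).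
have inB r j : injective r -> free f (cglue eB tauB theta bs) r -> rho f eB tauB (fun i => r (inl (theta j i))).
  move=> ri fr; exists (fun v => r (cpi tauB theta j v)); split.
  - by apply: inj_comp ri _; exact: (pi_inj GL).
  - exact: (free_glue_pi GL).
  - by move=> a b; rewrite !(gl_tau GL).
pose z0 := t (o6 0).
exists (Z0 + (Z * Z) * VB)%type, (cglue eB tauB theta bs), tau; split; first exact: GQ.
- move=> s [r [ri fr Er]].
  have := inB r (z0, z0) ri fr; rewrite /theta /= (cn_irr N) => h.
  by apply: rho_iso h => a b; rewrite -Er.
- move=> s [r [ri fr Er]] is_.
  have lt x y : P x y -> r (inl (inr x)) < r (inl (inr y)).
    move=> Pxy; have h := inB r (x, y) ri fr.
    have : incr (fun i => r (inl (theta (x, y) i))).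
      apply: (frame_insert fsimp fbi fnc).
      - exact: (rho_inj (gd_inj GB) h).
      - move=> h0 ih; exact: (cohB natB h ih).
      - move=> a b ab na nb; rewrite /theta /= Pxy !ifN; try by move: na nb; lia.
        by have := Er (inl a) (inl b); rewrite /= => ->; exact: is_.
    move=> /(_ (frame_index k k) (frame_index k k.+1)); rewrite /theta /= Pxy !inordK /M; try lia.
    by rewrite eqxx ifN ?eqxx; [apply; lia|lia].
  have := cn_sound N (u := fun z => r (inl (inr z))).
  rewrite /lits => /(_ _ lt _) h; case: h.
  + by move=> x y /ri [].
  + move=> c; exact: (free_base cWi (free_glue_bs GL fr)).
  + by move=> h; constructor 1; rewrite -Er.
  + by move=> h; constructor 2; rewrite -Er.
  + by move=> h; constructor 3; rewrite -Er.
- move=> s si is_ ar lt.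
  have [u [uP uC uE]] := cn_complete N (w := fun i => s (inr i)) (inj_comp si (fun x y => @inr_inj _ _ x y)) lt.
  pose zr z := u z * #|Z| + enum_rank z.
  have zmono x y : u x < u y -> zr x < zr y.
    have lex a b n c d : a < b -> c < n -> a * n + c < b * n + d.
      move=> ab cn; have : a.+1 * n <= b * n by rewrite leq_mul2r ab orbT.
      by rewrite mulSnr; lia.
    by move=> h; apply: lex => //; exact: ltn_ord.
  have zri : injective zr.
    move=> x y /(congr1 (modn^~ #|Z|)).
    by rewrite /zr !modnMDl !modn_small ?ltn_ord // => /ord_inj /enum_rank_inj.
  pose U := (\max_z zr z).+1.
  have zU z : zr z < U by rewrite ltnS; exact: (leq_bigmax (F := zr)).
  pose fr0 (a : nat) := if a <= k.+1 then a else M k + U + a.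
  pose r0 (x : Z0 + (Z * Z) * VB) := match x with
    | inl (inl a) => fr0 a
    | inl (inr z) => M k + zr z
    | inr _ => 0 end.
  have fr_incr a b : a < b -> fr0 a < fr0 b.
    by rewrite /fr0 => ab; case: (leqP a k.+1) => ha; case: (leqP b k.+1) => hb; lia.
  have fr_z (a : nat) z : a < M k -> (fr0 a < M k + zr z) = (a <= k.+1) /\ (M k + zr z < fr0 a) = (k.+1 < a).
    by move=> ha; rewrite /fr0; have := zU z; case: (leqP a k.+1) => h; move: ha; clear; move: (zr z) U (M k) => ? ? ?; lia.
  have [] := glue_extend fsimp fbi GB GL (r0 := r0).
  + move=> [[a|x]|//] [[b|y]|//] _ _ /=.
    * case: (ltngtP a b) => [/fr_incr|/fr_incr|/ord_inj ->//]; lia.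
    * have [] := fr_z a y (ltn_ord a); lia.
    * have [] := fr_z b x (ltn_ord b); lia.
    * by move=> /addnI /zri ->.
  + apply: (base_free fbi cWi) => c; have [ci nap] := uC c.
    move=> ap; apply: nap; apply: Apat_iso ap => a b /=; rewrite ltn_add2l.
    case: (ltngtP (u (cc c a)) (u (cc c b))) => [/zmono //|/zmono|/ci ->]; last by rewrite ltnn.
    by lia.
  + move=> j; apply: rho_iso natB => a b.
    apply: (incr_iso (s := @natural k) (s' := fun i => r0 (inl (theta j i)))) => //.
    move=> {}a {}b ab; rewrite /theta; case: (boolP (P _ _)) => [h|_] /=; last exact: fr_incr.
    have [Ea|na] := eqVneq (a : nat) k.
      have [Eb|nb] := eqVneq (b : nat) k; first by lia.
      case: eqP => [_|/eqP nb'] /=; first by rewrite ltn_add2l; apply/zmono/uP.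
      have [_ ->] := fr_z b j.1 (ltn_ord b); by lia.
    have [Ea1|na1] := eqVneq (a : nat) k.+1.
      have [Eb|nb] := eqVneq (b : nat) k; first by lia.
      case: eqP => [Eb1|nb'] /=; first by lia.
      have [_ ->] := fr_z b j.2 (ltn_ord b); by lia.
    have [Eb|nb] /= := eqVneq (b : nat) k.
      have [-> _] := fr_z a j.1 (ltn_ord a); by lia.
    have [Eb|nb1] /= := eqVneq (b : nat) k.+1.
      have [-> _] := fr_z a j.2 (ltn_ord a); by lia.
    exact: fr_incr.
  + move=> r [ri fr Er]; exists r; split=> // x y.
    have fle (a : 'I_(M k)) i : (s (inl a) < s (inr i)) = (a <= k.+1) /\ (s (inr i) < s (inl a)) = (k.+1 < a).
      have /andP [h1 h2] := ar i.
      have p1 : k.+1 < M k by rewrite /M; lia.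
      have p2 : k.+2 < M k by rewrite /M; lia.
      case: (leqP a k.+1) => ha.
        have : s (inl a) <= s (inl (frame_index k k.+1)).
          have [Ea|na] := eqVneq (a : nat) k.+1; first by rewrite /frame_index -Ea inord_val.
          by apply: ltnW; apply: is_; rewrite inordK //; lia.
        by lia.
      have : s (inl (frame_index k k.+2)) <= s (inl a).
        have [Ea|na] := eqVneq (a : nat) k.+2; first by rewrite /frame_index -Ea inord_val.
        by apply: ltnW; apply: is_; rewrite inordK //; lia.
      by lia.
    rewrite Er; [|by case: (x)|by case: (y)].
    case: x => [a|i]; case: y => [b|j] /=.
    * by apply: (incr_iso (s := fun a : 'I_(M k) => fr0 a) (s' := fun a => s (inl a))) => // a' b'; exact: fr_incr.
    * by have [-> _] := fr_z a (t j) (ltn_ord a); have [-> _] := fle a j.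
    * by have [_ ->] := fr_z b (t i) (ltn_ord b); have [_ ->] := fle b i.
    * rewrite ltn_add2l -uE; case: (ltngtP (u (t i)) (u (t j))) => [/zmono //|/zmono|E]; first by lia.
      suff -> : i = j by rewrite ltnn.
      have := uE i j; have := uE j i; rewrite E ltnn => h1 h2.
      have : s (inr i) = s (inr j) by apply/eqP; move: h1 h2; case: ltngtP.
      by move/si => [].
Qed.
End ClauseGadget.

(** * Reducing 3-satisfiability to ordering *)

(* The literal [l] stands for the variable [l./2], negated when [l] is odd. *)
Definition ltrue (al : nat -> bool) (l : nat) : bool := al l./2 (+) odd l.
Definition flip (l : nat) := if odd l then l.-1 else l.+1.
Definition sat3 (cl : nat -> nat -> nat -> bool) : Prop :=
  exists al, forall l1 l2 l3, cl l1 l2 l3 -> [|| ltrue al l1, ltrue al l2 | ltrue al l3].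
(** The frame gadget enters the graph only through clauses, whence the existence of one. Distinct
    variables make the six literal vertices of a clause distinct. *)
Definition wf3 (N : nat) (cl : nat -> nat -> nat -> bool) : Prop :=
  (exists l1 l2 l3, cl l1 l2 l3) /\
  forall l1 l2 l3, cl l1 l2 l3 -> [&& l1 < 2 * N, l2 < 2 * N, l3 < 2 * N,
    l1./2 != l2./2, l1./2 != l3./2 & l2./2 != l3./2].

Lemma flip_half l : (flip l)./2 = l./2.
Proof. rewrite /flip; case: ifP => h; lia. Qed.
Lemma flip_neq l : flip l != l.
Proof. rewrite /flip; case: ifP => h; lia. Qed.
Lemma flip_lt N l : l < 2 * N -> flip l < 2 * N.
Proof. rewrite /flip; case: ifP => h; lia. Qed.

(** * The graph of a 3-satisfiability instance *)

Section HardGraph.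
Variables (k : nat) (V : finType) (e : rel V) (tau : 'I_(M k) + 'I_6 -> V).

(* Vertices [0 .. M k - 1] form the frame, [M k + l] is the vertex of the literal [l], and the
   interior vertices of the gadget of the clause [(l1, l2, l3)] come after them. *)
Definition tpos (l1 l2 l3 : nat) (x : 'I_(M k) + 'I_6) : nat :=
  match x with
  | inl a => a
  | inr i => M k + nth 0 [:: l1; flip l1; l2; flip l2; l3; flip l3] i end.
Definition vpos (N l1 l2 l3 : nat) (v : V) : nat :=
  if [pick x | tau x == v] is Some x then tpos l1 l2 l3 x
  else M k + 2 * N + ((l1 * (2 * N) + l2) * (2 * N) + l3) * #|V| + enum_rank v.
Definition gsize N := M k + 2 * N + (2 * N) * (2 * N) * (2 * N) * #|V|.
Definition gedge N (cl : nat -> nat -> nat -> bool) (x y : nat) : bool :=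
  [exists l : 'I_(2 * N) * 'I_(2 * N) * 'I_(2 * N), cl l.1.1 l.1.2 l.2 &&
   [exists u, exists v, [&& e u v, x == vpos N l.1.1 l.1.2 l.2 u & y == vpos N l.1.1 l.1.2 l.2 v]]].
Definition gE N cl : rel 'I_(gsize N) := fun x y => gedge N cl x y.

Variable f : rel 'I_k.
Hypothesis fsimp : simple_graph f.
Hypothesis fbi : biconnected f.
Variables (VB : finType) (eB : rel VB) (tauB : 'I_(M k) -> VB).
Hypothesis G : gadget f e tau.
Hypothesis minB : forall (V' : finType) (e' : rel V') (tau' : 'I_(M k) -> V'), gadget f e' tau' ->
     (forall s, rho f e' tau' s -> rho f eB tauB s) -> (exists s, rho f e' tau' s) ->
     rho f e' tau' (@natural k).
Hypothesis toB : forall s, rho f e tau s -> rho f eB tauB (fun a => s (inl a)).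
Hypothesis snd : forall s, rho f e tau s -> incr (fun a => s (inl a)) -> lits (fun n => s (inr (o6 n))).
Hypothesis cmp : forall s, injective s -> incr (fun a => s (inl a)) ->
  (forall i, s (inl (frame_index k k.+1)) < s (inr i) < s (inl (frame_index k k.+2))) ->
  lits (fun n => s (inr (o6 n))) -> rho f e tau s.

Section Fixed.
Variables (N : nat) (cl : nat -> nat -> nat -> bool).
Hypothesis wf : wf3 N cl.
Let W := 'I_(gsize N).
Let J : finType := {l : 'I_(2 * N) * 'I_(2 * N) * 'I_(2 * N) | cl l.1.1 l.1.2 l.2}.
Let mkJ (l : 'I_(2 * N) * 'I_(2 * N) * 'I_(2 * N)) (c : cl l.1.1 l.1.2 l.2) : J :=
  exist (fun l : 'I_(2 * N) * 'I_(2 * N) * 'I_(2 * N) => cl l.1.1 l.1.2 l.2) l c.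
Let V0 : pred W := fun x => x < M k + 2 * N.
Let jpos (j : J) x := tpos (val j).1.1 (val j).1.2 (val j).2 x.

Lemma jpos_lt j x : jpos j x < M k + 2 * N.
Proof.
rewrite /jpos /tpos; case: x => [a|i]; first by apply: (leq_trans (ltn_ord a)); rewrite leq_addr.
rewrite ltn_add2l; move: (flip_lt (ltn_ord (val j).1.1)) (flip_lt (ltn_ord (val j).1.2)) (flip_lt (ltn_ord (val j).2)).
by case: i => [[|[|[|[|[|[|//]]]]]] hi] /=; rewrite ?ltn_ord.
Qed.

Lemma jpos_inj j : injective (jpos j).
Proof.
have := proj2 wf _ _ _ (valP j); rewrite /jpos; move: (val j) => [[l1 l2] l3] /= /and5P [_ _ _ h12 /andP [h13 h23]].
have n1 := flip_neq l1; have n2 := flip_neq l2; have n3 := flip_neq l3.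
have e1 := flip_half l1; have e2 := flip_half l2; have e3 := flip_half l3.
move=> [a|i] [b|i'] /=.
- by move=> /ord_inj ->.
- by have := ltn_ord a; lia.
- by have := ltn_ord b; lia.
move=> /addnI E; congr inr; apply: ord_inj; move: E.
move: (nat_of_ord l1) (nat_of_ord l2) (nat_of_ord l3) (flip l1) (flip l2) (flip l3) h12 h13 h23 n1 n2 n3 e1 e2 e3 => {l1 l2 l3} l1 l2 l3 f1 f2 f3 h12 h13 h23 n1 n2 n3 e1 e2 e3.
by case: i => [[|[|[|[|[|[|//]]]]]] hi]; case: i' => [[|[|[|[|[|[|//]]]]]] hi'] //= E; exfalso; clear hi hi'; lia.
Qed.

Lemma V0_sub : M k + 2 * N <= gsize N. Proof. by rewrite /gsize leq_addr. Qed.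

Let theta (j : J) x : W := Ordinal (leq_trans (jpos_lt j x) V0_sub).

Let code (l : 'I_(2 * N) * 'I_(2 * N) * 'I_(2 * N)) := (l.1.1 * (2 * N) + l.1.2) * (2 * N) + l.2.

Lemma pair_lt a b n m : a < m -> b < n -> a * n + b < m * n.
Proof. by move=> am bn; have : a.+1 * n <= m * n by [rewrite leq_mul2r am orbT]; rewrite mulSnr; lia. Qed.

Lemma pair_inj n a b a' b' : b < n -> b' < n -> a * n + b = a' * n + b' -> a = a' /\ b = b'.
Proof.
move=> h h' E; have := congr1 (divn^~ n) E; have := congr1 (modn^~ n) E.
have n0 : 0 < n by lia.
by rewrite !modnMDl !modn_small // !divnMDl // !divn_small // !addn0 => -> ->.
Qed.

Lemma code_lt l : code l < 2 * N * (2 * N) * (2 * N).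
Proof. by case: l => [[a b] c]; apply: pair_lt => //; apply: pair_lt. Qed.

Lemma code_inj : injective code.
Proof.
move=> [[a b] c] [[a' b'] c'] /pair_inj [] // /pair_inj [] // /= /ord_inj -> /ord_inj -> /ord_inj ->.
by [].
Qed.

Lemma vpos_lt (l : 'I_(2 * N) * 'I_(2 * N) * 'I_(2 * N)) v : cl l.1.1 l.1.2 l.2 -> vpos N l.1.1 l.1.2 l.2 v < gsize N.
Proof.
move=> c; rewrite /vpos; case: pickP => [x _|_].
  exact: leq_trans (jpos_lt (mkJ c) x) V0_sub.
rewrite /gsize -addnA ltn_add2l; apply: pair_lt; [exact: code_lt|exact: ltn_ord].
Qed.

Let pi (j : J) v : W := Ordinal (vpos_lt v (valP j)).

Lemma hard_gluing : gluing e tau V0 (fun _ _ => false) theta pi (@gE N cl).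
Proof.
have tint j v : v \notin codom tau -> pi j v = M k + 2 * N + (code (val j) * #|V| + enum_rank v) :> nat.
  move=> vn; rewrite /= /vpos; case: pickP => [x /eqP E|_]; last by rewrite addnA.
  by rewrite -E codom_f in vn.
have tter j x : pi j (tau x) = theta j x :> nat.
  by rewrite /= /vpos; case: pickP => [y /eqP /(gd_inj G) ->//|/(_ x)]; rewrite eqxx.
split=> //.
- by move=> j x; exact: jpos_lt.
- by move=> j x y /(congr1 (@nat_of_ord _)) /jpos_inj.
- by move=> j x; apply: ord_inj; exact: tter.
- by move=> j v vn; rewrite /V0 tint // -leqNgt leq_addr.
- move=> j v j' v' vn /(congr1 (@nat_of_ord _)); rewrite tint //.
  have [/codomP [x ->]|vn'] := boolP (v' \in codom tau).
    by rewrite tter /=; have := jpos_lt j' x; rewrite -/(jpos j' x); lia.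
  rewrite tint // => /addnI /pair_inj []; try exact: ltn_ord.
  by move=> /code_inj /val_inj -> /ord_inj /enum_rank_inj ->.
- move=> x y; rewrite /gE /gedge; split.
    case/existsP => l /andP [c /existsP [u /existsP [v /and3P [uv /eqP Ex /eqP Ey]]]].
    by right; exists (mkJ c), u, v; split=> //; apply: ord_inj.
  case=> // -[j [u [v [uv -> ->]]]]; apply/existsP; exists (val j); rewrite (valP j) /=.
  by apply/existsP; exists u; apply/existsP; exists v; rewrite uv !eqxx.
Qed.

Lemma nobase_copy (phi : 'I_k -> W) : ~ copy f (fun _ _ => false) phi.
Proof.
move=> [_ h]; have k0 : 0 < k by have := k_gt2 fbi; lia.
by have [y /h] := f_nbr fbi (Ordinal k0).
Qed.

Lemma frame_lt (a : 'I_(M k)) : a < gsize N.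
Proof. by apply: (leq_trans (ltn_ord a)); rewrite /gsize -addnA leq_addr. Qed.
Let tauW (a : 'I_(M k)) : W := Ordinal (frame_lt a).

Lemma hard_gadget : gadget f (@gE N cl) tauW.
Proof.
apply: (glue_gadget fsimp fbi G hard_gluing) => //.
- by move=> a b /(congr1 (@nat_of_ord _)) /= /ord_inj.
- by move=> a; rewrite /V0 /=; apply: (leq_trans (ltn_ord a)); rewrite leq_addr.
Qed.

Lemma hard_in r j : injective r -> free f (@gE N cl) r -> rho f e tau (fun x => r (theta j x)).
Proof.
move=> ri fr; exists (fun v => r (pi j v)); split.
- by apply: inj_comp ri _; exact: (pi_inj hard_gluing).
- exact: (free_glue_pi hard_gluing).
- by move=> a b; rewrite !(gl_tau hard_gluing).
Qed.

(** The whole graph, seen as a gadget on the frame, only adds to the frame constraints, so [minB]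
    provides an F-free order that is natural on the frame. In it every clause gadget yields a true
    literal. *)
Lemma hard_sound : orderable f (@gE N cl) -> sat3 cl.
Proof.
case=> r0 [r0i fr0].
have theta_fr (j : J) a : theta j (inl a) = tauW a by apply: ord_inj.
have [r [ri fr rincr]] : rho f (@gE N cl) tauW (@natural k).
  apply: minB; first exact: hard_gadget; last by exists (fun a => r0 (tauW a)), r0.
  move=> s [r [ri fr E]]; have [[l1 [l2 [l3 c]]] h] := wf.
  have /and5P [b1 b2 b3 _ _] := h _ _ _ c.
  pose j : J := @mkJ (Ordinal b1, Ordinal b2, Ordinal b3) c.
  have := toB (hard_in j ri fr); apply: rho_iso => a b; by rewrite -E !theta_fr.
pose R n := r (insubd (tauW ord0) n).
have RE (w : W) : r w = R w by rewrite /R valKd.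
exists (fun v => R (M k + 2 * v).+1 < R (M k + 2 * v)) => l1 l2 l3 c.
have /and5P [b1 b2 b3 _ _] := proj2 wf _ _ _ c.
pose j : J := @mkJ (Ordinal b1, Ordinal b2, Ordinal b3) c.
have Rinj n n' : n < gsize N -> n' < gsize N -> R n = R n' -> n = n'.
  by move=> h h' /ri /(congr1 val); rewrite !val_insubd h h'.
have key l : l < 2 * N -> R (M k + flip l) < R (M k + l) ->
    ltrue (fun v => R (M k + 2 * v).+1 < R (M k + 2 * v)) l.
  move=> hl; rewrite /ltrue /flip; case: ifP => ol.
    have E : 2 * l./2 = l.-1 by lia.
    rewrite E (_ : (M k + l.-1).+1 = M k + l) ?addbT; last by case: (l) ol => // l' _ /=; rewrite addnS.
    by lia.
  have E : 2 * l./2 = l by lia.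
  by rewrite E addbF addnS.
have : incr (fun a => r (theta j (inl a))).
  by move=> a b ab; rewrite !theta_fr rincr.
move=> /(snd (hard_in j ri fr)) []; rewrite !RE /= /jpos /= !inordK //= => h; apply/or3P.
- by constructor 1; exact: key.
- by constructor 2; exact: key.
- by constructor 3; exact: key.
Qed.

Lemma hard_complete : sat3 cl -> orderable f (@gE N cl).
Proof.
case=> al hal; have k2 := k_gt2 fbi.
pose fr0 a := if a <= k.+1 then a else M k + 2 * N + a.
(* The two literal vertices of a true variable are exchanged, so that the true literal is always the
   upper one. *)
pose lr l := M k + (if al l./2 then flip l else l).
pose r0 (x : W) := if x < M k then fr0 x else lr (x - M k).
have fr_incr a b : a < b -> fr0 a < fr0 b.
  by rewrite /fr0 => ab; case: (leqP a k.+1) => ha; case: (leqP b k.+1) => hb; lia.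
have flipK l : flip (flip l) = l by rewrite /flip; case: (boolP (odd l)) => h; case: ifP => h'; lia.
have lr_inj l l' : lr l = lr l' -> l = l'.
  rewrite /lr => /addnI; case: ifP => h; case: ifP => h' E.
  - by rewrite -(flipK l) E flipK.
  - by move: h h'; rewrite -E flip_half => ->.
  - by move: h h'; rewrite E flip_half => ->.
  - by [].
have lr_bd l : l < 2 * N -> M k <= lr l < M k + 2 * N.
  move=> hl; rewrite /lr leq_addr ltn_add2l; case: ifP => // _; exact: flip_lt.
have fr_lr a l : a < M k -> l < 2 * N -> (fr0 a < lr l) = (a <= k.+1) /\ (lr l < fr0 a) = (k.+1 < a).
  move=> ha /lr_bd; rewrite /fr0; case: (leqP a k.+1) => h; move: ha; rewrite /M; move: (lr l); lia.
have [] := glue_extend fsimp fbi G hard_gluing (r0 := r0).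
- move=> x y; rewrite !unfold_in /V0 /r0 => hx hy.
  case: ltnP => xM; case: ltnP => yM.
  + by case: (ltngtP x y) => [/fr_incr|/fr_incr|/ord_inj ->//]; lia.
  + have [] := fr_lr x (y - M k) xM; lia.
  + have [] := fr_lr y (x - M k) yM; lia.
  + by move=> /lr_inj E; apply: ord_inj; lia.
- by move=> phi cp; case: (nobase_copy cp).
- move=> j.
  have r0fr a : r0 (theta j (inl a)) = fr0 a by rewrite /r0 /= ltn_ord.
  have r0lit i : r0 (theta j (inr i)) = lr (nth 0 [:: nat_of_ord (val j).1.1; flip (val j).1.1; nat_of_ord (val j).1.2;
       flip (val j).1.2; nat_of_ord (val j).2; flip (val j).2] i).
    by rewrite /r0 /= ltnNge leq_addr /= addKn.
  have ltl i : nth 0 [:: nat_of_ord (val j).1.1; flip (val j).1.1; nat_of_ord (val j).1.2;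
       flip (val j).1.2; nat_of_ord (val j).2; flip (val j).2] i < 2 * N.
    move: (flip_lt (ltn_ord (val j).1.1)) (flip_lt (ltn_ord (val j).1.2)) (flip_lt (ltn_ord (val j).2)).
    have := ltn_ord (val j).2.
    by move: i => [|[|[|[|[|[|i]]]]]] /=; rewrite ?ltn_ord // nth_nil; lia.
  have r0lt l : ltrue al l -> lr (flip l) < lr l.
    rewrite /ltrue /lr flip_half flipK ltn_add2l /flip; case: (al _); case: ifP => //; lia.
  apply: cmp.
  + move=> [a|i] [b|i'].
    * rewrite !r0fr; case: (ltngtP a b) => [/fr_incr|/fr_incr|/ord_inj ->//]; lia.
    * rewrite r0fr r0lit; have [] := fr_lr a _ (ltn_ord a) (ltl i'); lia.
    * rewrite r0fr r0lit; have [] := fr_lr b _ (ltn_ord b) (ltl i); lia.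
    * rewrite !r0lit => /lr_inj E.
      by apply: (@jpos_inj j); rewrite /jpos /= E.
  + by move=> a b ab; rewrite !r0fr; exact: fr_incr.
  + move=> i; rewrite !r0fr r0lit.
    have p1 : k.+1 < M k by rewrite /M; lia.
    have p2 : k.+2 < M k by rewrite /M; lia.
    by have [-> _] := fr_lr _ _ (ltn_ord (frame_index k k.+1)) (ltl i);
       have [_ ->] := fr_lr _ _ (ltn_ord (frame_index k k.+2)) (ltl i); rewrite !inordK ?leqnn.
  + have := hal _ _ _ (valP j); case/or3P => /r0lt h; [constructor 1|constructor 2|constructor 3];
      by rewrite !r0lit !inordK.
- by move=> r [ri fr _]; exists r.
Qed.
End Fixed.
End HardGraph.

(** The gadget is chosen before the instance: it depends on F only and is a constant of the
    reduction. *)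
Theorem hard_graph (k : nat) (f : rel 'I_k) :
  simple_graph f -> biconnected f -> ~ complete_graph f ->
  exists (V : finType) (e : rel V) (tau : 'I_(M k) + 'I_6 -> V), forall N cl, wf3 N cl ->
    [/\ symmetric (@gE k V e tau N cl), irreflexive (@gE k V e tau N cl),
        clean f (@gE k V e tau N cl) & orderable f (@gE k V e tau N cl) <-> sat3 cl].
Proof.
move=> fsimp fbi fnc.
have [VB [eB [tauB [GB natB cohB minB]]]] := frame_gadget fsimp fbi.
have [V [e [tau [G toB snd cmp]]]] := clause_gadget fsimp fbi fnc GB natB cohB.
exists V, e, tau => N cl wf; have GH := hard_gadget fsimp fbi G wf.
split; [exact: gd_sym GH|exact: gd_irr GH|exact: gd_clean GH|split].
  exact: (hard_sound fsimp fbi G minB toB snd wf).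
exact: (hard_complete fsimp fbi G cmp wf).
Qed.

(** * Pebble machines on one tape *)

Definition upd (st : nat -> nat) (r v : nat) : nat -> nat := fun s => if s == r then v else st s.

(* A loop language: register 0 is never written and stays 0, register 1 holds the
   length of the output.  [Loop i b c] is [while i <> b do (c; i := i + 1)]. *)
Inductive com :=
| Inc of nat | Copy of nat & nat | Len of nat | Out of bool | Skip
| Seq of com & com | IfEq of nat & nat & com & com | IfBit of nat & com & com
| Loop of nat & nat & com.

(** Big-step semantics with registers capped by [C]. The counter is the number of
    micro-instructions, so a true branch, which ends with a jump over the other one, costs one
    more. *)
Inductive bs (C : nat) (x : seq bool) : com -> (nat -> nat) -> seq bool -> nat -> (nat -> nat) -> seq bool -> Prop :=
| BInc r st o : r != 1 -> st r < C -> bs C x (Inc r) st o 1 (upd st r (st r).+1) o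
| BCopy r s st o : r != 1 -> r != s -> bs C x (Copy r s) st o 2 (upd st r (st s)) o
| BLen r st o : r != 1 -> bs C x (Len r) st o 2 (upd st r (size x)) o
| BOut v st o : size o < C -> bs C x (Out v) st o 1 (upd st 1 (size o).+1) (rcons o v)
| BSkip st o : bs C x Skip st o 0 st o
| BSeq c1 c2 st o n1 st1 o1 n2 st2 o2 : bs C x c1 st o n1 st1 o1 -> bs C x c2 st1 o1 n2 st2 o2 ->
    bs C x (Seq c1 c2) st o (n1 + n2) st2 o2
| BIfEqT r s c1 c2 st o n st' o' : st r = st s -> bs C x c1 st o n st' o' ->
    bs C x (IfEq r s c1 c2) st o n.+2 st' o'
| BIfEqF r s c1 c2 st o n st' o' : st r != st s -> bs C x c2 st o n st' o' ->
    bs C x (IfEq r s c1 c2) st o n.+1 st' o'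
| BIfBitT r c1 c2 st o n st' o' : nth false x (st r) -> bs C x c1 st o n st' o' ->
    bs C x (IfBit r c1 c2) st o n.+2 st' o'
| BIfBitF r c1 c2 st o n st' o' : ~~ nth false x (st r) -> bs C x c2 st o n st' o' ->
    bs C x (IfBit r c1 c2) st o n.+1 st' o'
| BLoopE i b c st o : st i = st b -> bs C x (Loop i b c) st o 1 st o
| BLoopS i b c st o n1 st1 o1 n2 st2 o2 : i != 1 -> st i != st b -> bs C x c st o n1 st1 o1 -> st1 i < C ->
    bs C x (Loop i b c) (upd st1 i (st1 i).+1) o1 n2 st2 o2 ->
    bs C x (Loop i b c) st o (n1 + n2 + 3) st2 o2.

Fixpoint rmax c := match c with
  | Inc r => r.+1 | Copy r s => maxn r.+1 s.+1 | Len r => r.+1 | Out _ => 2 | Skip => 0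
  | Seq c1 c2 => maxn (rmax c1) (rmax c2)
  | IfEq r s c1 c2 => maxn (maxn r.+1 s.+1) (maxn (rmax c1) (rmax c2))
  | IfBit r c1 c2 => maxn r.+1 (maxn (rmax c1) (rmax c2))
  | Loop i b c => maxn (maxn i.+1 b.+1) (rmax c) end.

(** * Micro-instructions and the machine running them *)

Section Machine.
Variable R : nat.

(* input symbol, left-end mark, pebbles on the cell, output symbol *)
Definition cell : finType := (option bool * bool * {ffun 'I_R -> bool} * option bool)%type.
Definition cin (c : cell) := c.1.1.1.
Definition cend (c : cell) := c.1.1.2.
Definition cpeb (c : cell) := c.1.2.
Definition cout (c : cell) := c.2.
(** Plain symbols make up the input and the final output; [dec] reads them as cells without
    marks. *)
Definition sym : finType := (option bool + cell)%type.
Definition dec (s : sym) : cell :=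
  match s with inl o => (o, false, [ffun=> false], None) | inr c => c end.

(* Walk right to the first cell satisfying [mseek], rewrite it and its right
   neighbour, walk back to the left end and jump according to [mtest]. *)
Record micro := Micro {
  mseek : cell -> bool; mup : cell -> cell; mnext : cell -> cell; mtest : cell -> bool;
  mj1 : nat; mj0 : nat }.

Definition haspeb r (c : cell) := [exists i : 'I_R, (i == r :> nat) && cpeb c i].
Definition setpeb r b (c : cell) : cell :=
  (cin c, cend c, [ffun i : 'I_R => if i == r :> nat then b else cpeb c i], cout c).
Definition setout v (c : cell) : cell := (cin c, cend c, cpeb c, Some v).

Definition mInc r a := Micro (haspeb r) (setpeb r false) (setpeb r true) xpredT a a.
Definition mRem r a := Micro (haspeb r) (setpeb r false) id xpredT a a.
Definition mAdd r s a := Micro (haspeb s) (setpeb r true) id xpredT a a.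
Definition mLen r a := Micro (fun c => cin c == None) (setpeb r true) id xpredT a a.
Definition mEq r s a b := Micro (haspeb r) id id (haspeb s) a b.
Definition mBit r a b := Micro (haspeb r) id id (fun c => cin c == Some true) a b.
Definition mOut v a := Micro (haspeb 1) (fun c => setout v (setpeb 1 false c)) (setpeb 1 true) xpredT a a.
Definition mJmp a := Micro xpredT id id xpredT a a.

Fixpoint len c := match c with
  | Inc _ => 1 | Copy _ _ => 2 | Len _ => 2 | Out _ => 1 | Skip => 0
  | Seq c1 c2 => len c1 + len c2
  | IfEq _ _ c1 c2 | IfBit _ c1 c2 => len c1 + len c2 + 2
  | Loop _ _ c => len c + 3 end.

Fixpoint compile c a : seq micro := match c with
  | Inc r => [:: mInc r a.+1]
  | Copy r s => [:: mRem r a.+1; mAdd r s a.+2]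
  | Len r => [:: mRem r a.+1; mLen r a.+2]
  | Out v => [:: mOut v a.+1]
  | Skip => [::]
  | Seq c1 c2 => compile c1 a ++ compile c2 (a + len c1)
  | IfEq r s c1 c2 => mEq r s a.+1 (a.+1 + len c1).+1 ::
      compile c1 a.+1 ++ mJmp (a + len c1 + len c2 + 2) :: compile c2 (a.+1 + len c1).+1
  | IfBit r c1 c2 => mBit r a.+1 (a.+1 + len c1).+1 ::
      compile c1 a.+1 ++ mJmp (a + len c1 + len c2 + 2) :: compile c2 (a.+1 + len c1).+1
  | Loop i b c => mEq i b (a + len c + 3) a.+1 ::
      compile c a.+1 ++ [:: mInc i (a.+1 + len c).+1; mJmp a] end.

Lemma size_comp c a : size (compile c a) = len c.
Proof.
elim: c a => //= [c1 IH1 c2 IH2|r s c1 IH1 c2 IH2|r c1 IH1 c2 IH2|i b c IH] a;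
  rewrite ?size_cat /= ?IH1 ?IH2 ?IH /=; lia.
Qed.

Variable code : seq micro.
Let m0 := mJmp 0.

Definition state : finType := (bool + (bool + ('I_(size code) * option (bool * bool))))%type.
Definition sHalt b : state := inl b.
Definition sStart : state := inr (inl true).
Definition sFin : state := inr (inl false).
Definition sSeek i : state := inr (inr (i, None)).
Definition sNext i b : state := inr (inr (i, Some (false, b))).
Definition sBack i b : state := inr (inr (i, Some (true, b))).
(** Programs have two exits: the address just past the code starts the accepting final phase, and
    any larger one rejects. *)
Definition goto n : state :=
  if insub n is Some i then sSeek i else if n == size code then sFin else sHalt false.

(** The start state marks cell 0 and drops all pebbles there, so all registers are 0; its left move
    stays at cell 0. The final phase turns cells into plain output bits and halts at the first cell
    without one. *)
Definition delta (q : state) (s : sym) : state * sym * bool :=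
  let c := dec s in
  match q with
  | inl _ => (q, s, true)
  | inr (inl true) => (goto 0, inr (cin c, true, [ffun=> true], None), false)
  | inr (inl false) => if cout c is Some b then (sFin, inl (Some b), true) else (sHalt true, inl None, true)
  | inr (inr (i, None)) => let m := nth m0 code i in
      if mseek m c then (sNext i (mtest m c), inr (mup m c), true) else (q, inr c, true)
  | inr (inr (i, Some (false, b))) => (sBack i b, inr (mnext (nth m0 code i) c), false)
  | inr (inr (i, Some (true, b))) => let m := nth m0 code i in
      (if cend c then goto (if b then mj1 m else mj0 m) else q, inr c, false)
  end.

Definition machine : TM := Build_TM (inl None : sym) (inl (Some false)) (inl (Some true))
  sStart (sHalt true) (sHalt false) delta.

Lemma machine_wf : tm_wf machine.
Proof. by []. Qed.

(** Tapes are compared through [dec], so a plain symbol is identified with its cell form. *)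
Definition at_ (q : state) (h : nat) (T : nat -> cell) (cf : config machine) : Prop :=
  [/\ cf.1.1 = q, cf.1.2 = h & forall i, dec (cf.2 i) = T i].

Record goes n q h T q' h' T' : Prop := Goes {
  goesP : forall cf, at_ q h T cf -> at_ q' h' T' (iter n (@tm_step machine) cf) }.

Lemma goes0 q h T T' : T =1 T' -> goes 0 q h T q h T'.
Proof. by move=> E; split=> cf [h1 h2 h3]; split=> // i; rewrite -E. Qed.

Lemma goes_trans n m q h T q1 h1 T1 q2 h2 T2 :
  goes n q h T q1 h1 T1 -> goes m q1 h1 T1 q2 h2 T2 -> goes (n + m) q h T q2 h2 T2.
Proof. by move=> [g1] [g2]; split=> cf /g1 /g2; rewrite addnC iterD. Qed.

Lemma goes_ext n q h T T0 q' h' T' T1 : T0 =1 T -> T' =1 T1 ->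
  goes n q h T q' h' T' -> goes n q h T0 q' h' T1.
Proof.
move=> E0 E1 [g]; split=> cf [h1 h2 h3]; have [|a b c] := g cf; first by split=> // i; rewrite h3.
by split=> // i; rewrite c.
Qed.

Definition updT (T : nat -> cell) p c : nat -> cell := fun i => if i == p then c else T i.

Lemma goes1 q h T q' s' r : (forall b, q != sHalt b) ->
  (forall s, dec s = T h -> exists2 s1, delta q s = (q', s1, r) & dec s1 = s') ->
  goes 1 q h T q' (if r then h.+1 else h.-1) (updT T h s').
Proof.
move=> nh hd; split=> -[[q0 h0] tp] [/= -> -> hT]; rewrite /tm_step /tm_halting /=.
rewrite (negbTE (nh true)) (negbTE (nh false)) /=.
have [s1 -> E] := hd _ (hT h); split=> // i /=; rewrite /updT; case: eqP => // _; exact: hT.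
Qed.

Lemma updT_id T h : updT T h (T h) =1 T.
Proof. by move=> i; rewrite /updT; case: eqP => // ->. Qed.

Lemma goes_seek (i : 'I_(size code)) T h p : (forall j, h <= j < h + p -> ~~ mseek (nth m0 code i) (T j)) ->
  goes p (sSeek i) h T (sSeek i) (h + p) T.
Proof.
elim: p h => [|p IH] h hs; first by rewrite addn0; exact: goes0.
have g : goes 1 (sSeek i) h T (sSeek i) h.+1 T.
  apply: (goes_ext (T := T) (T' := updT T h (T h))) => //; first exact: updT_id.
  apply: (@goes1 _ _ _ _ _ true) => // s Es; exists (inr (T h)) => //=.
  by rewrite Es (negbTE (hs h _)) //; lia.
rewrite -add1n addnA addn1 -[1 + p]/(1 + p); apply: goes_trans g _; apply: IH => j hj; apply: hs; lia.
Qed.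

Lemma goes_back (i : 'I_(size code)) b T h : (forall j, cend (T j) = (j == 0)) ->
  goes h.+1 (sBack i b) h T (goto (if b then mj1 (nth m0 code i) else mj0 (nth m0 code i))) 0 T.
Proof.
move=> he; elim: h => [|h IH].
  apply: (goes_ext (T := T) (T' := updT T 0 (T 0))) => //; first exact: updT_id.
  apply: (@goes1 _ _ _ _ _ false) => // s Es; exists (inr (T 0)) => //=.
  by rewrite Es he.
have g : goes 1 (sBack i b) h.+1 T (sBack i b) h T.
  apply: (goes_ext (T := T) (T' := updT T h.+1 (T h.+1))) => //; first exact: updT_id.
  apply: (@goes1 _ _ _ _ _ false) => // s Es; exists (inr (T h.+1)) => //=.
  by rewrite Es he.
exact: goes_trans g IH.
Qed.

Lemma goto_lt n (h : n < size code) : goto n = sSeek (Ordinal h).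
Proof. by rewrite /goto insubT. Qed.

(** The steps are [p] to the cell, one to rewrite it, one for its neighbour, and [p.+1] back. *)
Lemma goes_micro a m T p T' : a < size code -> nth m0 code a = m ->
  (forall j, cend (T j) = (j == 0)) -> (forall j, cend (T' j) = (j == 0)) ->
  mseek m (T p) -> (forall j, j < p -> ~~ mseek m (T j)) ->
  T' p = mup m (T p) -> T' p.+1 = mnext m (T p.+1) -> (forall j, j != p -> j != p.+1 -> T' j = T j) ->
  goes (p + p + 3) (goto a) 0 T (goto (if mtest m (T p) then mj1 m else mj0 m)) 0 T'.
Proof.
move=> ha hm eT eT' sp sj Ep Ep1 Ej; rewrite goto_lt; set i := Ordinal ha.
have hi : nth m0 code i = m by [].
have g1 : goes p (sSeek i) 0 T (sSeek i) p T.
  by rewrite -{2}[p]add0n; apply: goes_seek => j; rewrite hi => hj; apply: sj; lia.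
have g2 : goes 1 (sSeek i) p T (sNext i (mtest m (T p))) p.+1 (updT T p (T' p)).
  apply: (@goes1 _ _ _ _ _ true) => // s Es; exists (inr (mup m (T p))) => //=.
  by rewrite Es hm sp.
have g3 : goes 1 (sNext i (mtest m (T p))) p.+1 (updT T p (T' p)) (sBack i (mtest m (T p))) p T'.
  apply: (@goes_ext _ _ _ _ _ _ _ (updT (updT T p (T' p)) p.+1 (T' p.+1))) => //.
    move=> j; rewrite /updT; case: eqP => [->//|/eqP n1]; case: eqP => [->//|/eqP n2].
    by rewrite Ej.
  apply: (@goes1 _ _ _ _ _ false) => // s; rewrite /updT ifN; last by lia.
  by move=> Es; exists (inr (T' p.+1)) => //=; rewrite Es hm Ep1.
have g4 := @goes_back i (mtest m (T p)) T' p eT'; rewrite hi in g4.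
have := goes_trans (goes_trans (goes_trans g1 g2) g3) g4.
by rewrite (_ : p + 1 + 1 + p.+1 = p + p + 3) //; lia.
Qed.

(** ** Tapes representing stores *)

Definition inp (x : seq bool) i := nth None (map Some x) i.
Definition TP x (P : nat -> nat -> bool) (o : seq bool) (i : nat) : cell :=
  (inp x i, i == 0, [ffun r : 'I_R => P r i], inp o i).
(** A register is held as the position of its pebble, so an increment is a local move and a test for
    equality inspects one cell. *)
Definition TS x (st : nat -> nat) o := TP x (fun r i => st r == i) o.

Lemma haspebE x P o r i : r < R -> haspeb r (TP x P o i) = P r i.
Proof.
move=> hr; apply/existsP/idP; first by case=> j /andP [/eqP <-]; rewrite /cpeb /= ffunE.
by move=> h; exists (Ordinal hr); rewrite /cpeb /= ffunE eqxx.
Qed.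

Lemma setpebE x P o r b i : setpeb r b (TP x P o i) = TP x (fun s j => if (s == r) && (j == i) then b else P s j) o i.
Proof. by congr (_, _, _, _); apply/ffunP => s; rewrite !ffunE eqxx andbT. Qed.

Lemma TP_ext x P P' o o' i : (forall r, P r i = P' r i) -> inp o i = inp o' i -> TP x P o i = TP x P' o' i.
Proof. by move=> E Eo; congr (_, _, _, _) => //; apply/ffunP => s; rewrite !ffunE. Qed.

Definition sub_at a l := exists pre post, code = pre ++ l ++ post /\ size pre = a.

Lemma sub_at_cons a m l : sub_at a (m :: l) -> [/\ a < size code, nth m0 code a = m & sub_at a.+1 l].
Proof.
case=> pre [post [E <-]]; split.
- by rewrite E size_cat /=; lia.
- by rewrite E nth_cat ltnn subnn.
- by exists (rcons pre m), post; rewrite size_rcons cat_rcons.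
Qed.

Lemma sub_at_cat a l1 l2 : sub_at a (l1 ++ l2) -> sub_at a l1 /\ sub_at (a + size l1) l2.
Proof.
case=> pre [post [E <-]]; split; first by exists pre, (l2 ++ post); rewrite E !catA.
by exists (pre ++ l1), post; rewrite size_cat E !catA.
Qed.

Section Sim.
Variables (C : nat) (x : seq bool).
Hypothesis xC : size x <= C.

Definition good (st : nat -> nat) (o : seq bool) := st 1 = size o /\ forall r, st r <= C.
Let cost := C + C + 3.

Lemma goes_test a m st o p : a < size code -> nth m0 code a = m ->
  mup m (TS x st o p) = TS x st o p -> mnext m (TS x st o p.+1) = TS x st o p.+1 ->
  mseek m (TS x st o p) -> (forall j, j < p -> ~~ mseek m (TS x st o j)) ->
  goes (p + p + 3) (goto a) 0 (TS x st o) (goto (if mtest m (TS x st o p) then mj1 m else mj0 m)) 0 (TS x st o).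
Proof. by move=> ha hm h1 h2 h3 h4; apply: goes_micro. Qed.

Lemma seek_st st o r : r < R -> haspeb r (TS x st o (st r)) /\ forall j, j < st r -> ~~ haspeb r (TS x st o j).
Proof.
by move=> hr; split=> [|j hj]; rewrite haspebE // ?eqxx // neq_ltn hj orbT.
Qed.

Lemma goes_eq a r s n1 n2 st o : sub_at a [:: mEq r s n1 n2] -> r < R -> s < R ->
  goes (st r + st r + 3) (goto a) 0 (TS x st o) (goto (if st r == st s then n1 else n2)) 0 (TS x st o).
Proof.
move=> /sub_at_cons [ha hm _] hr hs; have [h1 h2] := seek_st st o hr.
have E : haspeb s (TS x st o (st r)) = (st r == st s) by rewrite haspebE // eq_sym.
by have := @goes_test a _ st o (st r) ha hm; rewrite /= E; apply.
Qed.

Lemma goes_bit a r n1 n2 st o : sub_at a [:: mBit r n1 n2] -> r < R ->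
  goes (st r + st r + 3) (goto a) 0 (TS x st o) (goto (if nth false x (st r) then n1 else n2)) 0 (TS x st o).
Proof.
move=> /sub_at_cons [ha hm _] hr; have [h1 h2] := seek_st st o hr.
have := @goes_test a _ st o (st r) ha hm; rewrite /= /cin /=.
have -> : (inp x (st r) == Some true) = nth false x (st r); last by apply.
rewrite /inp; case: (ltnP (st r) (size x)) => h; first by rewrite (nth_map false) //; case: (nth false x (st r)).
by rewrite !nth_default ?size_map.
Qed.

Lemma goes_jmp a n st o : sub_at a [:: mJmp n] -> goes 3 (goto a) 0 (TS x st o) (goto n) 0 (TS x st o).
Proof. by move=> /sub_at_cons [ha hm _]; have := @goes_test a _ st o 0 ha hm; apply. Qed.

Lemma goes_inc a r n st o : sub_at a [:: mInc r n] -> r < R ->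
  goes (st r + st r + 3) (goto a) 0 (TS x st o) (goto n) 0 (TS x (upd st r (st r).+1) o).
Proof.
move=> /sub_at_cons [ha hm _] hr; have [h1 h2] := seek_st st o hr.
apply: (@goes_micro a (mInc r n) (TS x st o) (st r)) => //=.
- rewrite setpebE; apply: TP_ext => // s; rewrite /upd eqxx andbT; case: (eqVneq s r) => [Es|_] //; rewrite ?Es; lia.
- rewrite setpebE; apply: TP_ext => // s; rewrite /upd eqxx andbT; case: (eqVneq s r) => [_|_] //; by rewrite eqxx.
- move=> j n1 n2; apply: TP_ext => // s; rewrite /upd; case: (eqVneq s r) => [Es|_] //; rewrite ?Es; lia.
Qed.

(** The intermediate tape of an assignment, with pebble [r] lifted. *)
Let Prem (st : nat -> nat) r : nat -> nat -> bool := fun s i => (s != r) && (st s == i).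

Lemma goes_rem a r n st o : sub_at a [:: mRem r n] -> r < R ->
  goes (st r + st r + 3) (goto a) 0 (TS x st o) (goto n) 0 (TP x (Prem st r) o).
Proof.
move=> /sub_at_cons [ha hm _] hr; have [h1 h2] := seek_st st o hr.
apply: (@goes_micro a (mRem r n) (TS x st o) (st r)) => //=.
- rewrite setpebE; apply: TP_ext => // s; rewrite /Prem eqxx andbT; by case: (eqVneq s r).
- apply: TP_ext => // s; rewrite /Prem; case: (eqVneq s r) => [Es|_] //=; rewrite ?Es; lia.
- move=> j n1 n2; apply: TP_ext => // s; rewrite /Prem; case: (eqVneq s r) => [Es|_] //=; rewrite ?Es; lia.
Qed.

Lemma goes_add a r s n st o : sub_at a [:: mAdd r s n] -> s < R -> r != s ->
  goes (st s + st s + 3) (goto a) 0 (TP x (Prem st r) o) (goto n) 0 (TS x (upd st r (st s)) o).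
Proof.
move=> /sub_at_cons [ha hm _] hs rs.
apply: (@goes_micro a (mAdd r s n) (TP x (Prem st r) o) (st s)) => //=.
- by rewrite haspebE // /Prem eq_sym rs eqxx.
- by move=> j hj; rewrite haspebE // /Prem eq_sym rs /= neq_ltn hj orbT.
- rewrite setpebE; apply: TP_ext => // t; rewrite /Prem /upd eqxx andbT; case: (eqVneq t r) => [_|_] //; by rewrite eqxx.
- apply: TP_ext => // t; rewrite /Prem /upd; case: (eqVneq t r) => //= _; lia.
- move=> j n1 n2; apply: TP_ext => // t; rewrite /Prem /upd; case: (eqVneq t r) => //= _; lia.
Qed.

Lemma goes_len a r n st o : sub_at a [:: mLen r n] ->
  goes (size x + size x + 3) (goto a) 0 (TP x (Prem st r) o) (goto n) 0 (TS x (upd st r (size x)) o).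
Proof.
move=> /sub_at_cons [ha hm _].
apply: (@goes_micro a (mLen r n) (TP x (Prem st r) o) (size x)) => //=.
- by rewrite /cin /= /inp nth_default ?size_map.
- by move=> j hj; rewrite /cin /= /inp (nth_map false).
- rewrite setpebE; apply: TP_ext => // t; rewrite /Prem /upd eqxx andbT; case: (eqVneq t r) => [_|_] //; by rewrite eqxx.
- apply: TP_ext => // t; rewrite /Prem /upd; case: (eqVneq t r) => //= _; lia.
- move=> j n1 n2; apply: TP_ext => // t; rewrite /Prem /upd; case: (eqVneq t r) => //= _; lia.
Qed.

Lemma goes_out a v n st o : sub_at a [:: mOut v n] -> 1 < R -> st 1 = size o ->
  goes (st 1 + st 1 + 3) (goto a) 0 (TS x st o) (goto n) 0 (TS x (upd st 1 (size o).+1) (rcons o v)).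
Proof.
move=> /sub_at_cons [ha hm _] hr so; have [h1 h2] := seek_st st o hr.
have io j : j != size o -> inp o j = inp (rcons o v) j.
  move=> hj; rewrite /inp map_rcons nth_rcons size_map; case: ltngtP hj => // h _.
  by rewrite nth_default // size_map ltnW.
apply: (@goes_micro a (mOut v n) (TS x st o) (st 1)) => //=.
- rewrite setpebE /setout /TS /TP /=; congr (_, _, _, _).
    by apply/ffunP => s; rewrite !ffunE /upd eqxx andbT; case: (eqVneq (s : nat) 1) => [_|_] //; lia.
  by rewrite so /inp map_rcons nth_rcons size_map ltnn eqxx.
- rewrite setpebE; apply: TP_ext; last by rewrite io //; lia.
  by move=> s; rewrite /upd eqxx andbT so; case: (eqVneq s 1) => [_|_] //; rewrite eqxx.
- move=> j n1 n2; apply: TP_ext; last by rewrite -io // -so.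
  by move=> s; rewrite /upd; case: (eqVneq s 1) => [Es|_] //; rewrite ?Es; lia.
Qed.

(** A micro-instruction takes at most [cost] steps, as neither a pebble nor the end of the input
    lies beyond cell [C]. *)
Lemma sim c st o n st' o' a : bs C x c st o n st' o' -> sub_at a (compile c a) -> rmax c <= R -> good st o ->
  good st' o' /\ exists2 m, m <= n * cost & goes m (goto a) 0 (TS x st o) (goto (a + len c)) 0 (TS x st' o').
Proof.
move=> H; elim: H a => {c st o n st' o'}.
- move=> r st o r1 rC a sa /= hr [g1 g2]; split; last first.
    exists (st r + st r + 3); first by rewrite /cost; have := g2 r; lia.
    by rewrite addn1; apply: goes_inc.
  by split=> [|s]; rewrite /upd; [rewrite eq_sym (negbTE r1)|case: eqP => //].
- move=> r s st o r1 rs a sa /= hr [g1 g2]; split; last first.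
    exists ((st r + st r + 3) + (st s + st s + 3)); first by rewrite /cost; have := g2 r; have := g2 s; lia.
    have [sa1 sa2] := sub_at_cat (l1 := [:: mRem r a.+1]) sa; rewrite addn1 in sa2.
    have hr1 : r < R by lia.
    have hs1 : s < R by lia.
    have ga := @goes_rem a r a.+1 st o sa1 hr1.
    rewrite addn2; have gb := @goes_add a.+1 r s a.+2 st o sa2 hs1 rs.
    exact: goes_trans ga gb.
  by split=> [|t]; rewrite /upd; [rewrite eq_sym (negbTE r1)|case: eqP].
- move=> r st o r1 a sa /= hr [g1 g2]; split; last first.
    exists ((st r + st r + 3) + (size x + size x + 3)); first by rewrite /cost; have := g2 r; lia.
    have [sa1 sa2] := sub_at_cat (l1 := [:: mRem r a.+1]) sa; rewrite addn1 in sa2.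
    have ga := @goes_rem a r a.+1 st o sa1 hr.
    by rewrite addn2; apply: goes_trans ga (goes_len _ _ _).
  by split=> [|t]; rewrite /upd; [rewrite eq_sym (negbTE r1)|case: eqP].
- move=> v st o oC a sa /= hr [g1 g2]; split; last first.
    exists (st 1 + st 1 + 3); first by rewrite /cost; have := g2 1; lia.
    by rewrite addn1; apply: goes_out.
  by split=> [|s]; rewrite /upd ?eqxx ?size_rcons //; case: eqP.
- move=> st o a _ _ g; split=> //; exists 0 => //; rewrite addn0; exact: goes0.
- move=> c1 c2 st o n1 st1 o1 n2 st2 o2 _ IH1 _ IH2 a /= /sub_at_cat [s1]; rewrite size_comp => s2 hr g.
  have [g1 [m1 h1 go1]] := IH1 _ s1 (leq_trans (leq_maxl _ _) hr) g.
  have [g2 [m2 h2 go2]] := IH2 _ s2 (leq_trans (leq_maxr _ _) hr) g1.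
  split=> //; exists (m1 + m2); first by rewrite mulnDl leq_add.
  by rewrite addnA; apply: goes_trans go1 go2.
- move=> r s c1 c2 st o n st' o' E _ IH a /= sa hr g.
  have [sa0 /sub_at_cat [sa1 sa2]] := sub_at_cat (l1 := [:: mEq r s a.+1 (a.+1 + len c1).+1]) sa.
  rewrite addn1 in sa1 sa2; rewrite size_comp in sa2.
  have [sa3 _] := sub_at_cat (l1 := [:: mJmp (a + len c1 + len c2 + 2)]) sa2.
  have hr1 : rmax c1 <= R by lia.
  have [g1 [m h1 go]] := IH _ sa1 hr1 g.
  split=> //; exists ((st r + st r + 3) + m + 3).
    by rewrite !mulSn; have := proj2 g r; rewrite /cost in h1 *; lia.
  have rR : r < R by lia.
  have sR : s < R by lia.
  have g0 := @goes_eq _ _ _ _ _ st o sa0 rR sR; have Eb : st r == st s by apply/eqP.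
  rewrite Eb in g0; have gj := @goes_jmp _ _ st' o' sa3.
  by rewrite !addnA; exact: goes_trans (goes_trans g0 go) gj.
- move=> r s c1 c2 st o n st' o' E _ IH a /= sa hr g.
  have [sa0 /sub_at_cat [sa1 sa2]] := sub_at_cat (l1 := [:: mEq r s a.+1 (a.+1 + len c1).+1]) sa.
  rewrite addn1 in sa1 sa2; rewrite size_comp in sa2.
  have [_ sa3] := sub_at_cat (l1 := [:: mJmp (a + len c1 + len c2 + 2)]) sa2; rewrite addn1 in sa3.
  have hr1 : rmax c2 <= R by lia.
  have [g1 [m h1 go]] := IH _ sa3 hr1 g.
  split=> //; exists ((st r + st r + 3) + m).
    by rewrite !mulSn; have := proj2 g r; rewrite /cost in h1 *; lia.
  have rR : r < R by lia.
  have sR : s < R by lia.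
  have g0 := @goes_eq _ _ _ _ _ st o sa0 rR sR; rewrite (negbTE E) in g0.
  rewrite (_ : a + (len c1 + len c2 + 2) = (a.+1 + len c1).+1 + len c2); last by lia.
  exact: goes_trans g0 go.
- move=> r c1 c2 st o n st' o' E _ IH a /= sa hr g.
  have [sa0 /sub_at_cat [sa1 sa2]] := sub_at_cat (l1 := [:: mBit r a.+1 (a.+1 + len c1).+1]) sa.
  rewrite addn1 in sa1 sa2; rewrite size_comp in sa2.
  have [sa3 _] := sub_at_cat (l1 := [:: mJmp (a + len c1 + len c2 + 2)]) sa2.
  have hr1 : rmax c1 <= R by lia.
  have [g1 [m h1 go]] := IH _ sa1 hr1 g.
  split=> //; exists ((st r + st r + 3) + m + 3).
    by rewrite !mulSn; have := proj2 g r; rewrite /cost in h1 *; lia.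
  have rR : r < R by lia.
  have g0 := @goes_bit _ _ _ _ st o sa0 rR; rewrite E in g0.
  have gj := @goes_jmp _ _ st' o' sa3.
  by rewrite !addnA; exact: goes_trans (goes_trans g0 go) gj.
- move=> r c1 c2 st o n st' o' E _ IH a /= sa hr g.
  have [sa0 /sub_at_cat [sa1 sa2]] := sub_at_cat (l1 := [:: mBit r a.+1 (a.+1 + len c1).+1]) sa.
  rewrite addn1 in sa1 sa2; rewrite size_comp in sa2.
  have [_ sa3] := sub_at_cat (l1 := [:: mJmp (a + len c1 + len c2 + 2)]) sa2; rewrite addn1 in sa3.
  have hr1 : rmax c2 <= R by lia.
  have [g1 [m h1 go]] := IH _ sa3 hr1 g.
  split=> //; exists ((st r + st r + 3) + m).
    by rewrite !mulSn; have := proj2 g r; rewrite /cost in h1 *; lia.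
  have rR : r < R by lia.
  have g0 := @goes_bit _ _ _ _ st o sa0 rR; rewrite (negbTE E) in g0.
  rewrite (_ : a + (len c1 + len c2 + 2) = (a.+1 + len c1).+1 + len c2); last by lia.
  exact: goes_trans g0 go.
- move=> i b c st o E a /= sa hr g.
  have [sa0 _] := sub_at_cat (l1 := [:: mEq i b (a + len c + 3) a.+1]) sa.
  split=> //; exists (st i + st i + 3); first by have := proj2 g i; rewrite /cost; lia.
  have iR : i < R by lia.
  have bR : b < R by lia.
  have g0 := @goes_eq _ _ _ _ _ st o sa0 iR bR; have Eb : st i == st b by apply/eqP.
  by rewrite Eb in g0; rewrite addnA.
- move=> i b c st o n1 st1 o1 n2 st2 o2 i1 E _ IH1 iC _ IH2 a /= sa hr g.
  have [sa0 /sub_at_cat [sa1 sa2]] := sub_at_cat (l1 := [:: mEq i b (a + len c + 3) a.+1]) sa.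
  rewrite addn1 in sa1 sa2; rewrite size_comp in sa2.
  have [sa3 sa4] := sub_at_cat (l1 := [:: mInc i (a.+1 + len c).+1]) sa2; rewrite addn1 in sa4.
  have hr1 : rmax c <= R by lia.
  have [g1 [m1 h1 go1]] := IH1 _ sa1 hr1 g.
  have g1' : good (upd st1 i (st1 i).+1) o1.
    by case: g1 => ga gb; split=> [|s]; rewrite /upd; [rewrite eq_sym (negbTE i1)|case: eqP].
  have [g2 [m2 h2 go2]] := IH2 _ sa hr g1'.
  split=> //; exists ((st i + st i + 3) + m1 + (st1 i + st1 i + 3) + 3 + m2).
    rewrite !mulnDl; have := proj2 g i; have := proj2 g1 i; rewrite /cost in h1 h2 *; lia.
  have iR : i < R by lia.
  have bR : b < R by lia.
  have g0 := @goes_eq _ _ _ _ _ st o sa0 iR bR; rewrite (negbTE E) in g0.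
  have gi := @goes_inc _ _ _ st1 o1 sa3 iR; have gj := @goes_jmp _ _ (upd st1 i (st1 i).+1) o1 sa4.
  exact: goes_trans (goes_trans (goes_trans (goes_trans g0 go1) gi) gj) go2.
Qed.
End Sim.
End Machine.

(** * Polynomial bounds *)

(** With a base of at least 2, such bounds are stable under sums, products and composition; [pb_std]
    returns to the form used for running times. *)
Definition pb (g : nat -> nat) : Prop := exists c, forall n, g n <= (n + 2) ^ c.

Lemma pb_const m : pb (fun=> m).
Proof.
exists m => n; apply: leq_trans (ltnW (ltn_expl m (ltnSn 1))) _.
by case: m => // m; rewrite leq_exp2r // leq_addl.
Qed.
Lemma pb_id : pb id.
Proof. by exists 1 => n; rewrite expn1 leq_addr. Qed.
Lemma pb_add g h : pb g -> pb h -> pb (fun n => g n + h n).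
Proof.
move=> [c hc] [d hd]; exists (c + d).+1 => n.
have p : 0 < n + 2 by rewrite addn2.
have h1 : g n <= (n + 2) ^ (c + d) by apply: leq_trans (hc n) _; rewrite leq_pexp2l // leq_addr.
have h2 : h n <= (n + 2) ^ (c + d) by apply: leq_trans (hd n) _; rewrite leq_pexp2l // leq_addl.
apply: leq_trans (leq_add h1 h2) _; rewrite expnS addnn -mul2n leq_mul2r leq_addl orbT //.
Qed.
Lemma pb_mul g h : pb g -> pb h -> pb (fun n => g n * h n).
Proof. by move=> [c hc] [d hd]; exists (c + d) => n; rewrite expnD leq_mul. Qed.
Lemma pb_comp g h : pb g -> pb h -> pb (fun n => g (h n)).
Proof.
move=> [c hc] hh; have [d hd] := pb_add hh (pb_const 2).
exists (d * c) => n; apply: leq_trans (hc _) _; rewrite expnM; case: c {hc} => // c.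
by rewrite leq_exp2r.
Qed.
Lemma pb_std g : pb g -> exists c, forall n, g n <= n ^ c + c.
Proof.
move=> [c hc]; exists (2 * c + 3 ^ c) => n; apply: leq_trans (hc n) _.
case: (leqP n 1) => hn.
  apply: (@leq_trans (3 ^ c)); last by lia.
  by case: c {hc} => // c; rewrite leq_exp2r //; lia.
apply: (@leq_trans (n ^ (2 * c))).
  by rewrite expnM; case: c {hc} => // c; rewrite leq_exp2r // -mulnn; nia.
apply: leq_trans _ (leq_addr _ _); rewrite leq_pexp2l //; lia.
Qed.

Lemma start_at R code x :
  at_ (goto code 0) 0 (TS R x (fun=> 0) [::]) (tm_run (machine (R := R) code) x 1).
Proof.
split=> //= i; case: eqP => [->|/eqP ni].
  by rewrite /TS /TP /inp /=; congr (_, _, _, _); case: x => [|[] x].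
have E : [ffun=> false] = [ffun _ : 'I_R => 0 == i] by apply/ffunP => r; rewrite !ffunE eq_sym (negbTE ni).
rewrite /TS /TP /inp nth_nil (negbTE ni) -E; have [hi|hi] := ltnP i (size x).
  by rewrite (nth_map false) //; case: (nth false x i).
by rewrite nth_default ?size_map.
Qed.

Lemma run_prog R code x q T m : goes (R := R) (code := code) m (goto code 0) 0 (TS R x (fun=> 0) [::]) q 0 T ->
  at_ q 0 T (tm_run (machine (R := R) code) x m.+1).
Proof. by move=> [g]; rewrite /tm_run iterSr; apply: g; exact: start_at. Qed.

Lemma run_fin R (code : seq (micro R)) x st o cf : at_ (sFin code) 0 (TS R x st o) cf ->
  (iter (size o).+1 (@tm_step (machine code)) cf).1.1 = sHalt code true /\
  tape_output (machine code) (iter (size o).+1 (@tm_step (machine code)) cf).2 o.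
Proof.
move=> at0.
have key j : j <= size o -> let cf' := iter j (@tm_step (machine code)) cf in
    [/\ cf'.1.1 = sFin code, cf'.1.2 = j, (forall i, i < j -> cf'.2 i = inl (Some (nth false o i))) &
        forall i, j <= i -> dec (cf'.2 i) = TS R x st o i].
  elim: j => [|j IH] hj; first by case: at0 => h1 h2 h3; split.
  have [] := IH (ltnW hj); rewrite iterS; case: (iter j _ cf) => [[q h] tp] /= -> -> h3 h4.
  rewrite /tm_step /tm_halting /= h4 // /cout /= /inp (nth_map false) //=; split=> // i hi.
    case: (eqVneq i j) => [->//|ij]; apply: h3; lia.
  by rewrite ifN ?h4 //; lia.
have [] := key _ (leqnn _); rewrite iterS; case: (iter _ _ cf) => [[q h] tp] /= -> -> h3 h4.
rewrite /tm_step /tm_halting /= h4 // /cout /= /inp nth_default ?size_map //=; split=> //.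
split=> [i hi|]; last by rewrite eqxx.
by rewrite ifN ?h3 //; [case: (nth _ _ _)|lia].
Qed.

Lemma sub_at_full R (code post : seq (micro R)) : sub_at (code ++ post) 0 code.
Proof. by exists [::], post. Qed.

Lemma goto_end R (code : seq (micro R)) : goto code (size code) = sFin code.
Proof. by rewrite /goto insubF ?ltnn // eqxx. Qed.

Lemma good0 C : good C (fun=> 0) [::]. Proof. by []. Qed.

Lemma compute_poly c (F : seq bool -> seq bool) (Cf nf : nat -> nat) : pb Cf -> pb nf ->
  (forall x : seq bool, size x <= Cf (size x)) ->
  (forall x, exists n st', bs (Cf (size x)) x c (fun=> 0) [::] n st' (F x) /\ n <= nf (size x)) ->
  poly_computable F.
Proof.
move=> pC pn xC H; set R := rmax c; pose code := compile R c 0; exists (machine code); split.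
  exact: machine_wf.
have [d hd] : exists d, forall n, nf n * (Cf n + Cf n + 3) + (Cf n + 3) <= n ^ d + d.
  apply: pb_std; apply: pb_add; first by apply: pb_mul => //; apply: pb_add; [exact: pb_add|exact: pb_const].
  by apply: pb_add => //; exact: pb_const.
exists d => x; have [n [st' [hb hn]]] := H x.
have sa : sub_at code 0 (compile R c 0) by rewrite -{1}[code]cats0; exact: sub_at_full.
have [[g1 g2] [m hm go]] := sim (xC x) hb sa (leqnn _) (good0 _).
rewrite add0n -(size_comp R c 0) -/code goto_end in go.
have := run_fin (run_prog go); rewrite /tm_run -iterD => -[h1 h2].
exists ((size (F x)).+1 + m.+1); split; last first.
  by rewrite /tm_run; split; [rewrite /tm_halting h1|].
apply: leq_trans (hd _); have := g2 1; rewrite g1 => h3.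
have : m <= nf (size x) * (Cf (size x) + Cf (size x) + 3).
  by apply: leq_trans hm _; rewrite leq_mul2r hn orbT.
by move: (_ * _); lia.
Qed.

Lemma decide_poly c D (L : language) (Cf nf : nat -> nat) : pb Cf -> pb nf ->
  (forall x : seq bool, size x <= Cf (size x)) ->
  (forall x, exists n st', [/\ bs (Cf (size x)) x c (fun=> 0) [::] n st' [::], n <= nf (size x),
     st' 0 = 0 & (st' D != 0) <-> L x]) ->
  in_P L.
Proof.
move=> pC pn xC H; set R := maxn D.+1 (rmax c).+1; pose N := (len c).+1.
(* If register [D] is 0 the jump goes beyond the end of the code and rejects; otherwise it goes
   exactly to the end and accepts. *)
pose code := compile R c 0 ++ [:: mEq R D 0 N.+1 N]; exists (machine code); split.
  exact: machine_wf.
have sN : size code = N by rewrite size_cat size_comp addn1.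
have [d hd] : exists d, forall n, nf n * (Cf n + Cf n + 3) + (Cf n + Cf n + 6) <= n ^ d + d.
  apply: pb_std; apply: pb_add; first by apply: pb_mul => //; apply: pb_add; [exact: pb_add|exact: pb_const].
  by apply: pb_add => //; [exact: pb_add|exact: pb_const].
exists d => x; have [n [st' [hb hn s0 hL]]] := H x.
have hR : rmax c <= R by rewrite /R; lia.
have sa1 : sub_at code 0 (compile R c 0) by exact: sub_at_full.
have [[g1 g2] [m hm go]] := sim (xC x) hb sa1 hR (good0 _).
rewrite add0n in go.
have sa2 : sub_at code (len c) [:: mEq R D 0 N.+1 N].
  by exists (compile R c 0), [::]; rewrite size_comp cats0.
have DR : D < R by rewrite /R; lia.
have R0 : 0 < R by rewrite /R; lia.
have ge := @goes_eq _ _ x _ _ _ _ _ st' [::] sa2 DR R0.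
have {go} := run_prog (goes_trans go ge); rewrite s0; set m' := m + _ => go.
have hm' : m' <= nf (size x) * (Cf (size x) + Cf (size x) + 3) + (Cf (size x) + Cf (size x) + 3).
  have : m <= nf (size x) * (Cf (size x) + Cf (size x) + 3).
    by apply: leq_trans hm _; rewrite leq_mul2r hn orbT.
  by rewrite /m'; have := g2 D; move: (_ * _); lia.
case: eqP go hL => [_ go hL|_ go hL].
  exists m'.+1; split; first by apply: leq_trans (hd _); move: hm'; move: (_ * _); lia.
  case: go; rewrite /goto insubF; last by rewrite sN; lia.
  rewrite ifN; last by rewrite sN; lia.
  move=> -> _ _; split; first by rewrite /tm_halting eqxx orbT.
  by split=> [//|/hL].
rewrite -sN goto_end in go; have := run_fin go; rewrite /tm_run -iterD => -[h1 _].
exists m'.+2; split; first by apply: leq_trans (hd _); move: hm'; move: (_ * _); lia.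
rewrite /tm_run h1; split=> //; split=> // _; exact/hL.
Qed.

(** * Bounded arithmetic formulas over the input word *)

Inductive term := V of nat | K of nat | Add of term & term | Mul of term & term.
Inductive fm := Eq of term & term | Bit of term | Not of fm | And of fm & fm | Ex of nat & term & fm.

Fixpoint teval (t : term) (st : nat -> nat) : nat := match t with
  | V v => st v | K c => c | Add a b => teval a st + teval b st | Mul a b => teval a st * teval b st end.
Fixpoint ev (f : fm) (x : seq bool) (st : nat -> nat) : bool := match f with
  | Eq a b => teval a st == teval b st
  | Bit t => nth false x (teval t st)
  | Not f => ~~ ev f x st
  | And f g => ev f x st && ev g x st
  | Ex v t f => has (fun i => ev f x (upd st v i)) (iota 0 (teval t st)) end.

(* Variable 1 is excluded because the compiled program keeps the output length in register 1. *)
Fixpoint tvb (t : term) (d : nat) : bool := match t with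
  | V v => (v != 1) && (v < d) | K _ => true | Add a b | Mul a b => tvb a d && tvb b d end.
Fixpoint fvb (f : fm) (d : nat) : bool := match f with
  | Eq a b => tvb a d && tvb b d | Bit t => tvb t d | Not f => fvb f d
  | And f g => fvb f d && fvb g d | Ex v t f => [&& 2 <= v, v < d, tvb t d & fvb f d] end.

Definition Zero r := Copy r 0.
Fixpoint Incs n r := if n is n'.+1 then Seq (Incs n' r) (Inc r) else Skip.
Definition Set1 r := Seq (Zero r) (Inc r).

(** The value is left in register [r], the higher registers being scratch; sums and products are
    loops of increments. *)
Fixpoint cterm (t : term) (r : nat) : com := match t with
  | V v => Copy r v
  | K c => Seq (Zero r) (Incs c r)
  | Add a b => Seq (cterm a r) (Seq (cterm b r.+1) (Seq (Zero r.+2) (Loop r.+2 r.+1 (Inc r))))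
  | Mul a b => Seq (cterm a r.+1) (Seq (cterm b r.+2) (Seq (Zero r) (Seq (Zero r.+3)
      (Loop r.+3 r.+2 (Seq (Zero r.+4) (Loop r.+4 r.+1 (Inc r)))))))
  end.

(** Truth is left as 0 or 1 in register [d]. A quantifier saves its variable in [d.+2] and restores
    it, as the variable may be in use outside. *)
Fixpoint cfm (f : fm) (d : nat) : com := match f with
  | Eq a b => Seq (cterm a d) (Seq (cterm b d.+1) (IfEq d d.+1 (Set1 d) (Zero d)))
  | Bit t => Seq (cterm t d) (IfBit d (Set1 d) (Zero d))
  | Not f => Seq (cfm f d) (IfEq d 0 (Set1 d) (Zero d))
  | And f g => Seq (cfm f d) (Seq (cfm g d.+1) (IfEq d 0 Skip (Copy d d.+1)))
  | Ex v t f => Seq (cterm t d.+1) (Seq (Copy d.+2 v) (Seq (Zero d) (Seq (Zero v)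
      (Seq (Loop v d.+1 (Seq (cfm f d.+3) (IfEq d.+3 0 Skip (Set1 d)))) (Copy v d.+2)))))
  end.

(** For variables at most [B], [bt] bounds values, [capt] the registers and [ct] the time; [capf]
    and [cf] do this for formulas, where a quantifier raises [B] by the bound of its range. *)
Fixpoint bt t (B : nat) : nat := match t with
  | V _ => B | K c => c | Add a b => bt a B + bt b B | Mul a b => bt a B * bt b B end.
Fixpoint capt t (B : nat) : nat := match t with
  | V _ => B | K c => c | Add a b | Mul a b => capt a B + capt b B + bt t B + bt a B + bt b B end.
Fixpoint ct t (B : nat) : nat := match t with
  | V _ => 2 | K c => 2 + c
  | Add a b => ct a B + ct b B + (2 + (bt b B * 4 + 1))
  | Mul a b => ct a B + ct b B + (4 + (bt b B * (bt a B * 4 + 6) + 1)) end.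
Fixpoint capf f (B : nat) : nat := match f with
  | Eq a b => capt a B + capt b B + 1
  | Bit t => capt t B + 1
  | Not f => capf f B + 1
  | And f g => capf f B + capf g B
  | Ex v t f => capt t B + bt t B + capf f (B + bt t B) + 1 end.
Fixpoint cf f (B : nat) : nat := match f with
  | Eq a b => ct a B + ct b B + 5
  | Bit t => ct t B + 5
  | Not f => cf f B + 5
  | And f g => cf f B + cf g B + 3
  | Ex v t f => ct t B + 8 + (bt t B * (cf f (B + bt t B) + 7) + 1) end.

Lemma pb_bt t : pb (bt t).
Proof.
by elim: t => [v|c|a ha b hb|a ha b hb] /=; [exact: pb_id|exact: pb_const|exact: pb_add|exact: pb_mul].
Qed.
Lemma pb_capt t : pb (capt t).
Proof.
elim: t => [v|c|a ha b hb|a ha b hb]; [exact: pb_id|exact: pb_const| |];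
  by do !apply: pb_add => //; exact: pb_bt.
Qed.
Lemma pb_ct t : pb (ct t).
Proof.
have pc := pb_const; have pbt := pb_bt.
elim: t => [v|c|a ha b hb|a ha b hb] /=; [exact: pb_const|exact: pb_const| |].
  by do !apply: pb_add => //; apply: pb_mul.
do !apply: pb_add => //; apply: pb_mul => //; apply: pb_add => //; exact: pb_mul.
Qed.
Lemma pb_capf f : pb (capf f).
Proof.
have pc := pb_const; have pbt := pb_bt; have pct := pb_capt.
elim: f => [a b|t|f hf|f hf g hg|v t f hf] /=; do !apply: pb_add => //.
by apply: (pb_comp (g := capf f)) => //; apply: pb_add => //; exact: pb_id.
Qed.
Lemma pb_cf f : pb (cf f).
Proof.
have pc := pb_const; have pbt := pb_bt; have pct := pb_ct.
elim: f => [a b|t|f hf|f hf g hg|v t f hf] /=; do !apply: pb_add => //.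
apply: pb_mul => //; apply: pb_add => //.
by apply: (pb_comp (g := cf f)) => //; apply: pb_add => //; exact: pb_id.
Qed.

Lemma teval_ext t d st st' : tvb t d -> (forall v, v != 1 -> v < d -> st v = st' v) -> teval t st = teval t st'.
Proof.
move=> + E; elim: t => [v|c|a ha b hb|a ha b hb] //=; first by case/andP; exact: E.
  by case/andP => /ha -> /hb ->.
by case/andP => /ha -> /hb ->.
Qed.

Lemma ev_ext f x d st st' : fvb f d -> (forall v, v != 1 -> v < d -> st v = st' v) -> ev f x st = ev f x st'.
Proof.
elim: f st st' => [a b|t|f hf|f hf g hg|v t f hf] st st' /=.
- by case/andP => h1 h2 E; rewrite (teval_ext h1 E) (teval_ext h2 E).
- by move=> h E; rewrite (teval_ext h E).
- by move=> h E; rewrite (hf _ st').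
- by case/andP => h1 h2 E; rewrite (hf _ st') // (hg _ st').
- case/and4P => _ _ h1 h2 E; rewrite (teval_ext h1 E); apply: eq_has => i.
  by apply: hf => // w w1 hw; rewrite /upd; case: eqP => // _; exact: E.
Qed.

Lemma teval_le t d st B : tvb t d -> (forall v, v < d -> st v <= B) -> teval t st <= bt t B.
Proof.
move=> + E; elim: t => [v|c|a ha b hb|a ha b hb] //=; first by case/andP => _; exact: E.
  by case/andP => h1 h2; apply: leq_add; [exact: ha|exact: hb].
case/andP => h1 h2.
by apply: leq_mul; [exact: ha|exact: hb].
Qed.

Lemma upd_eq st r v : upd st r v r = v. Proof. by rewrite /upd eqxx. Qed.
Lemma upd_neq st r v s : s != r -> upd st r v s = st s. Proof. by rewrite /upd => /negbTE ->. Qed.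

(** * Correctness and cost of compiled formulas *)

Section Exec.
Variables (C : nat) (x : seq bool).

Lemma loop_inv i b c (I : nat -> (nat -> nat) -> seq bool -> Prop) m q st o :
  i != 1 -> m <= C -> st i = 0 -> st b = m -> I 0 st o ->
  (forall j st o, j < m -> I j st o -> st i = j -> st b = m ->
     exists n st1 o1, [/\ bs C x c st o n st1 o1, n <= q, st1 i = j, upd st1 i j.+1 b = m & I j.+1 (upd st1 i j.+1) o1]) ->
  exists n st' o', [/\ bs C x (Loop i b c) st o n st' o', n <= m * (q + 3) + 1 & I m st' o'].
Proof.
move=> i1 mC si sb I0 step.
have key d : forall j st o, j + d = m -> st i = j -> st b = m -> I j st o ->
    exists n st' o', [/\ bs C x (Loop i b c) st o n st' o', n <= d * (q + 3) + 1 & I m st' o'].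
  elim: d {st o si sb I0} => [|d IH] j st o jd si sb Ij.
    rewrite addn0 in jd; exists 1, st, o; split=> //; last by rewrite -jd.
    by apply: BLoopE; rewrite si sb.
  have jm : j < m by lia.
  have [n1 [st1 [o1 [b1 h1 s1 s2 I1]]]] := step _ _ _ jm Ij si sb.
  have jd' : j.+1 + d = m by lia.
  have [n2 [st2 [o2 [b2 h2 I2]]]] := IH _ _ _ jd' (upd_eq _ _ _) s2 I1.
  exists (n1 + n2 + 3), st2, o2; split=> //.
    by apply: BLoopS b1 _ _ => //; [rewrite si sb; lia|rewrite s1; lia|rewrite s1].
  by rewrite mulSn; lia.
exact: (key m 0).
Qed.

Lemma bs_zero st o r : 1 < r -> st 0 = 0 -> bs C x (Zero r) st o 2 (upd st r 0) o.
Proof. by move=> hr s0; rewrite -{2}s0; apply: BCopy; lia. Qed.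

Lemma bs_set1 st o r : 0 < C -> 1 < r -> st 0 = 0 -> bs C x (Set1 r) st o 3 (upd (upd st r 0) r 1) o.
Proof.
move=> C0 hr s0; have := @BInc C x r (upd st r 0) o; rewrite upd_eq => h.
by apply: (BSeq (n1 := 2) (n2 := 1) (bs_zero _ hr s0)); apply: h => //; lia.
Qed.

Lemma cterm_ok t d r st o B : tvb t d -> d <= r -> 1 < r -> st 0 = 0 ->
  (forall v, v < d -> st v <= B) -> capt t B <= C ->
  exists n st', [/\ bs C x (cterm t r) st o n st' o, n <= ct t B, st' r = teval t st &
                    forall v, v < r -> st' v = st v].
Proof.
elim: t r st => [v|c|a IHa b IHb|a IHa b IHb] r st /=.
- move=> vd dr r1 s0 sB cC; exists 2, (upd st r (st v)); split=> //; first by apply: BCopy; lia.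
    by rewrite upd_eq.
  by move=> w hw; rewrite upd_neq //; lia.
- move=> _ dr r1 s0 sB cC.
  have [n [st' [h1 h2 h3 h4]]] : exists n st', [/\ bs C x (Incs c r) (upd st r 0) o n st' o, n <= c, st' r = c & forall v, v < r -> st' v = st v].
    elim: c cC => [|c IH] cC.
      exists 0, (upd st r 0); split=> //; [exact: BSkip|by rewrite upd_eq|].
      by move=> w hw; rewrite upd_neq //; lia.
    have [n [st' [h1 h2 h3 h4]]] := IH (ltnW cC).
    have r1' : r != 1 by lia.
    have sC : st' r < C by rewrite h3.
    exists (n + 1), (upd st' r (st' r).+1); split; [exact: BSeq h1 (BInc _ _ r1' sC)|by lia|by rewrite upd_eq h3|].
    by move=> w hw; rewrite upd_neq ?h4 //; lia.
  exists (2 + n), st'; split=> //; first exact: BSeq (bs_zero _ r1 s0) h1.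
- case/andP => va vb dr r1 s0 sB cC.
  have cap : capt a B <= C by lia.
  have [n1 [st1 [b1 h1 e1 p1]]] := IHa r st va dr r1 s0 sB cap.
  have s10 : st1 0 = 0 by rewrite p1 //; lia.
  have sB1 v : v < d -> st1 v <= B by move=> hv; rewrite p1 ?sB //; lia.
  have capb : capt b B <= C by lia.
  have [n2 [st2 [b2 h2 e2 p2]]] := IHb r.+1 st1 vb (leqW dr) (leqW r1) s10 sB1 capb.
  have eb : teval b st1 = teval b st by apply: (teval_ext vb) => v _ hv; rewrite p1 //; lia.
  have hb : teval b st <= bt b B := teval_le vb sB.
  have ha : teval a st <= bt a B := teval_le va sB.
  have s20 : st2 0 = 0 by rewrite p2 // s10.
  have b3 := bs_zero (r := r.+2) o (ltnW (ltnW r1) : 1 < r.+2) s20.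
  pose I j (s : nat -> nat) (o' : seq bool) := [/\ o' = o, s r = teval a st + j & forall v, v < r -> s v = st v].
  have [||||||n4 [st4 [o4 [b4 h4 [Eo e4 p4]]]]] := @loop_inv r.+2 r.+1 (Inc r) I (teval b st) 1 (upd st2 r.+2 0) o.
  + by lia.
  + by lia.
  + by rewrite upd_eq.
  + by rewrite upd_neq ?e2 //; lia.
  + split=> //; first by rewrite upd_neq ?p2 ?e1 ?addn0 //; lia.
    by move=> v hv; rewrite upd_neq ?p2 ?p1 //; lia.
  + move=> j s o' jm [-> es ps] si sb.
    have r1' : r != 1 by lia.
    have sC : s r < C by rewrite es; lia.
    exists 1, (upd s r (s r).+1), o; split=> //; first exact: BInc.
    * by rewrite upd_neq //; lia.
    * by rewrite !upd_neq //; lia.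
    * split=> //; first by rewrite upd_neq ?upd_eq ?es ?addnS //; lia.
      by move=> v hv; rewrite !upd_neq ?ps //; lia.
  rewrite Eo in b4.
  exists (n1 + (n2 + (2 + n4))), st4; split=> //; last 2 first.
    exact: (BSeq b1 (BSeq b2 (BSeq b3 b4))).
  have : teval b st * (1 + 3) <= bt b B * 4 by rewrite leq_mul2r hb orbT.
  by move: h1 h2 h4; lia.
- case/andP => va vb dr r1 s0 sB cC.
  have cap : capt a B <= C by lia.
  have [n1 [st1 [b1 h1 e1 p1]]] := IHa r.+1 st va (leqW dr) (leqW r1) s0 sB cap.
  have s10 : st1 0 = 0 by rewrite p1 //; lia.
  have sB1 v : v < d -> st1 v <= B by move=> hv; rewrite p1 ?sB //; lia.
  have capb : capt b B <= C by lia.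
  have [n2 [st2 [b2 h2 e2 p2]]] := IHb r.+2 st1 vb (leqW (leqW dr)) (leqW (leqW r1)) s10 sB1 capb.
  have eb : teval b st1 = teval b st by apply: (teval_ext vb) => v _ hv; rewrite p1 //; lia.
  have hb : teval b st <= bt b B := teval_le vb sB.
  have ha : teval a st <= bt a B := teval_le va sB.
  have s20 : st2 0 = 0 by rewrite p2 // s10.
  have b3 := bs_zero (r := r) o r1 s20.
  have s30 : upd st2 r 0 0 = 0 by rewrite upd_neq //; lia.
  have r31 : 1 < r.+3 by lia.
  have b3' := bs_zero (r := r.+3) o r31 s30.
  pose st3 := upd (upd st2 r 0) r.+3 0.
  pose I j (s : nat -> nat) (o' : seq bool) := [/\ o' = o, s r = j * teval a st, s r.+1 = teval a st & forall v, v < r -> s v = st v].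
  have hab : teval b st * teval a st <= bt a B * bt b B by rewrite mulnC leq_mul.
  have [||||||n4 [st4 [o4 [b4 h4 [Eo e4 _ p4]]]]] := @loop_inv r.+3 r.+2 (Seq (Zero r.+4) (Loop r.+4 r.+1 (Inc r))) I
      (teval b st) (bt a B * 4 + 3) st3 o.
  + by lia.
  + by lia.
  + by rewrite /st3 upd_eq.
  + by rewrite /st3 !upd_neq ?e2 //; lia.
  + split=> //; first by rewrite /st3 upd_neq ?upd_eq //; lia.
      by rewrite /st3 !upd_neq ?p2 //; lia.
    by move=> v hv; rewrite /st3 !upd_neq ?p2 ?p1 //; lia.
  + move=> j s o' jm [-> es es1 ps] si sb.
    have sz : s 0 = 0 by rewrite ps ?s0 //; lia.
    have r41 : 1 < r.+4 by lia.
    have c1 := bs_zero (r := r.+4) o r41 sz.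
    pose I2 i (s' : nat -> nat) (o' : seq bool) := [/\ o' = o, s' r = j * teval a st + i, s' r.+3 = j, s' r.+2 = teval b st & forall v, v < r -> s' v = st v] /\ s' r.+1 = teval a st.
    have [||||||n5 [st5 [o5 [c2 h5 [[Eo f1 f2 f3 f4] f5]]]]] := @loop_inv r.+4 r.+1 (Inc r) I2 (teval a st) 1 (upd s r.+4 0) o.
    * by lia.
    * by lia.
    * by rewrite upd_eq.
    * by rewrite upd_neq //; lia.
    * split; last by rewrite upd_neq //; lia.
      split=> //; try by rewrite upd_neq ?addn0 //; lia.
      by move=> v hv; rewrite upd_neq ?ps //; lia.
    * move=> i s' o'' im [[-> g1 g2 g3 g4] g5] si' sb'.
      have r1' : r != 1 by lia.
      have lt : j * teval a st + i < teval b st * teval a st.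
        have : j.+1 * teval a st <= teval b st * teval a st by rewrite leq_mul2r jm orbT.
        by rewrite mulSnr; lia.
      have sC : s' r < C by rewrite g1; lia.
      exists 1, (upd s' r (s' r).+1), o; split=> //; first exact: BInc.
      - by rewrite upd_neq //; lia.
      - by rewrite !upd_neq //; lia.
      - split; last by rewrite !upd_neq //; lia.
        split=> //; try by rewrite !upd_neq //; lia.
          by rewrite upd_neq ?upd_eq ?g1 ?addnS //; lia.
        by move=> v hv; rewrite !upd_neq ?g4 //; lia.
    rewrite Eo in c2.
    exists (2 + n5), st5, o; split=> //.
    * exact: BSeq c1 c2.
    * have : teval a st * (1 + 3) <= bt a B * 4 by rewrite leq_mul2r ha orbT.
      by move: h5; lia.
    * by rewrite upd_neq //; lia.
    * split=> //; try by rewrite upd_neq //; lia.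
      by move=> v hv; rewrite upd_neq ?f4 //; lia.
  rewrite Eo in b4.
  exists (n1 + (n2 + (2 + (2 + n4)))), st4; split=> //; last by rewrite mulnC.
    exact: (BSeq b1 (BSeq b2 (BSeq b3 (BSeq b3' b4)))).
  have : teval b st * (bt a B * 4 + 3 + 3) <= bt b B * (bt a B * 4 + 6).
    by rewrite -addnA leq_mul2r hb orbT.
  by move: h1 h2 h4; lia.
Qed.

Lemma bs_tobool (b : bool) st o n r c : 0 < C -> 1 < r -> st 0 = 0 ->
  (if b then bs C x (Set1 r) st o 3 (upd (upd st r 0) r 1) o -> bs C x c st o n (upd (upd st r 0) r 1) o
   else bs C x (Zero r) st o 2 (upd st r 0) o -> bs C x c st o n (upd st r 0) o) ->
  exists st', [/\ bs C x c st o n st' o, st' r = b & forall v, v < r -> st' v = st v].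
Proof.
move=> C0 hr s0; case: b => h.
  exists (upd (upd st r 0) r 1); split; [by apply: h; exact: bs_set1|by rewrite upd_eq|].
  by move=> v hv; rewrite !upd_neq //; lia.
exists (upd st r 0); split; [by apply: h; exact: bs_zero|by rewrite upd_eq|].
by move=> v hv; rewrite !upd_neq //; lia.
Qed.

(** The scratch base [r] is kept apart from the bound [d] on the variables because subformulas are
    compiled further up. *)
Lemma cfm_ok f d r st o B : fvb f d -> d <= r -> 1 < d -> st 0 = 0 ->
  (forall v, v < d -> st v <= B) -> capf f B <= C ->
  exists n st', [/\ bs C x (cfm f r) st o n st' o, n <= cf f B, st' r = ev f x st &
                    forall v, v < r -> st' v = st v].
Proof.
elim: f r st B => [a b|t|f hf|f hf g hg|v t f hf] r st B /=.
- case/andP => va vb dr d1 s0 sB cC; have r1 : 1 < r by lia.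
  have cap : capt a B <= C by lia.
  have [n1 [st1 [b1 h1 e1 p1]]] := @cterm_ok a d r st o B va dr r1 s0 sB cap.
  have s10 : st1 0 = 0 by rewrite p1 //; lia.
  have sB1 v : v < d -> st1 v <= B by move=> hv; rewrite p1 ?sB //; lia.
  have capb : capt b B <= C by lia.
  have [n2 [st2 [b2 h2 e2 p2]]] := @cterm_ok b d r.+1 st1 o B vb (leqW dr) (leqW r1) s10 sB1 capb.
  have eb : teval b st1 = teval b st by apply: (teval_ext vb) => v _ hv; rewrite p1 //; lia.
  have s20 : st2 0 = 0 by rewrite p2 // s10.
  have C0 : 0 < C by lia.
  have [|st3 [b3 e3 p3]] := @bs_tobool (teval a st == teval b st) st2 o (if teval a st == teval b st then 5 else 3) r
     (IfEq r r.+1 (Set1 r) (Zero r)) C0 r1 s20.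
    case: eqP => [Eab|/eqP nab] h.
      by apply: BIfEqT => //; rewrite p2 // e1 e2 eb.
    by apply: BIfEqF => //; rewrite p2 // e1 e2 eb.
  exists (n1 + (n2 + (if teval a st == teval b st then 5 else 3))), st3; split=> //.
  + exact: BSeq b1 (BSeq b2 b3).
  + by case: ifP => _; lia.
  + by move=> v hv; rewrite p3 ?p2 ?p1 //; lia.
- move=> vt dr d1 s0 sB cC; have r1 : 1 < r by lia.
  have cap : capt t B <= C by lia.
  have [n1 [st1 [b1 h1 e1 p1]]] := @cterm_ok t d r st o B vt dr r1 s0 sB cap.
  have s10 : st1 0 = 0 by rewrite p1 //; lia.
  have C0 : 0 < C by lia.
  have [|st3 [b3 e3 p3]] := @bs_tobool (nth false x (teval t st)) st1 o (if nth false x (teval t st) then 5 else 3) r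
     (IfBit r (Set1 r) (Zero r)) C0 r1 s10.
    case E: (nth false x (teval t st)) => h; first by apply: BIfBitT => //; rewrite e1.
    by apply: BIfBitF => //; rewrite e1 E.
  exists (n1 + (if nth false x (teval t st) then 5 else 3)), st3; split=> //.
  + exact: BSeq b1 b3.
  + by case: ifP => _; lia.
  + by move=> v hv; rewrite p3 ?p1 //; lia.
- move=> vf dr d1 s0 sB cC; have r1 : 1 < r by lia.
  have cap : capf f B <= C by lia.
  have [n1 [st1 [b1 h1 e1 p1]]] := hf r st B vf dr d1 s0 sB cap.
  have s10 : st1 0 = 0 by rewrite p1 //; lia.
  have C0 : 0 < C by lia.
  have [|st3 [b3 e3 p3]] := @bs_tobool (~~ ev f x st) st1 o (if ~~ ev f x st then 5 else 3) r
     (IfEq r 0 (Set1 r) (Zero r)) C0 r1 s10.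
    case E: (ev f x st) e1 => /= e1 h; first by apply: BIfEqF => //; rewrite e1 s10.
    by apply: BIfEqT => //; rewrite e1 s10.
  exists (n1 + (if ~~ ev f x st then 5 else 3)), st3; split=> //.
  + exact: BSeq b1 b3.
  + by case: ifP => _; lia.
  + by move=> v hv; rewrite p3 ?p1 //; lia.
- case/andP => vf vg dr d1 s0 sB cC; have r1 : 1 < r by lia.
  have cap : capf f B <= C by lia.
  have [n1 [st1 [b1 h1 e1 p1]]] := hf r st B vf dr d1 s0 sB cap.
  have s10 : st1 0 = 0 by rewrite p1 //; lia.
  have sB1 v : v < d -> st1 v <= B by move=> hv; rewrite p1 ?sB //; lia.
  have capg : capf g B <= C by lia.
  have [n2 [st2 [b2 h2 e2 p2]]] := hg r.+1 st1 B vg (leqW dr) d1 s10 sB1 capg.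
  have eg : ev g x st1 = ev g x st by apply: (ev_ext _ vg) => v _ hv; rewrite p1 //; lia.
  have s20 : st2 0 = 0 by rewrite p2 // s10.
  case E: (ev f x st) e1 => /= e1.
    exists (n1 + (n2 + 3)), (upd st2 r (st2 r.+1)); split.
    + apply: BSeq b1 (BSeq b2 _); apply: BIfEqF; first by rewrite p2 // e1 s20.
      by apply: BCopy; lia.
    + by lia.
    + by rewrite upd_eq e2 eg.
    + by move=> v hv; rewrite upd_neq ?p2 ?p1 //; lia.
  exists (n1 + (n2 + 2)), st2; split.
  + apply: BSeq b1 (BSeq b2 _); apply: BIfEqT; first by rewrite p2 // e1 s20.
    exact: BSkip.
  + by lia.
  + by rewrite p2 // e1.
  + by move=> v hv; rewrite p2 ?p1 //; lia.
- case/and4P => v2 vd vt vf dr d1 s0 sB cC; have r1 : 1 < r by lia.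
  have cap : capt t B <= C by lia.
  have [n1 [st1 [b1 h1 e1 p1]]] := @cterm_ok t d r.+1 st o B vt (leqW dr) (leqW r1) s0 sB cap.
  have s10 : st1 0 = 0 by rewrite p1 //; lia.
  have C0 : 0 < C by lia.
  have ht : teval t st <= bt t B := teval_le vt sB.
  have r21 : r.+2 != 1 by lia.
  have r2v : r.+2 != v by lia.
  have b2 := @BCopy C x r.+2 v st1 o r21 r2v.
  have s20 : upd st1 r.+2 (st1 v) 0 = 0 by rewrite upd_neq //; lia.
  have b3 := bs_zero (r := r) o r1 s20.
  have s30 : upd (upd st1 r.+2 (st1 v)) r 0 0 = 0 by rewrite upd_neq //; lia.
  have b4 := bs_zero (r := v) o v2 s30.
  pose st4 := upd (upd (upd st1 r.+2 (st1 v)) r 0) v 0.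
  pose ok (i : nat) := ev f x (upd st v i).
  pose I j (s : nat -> nat) (o' : seq bool) := [/\ o' = o, s r = has ok (iota 0 j), s r.+2 = st v & forall w, w < r -> w != v -> s w = st w].
  have [||||||n5 [st5 [o5 [b5 h5 [Eo e5 e5' p5]]]]] := @loop_inv v r.+1 (Seq (cfm f r.+3) (IfEq r.+3 0 Skip (Set1 r))) I
      (teval t st) (cf f (B + bt t B) + 4) st4 o.
  + by lia.
  + by lia.
  + by rewrite /st4 upd_eq.
  + by rewrite /st4 !upd_neq ?e1 //; lia.
  + split=> //; first by rewrite /st4 upd_neq ?upd_eq //; lia.
      have r2r : r.+2 != r by lia.
      by rewrite /st4 (upd_neq _ _ r2v) (upd_neq _ _ r2r) upd_eq p1 //; lia.
    by move=> w hw wv; rewrite /st4 !upd_neq ?p1 //; lia.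
  + move=> j s o' jm [-> es es2 ps] sv sb.
    have sz : s 0 = 0 by rewrite ps ?s0 //; lia.
    have sB' w : w < d -> s w <= B + bt t B.
      move=> hw; case: (eqVneq w v) => [->|wv]; first by rewrite sv; lia.
      by rewrite ps //; [have := sB _ hw; lia|lia].
    have capf' : capf f (B + bt t B) <= C by lia.
    have dr3 : d <= r.+3 by lia.
    have [n6 [st6 [b6 h6 e6 p6]]] := hf r.+3 s (B + bt t B) vf dr3 d1 sz sB' capf'.
    have ee : ev f x s = ok j.
      apply: (ev_ext _ vf) => w _ hw; rewrite /upd; case: eqP => [->//|/eqP wv].
      by rewrite ps //; lia.
    have s60 : st6 0 = 0 by rewrite p6 //; lia.
    have r3n : (r.+3 == v) = false by lia.
    have hasS : has ok (iota 0 j.+1) = has ok (iota 0 j) || ok j.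
      by rewrite -addn1 iotaD has_cat /= orbF.
    have fin (st7 : nat -> nat) : st7 r = (has ok (iota 0 j) || ok j) -> (forall w, w < r.+3 -> w != r -> st7 w = st6 w) ->
       [/\ st7 v = j, upd st7 v j.+1 r.+1 = teval t st & I j.+1 (upd st7 v j.+1) o].
      move=> q1 q2; split.
      - by rewrite q2 ?p6 //; lia.
      - by rewrite upd_neq ?q2 ?p6 //; lia.
      - split=> //; first by rewrite hasS -q1 upd_neq //; lia.
          by rewrite upd_neq ?q2 ?p6 //; lia.
        by move=> w hw wv; rewrite upd_neq ?q2 ?p6 ?ps //; lia.
    rewrite ee in e6; case E: (ok j) e6 fin => /= e6 fin.
      have [|w hw wr|q1 q2 q3] := fin (upd (upd st6 r 0) r 1).
      - by rewrite upd_eq orbT.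
      - by rewrite !upd_neq.
      exists (n6 + 4), (upd (upd st6 r 0) r 1), o; split=> //; last by lia.
      apply: BSeq b6 _; apply: BIfEqF; first by rewrite e6 s60.
      exact: bs_set1.
    have [||q1 q2 q3] := fin st6 => //.
      by rewrite p6 ?es ?orbF //; lia.
    exists (n6 + 2), st6, o; split=> //; last by lia.
    apply: BSeq b6 _; apply: BIfEqT; first by rewrite e6 s60.
    exact: BSkip.
  rewrite Eo in b5.
  have v1 : v != 1 by lia.
  have vr2 : v != r.+2 by lia.
  exists (n1 + (2 + (2 + (2 + (n5 + 2))))), (upd st5 v (st5 r.+2)); split.
  + have b6 := @BCopy C x v r.+2 st5 o v1 vr2.
    exact: (BSeq b1 (BSeq b2 (BSeq b3 (BSeq b4 (BSeq b5 b6))))).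
  + have : teval t st * (cf f (B + bt t B) + 4 + 3) <= bt t B * (cf f (B + bt t B) + 7).
      by rewrite -addnA leq_mul2r ht orbT.
    by move: h5 h1; lia.
  + by rewrite upd_neq ?e5 //; lia.
  + move=> w hw; case: (eqVneq w v) => [->|wv]; first by rewrite upd_eq e5'.
    by rewrite upd_neq ?p5.
Qed.
End Exec.

(** * Formulas define polynomial-time languages and functions *)

(* Variable 2 holds the length of the input. *)
Definition env0 (n : nat) : nat -> nat := upd (fun=> 0) 2 n.

Theorem formula_in_P f d : 2 < d -> fvb f d -> in_P (fun x => ev f x (env0 (size x))).
Proof.
move=> d2 vf.
apply: (@decide_poly (Seq (Len 2) (cfm f d)) d _ (fun n => capf f n + n) (fun n => 2 + cf f n)).
- by apply: pb_add; [exact: pb_capf|exact: pb_id].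
- by apply: pb_add; [exact: pb_const|exact: pb_cf].
- by move=> x; rewrite leq_addl.
move=> x; set C := capf f (size x) + size x.
have b1 : bs C x (Len 2) (fun=> 0) [::] 2 (env0 (size x)) [::] by exact: BLen.
have sB v : v < d -> env0 (size x) v <= size x by rewrite /env0 /upd; case: eqP.
have [n [st' [b2 h2 e2 p2]]] := @cfm_ok C x f d d (env0 (size x)) [::] (size x) vf (leqnn d) (ltnW d2) erefl sB (leq_addr _ _).
exists (2 + n), st'; split.
- exact: BSeq b1 b2.
- by rewrite leq_add2l.
- by rewrite p2 //; lia.
- by rewrite e2; case: (ev f x _).
Qed.

Theorem formula_computable f t d : 3 < d -> fvb f d -> tvb t d ->
  poly_computable (fun x => mkseq (fun i => ev f x (upd (env0 (size x)) 3 i)) (teval t (env0 (size x)))).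
Proof.
move=> d3 vf vt.
pose prog := Seq (Len 2) (Seq (cterm t d) (Seq (Zero 3) (Loop 3 d
  (Seq (cfm f d.+1) (IfEq d.+1 0 (Out false) (Out true)))))).
apply: (@compute_poly prog _ (fun n => capf f (n + bt t n) + (capt t n + (bt t n + n)))
  (fun n => ct t n + (4 + (bt t n * (cf f (n + bt t n) + 6) + 1)))).
- have p := pb_bt t; have i := pb_id; do !apply: pb_add => //; last exact: pb_capt.
  by apply: (pb_comp (g := capf f)); [exact: pb_capf|exact: pb_add].
- have p := pb_bt t; have i := pb_id; have c := pb_const; do !apply: pb_add => //; first exact: pb_ct.
  apply: pb_mul => //; apply: pb_add => //.
  by apply: (pb_comp (g := cf f)); [exact: pb_cf|exact: pb_add].
- by move=> x; lia.
move=> x; pose n := size x; rewrite -/n; set C := _ + _.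
pose m := teval t (env0 n); pose g i := ev f x (upd (env0 n) 3 i); rewrite -/m -/g.
have b1 : bs C x (Len 2) (fun=> 0) [::] 2 (env0 n) [::] by exact: BLen.
have sB v : v < d -> env0 n v <= n by rewrite /env0 /upd; case: eqP.
have capt' : capt t n <= C by rewrite /C; lia.
have [n2 [st2 [b2 h2 e2 p2]]] := @cterm_ok C x t d d (env0 n) [::] n vt (leqnn d) (ltnW (ltnW d3)) erefl sB capt'.
have s20 : st2 0 = 0 by rewrite p2 //; lia.
have b3 := @bs_zero C x st2 [::] 3 isT s20.
have hm : m <= bt t n := teval_le vt sB.
pose I j (s : nat -> nat) (o : seq bool) := [/\ o = mkseq g j, s 1 = j & forall v, v < d -> v != 1 -> v != 3 -> s v = env0 n v].
have [||||||n4 [st4 [o4 [b4 h4 [Eo _ _]]]]] := @loop_inv C x 3 d (Seq (cfm f d.+1) (IfEq d.+1 0 (Out false) (Out true))) I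
    m (cf f (n + bt t n) + 3) (upd st2 3 0) [::].
- by [].
- by rewrite /C; lia.
- by rewrite upd_eq.
- by rewrite upd_neq ?e2 //; lia.
- split=> //; first by rewrite upd_neq ?p2 //; lia.
  by move=> v vd v1 v3; rewrite upd_neq ?p2.
- move=> j s o jm [Eo s1 ps] s3 sd.
  have s0 : s 0 = 0 by rewrite ps //; lia.
  have sB' v : v < d -> s v <= n + bt t n.
    move=> vd; case: (eqVneq v 1) => [->|v1]; first by rewrite s1; lia.
    case: (eqVneq v 3) => [->|v3]; first by rewrite s3; lia.
    by rewrite ps //; have := sB v vd; lia.
  have capf' : capf f (n + bt t n) <= C by rewrite /C; lia.
  have [n5 [st5 [b5 h5 e5 p5]]] := @cfm_ok C x f d d.+1 s o _ vf (leqnSn d) (ltnW (ltnW d3)) s0 sB' capf'.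
  have eg : ev f x s = g j.
    apply: (ev_ext _ vf) => v v1 vd; case: (eqVneq v 3) => [->|v3]; first by rewrite s3 upd_eq.
    by rewrite upd_neq // ps.
  have so : size o = j by rewrite Eo size_mkseq.
  have oC : size o < C by rewrite so /C; lia.
  have s50 : st5 0 = 0 by rewrite p5 //; lia.
  have b6 : exists2 n6, n6 <= 3 & bs C x (IfEq d.+1 0 (Out false) (Out true)) st5 o n6 (upd st5 1 (size o).+1) (rcons o (g j)).
    rewrite -eg; case E: (ev f x s) e5 => e5.
      by exists 2 => //; apply: BIfEqF; [rewrite e5 s50|exact: BOut].
    by exists 3 => //; apply: BIfEqT; [rewrite e5 s50|exact: BOut].
  have [n6 h6 b6'] := b6.
  exists (n5 + n6), (upd st5 1 (size o).+1), (rcons o (g j)); split.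
  + exact: BSeq b5 b6'.
  + exact: leq_add.
  + by rewrite upd_neq ?p5 //; lia.
  + by rewrite !upd_neq ?p5 //; lia.
  + split.
    * by rewrite Eo /mkseq -addn1 iotaD map_cat /= cats1 add0n.
    * by rewrite upd_neq // upd_eq so.
    * by move=> v vd v1 v3; rewrite !upd_neq ?p5 ?ps //; lia.
rewrite Eo in b4; exists (2 + (n2 + (2 + n4))), st4; split.
  exact: (BSeq b1 (BSeq b2 (BSeq b3 b4))).
have : m * (cf f (n + bt t n) + 3 + 3) <= bt t n * (cf f (n + bt t n) + 6).
  by rewrite -addnA leq_mul2r hm orbT.
by move: h2 h4; lia.
Qed.

(** * Derived connectives and their evaluation *)

Definition Or f g := Not (And (Not f) (Not g)).
Definition Iff f g := Or (And f g) (And (Not f) (Not g)).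
Definition All v t f := Not (Ex v t (Not f)).
Definition Tru := Eq (K 0) (K 0).
Definition Ands := foldr And Tru.
Definition Ors := foldr Or (Not Tru).
Definition Exs (vs : seq nat) (t : term) (f : fm) := foldr (fun v g => Ex v t g) f vs.

Section Eval.
Variable x : seq bool.
Implicit Types (f g : fm) (st : nat -> nat).

Lemma ev_Or f g st : ev (Or f g) x st = ev f x st || ev g x st.
Proof. by rewrite /= negb_and !negbK. Qed.
Lemma ev_Iff f g st : ev (Iff f g) x st = (ev f x st == ev g x st).
Proof. by rewrite ev_Or /=; do 2 case: (ev _ _ _). Qed.
Lemma ev_ExP v t f st : reflect (exists2 i, i < teval t st & ev f x (upd st v i)) (ev (Ex v t f) x st).
Proof.
by apply: (iffP hasP) => -[i hi h]; exists i => //; move: hi; rewrite mem_iota /= ?add0n.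
Qed.
Lemma ev_AllP v t f st : reflect (forall i, i < teval t st -> ev f x (upd st v i)) (ev (All v t f) x st).
Proof.
apply: (iffP negP) => [h i hi|h /(ev_ExP v t (Not f)) [i hi]]; last by rewrite /= h.
apply: contraT => ni; case: h; apply/(ev_ExP v t (Not f)); by exists i.
Qed.
Lemma ev_Ands l st : ev (Ands l) x st = all (fun f => ev f x st) l.
Proof. by elim: l => //= f l ->. Qed.
Lemma ev_Ors l st : ev (Ors l) x st = has (fun f => ev f x st) l.
Proof. by elim: l => //= f l IH; rewrite -IH negb_and !negbK. Qed.

Lemma teval_eq t st st' : st =1 st' -> teval t st = teval t st'.
Proof. by move=> E; elim: t => //= a -> b ->. Qed.
Lemma ev_eq f st st' : st =1 st' -> ev f x st = ev f x st'.
Proof.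
elim: f st st' => [a b|t|f hf|f hf g hg|v t f hf] st st' E /=.
- by rewrite !(teval_eq _ E).
- by rewrite (teval_eq _ E).
- by rewrite (hf _ _ E).
- by rewrite (hf _ _ E) (hg _ _ E).
- by rewrite (teval_eq _ E); apply: eq_has => i; apply: hf => w; rewrite /upd E.
Qed.

Lemma ev_ExsP vs u f st : uniq vs -> u \notin vs ->
  reflect (exists2 h : nat -> nat, forall v, v \in vs -> h v < st u &
            ev f x (fun v => if v \in vs then h v else st v)) (ev (Exs vs (V u) f) x st).
Proof.
elim: vs st => [|v vs IH] st /=.
  move=> _ _; apply: (iffP idP) => [h|[h _]]; last by [].
  by exists id.
case/andP => vn uvs; rewrite inE negb_or => /andP [uv un].
apply: (iffP (ev_ExP v (V u) _ st)) => /=.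
  move=> [i hi /(IH _ uvs un) [h hh he]].
  exists (fun w => if w == v then i else h w).
    move=> w; rewrite inE; case: eqP => [_ _|_ /= /hh] //.
    by rewrite /upd (negbTE uv).
  rewrite -(ev_eq f (st := fun v0 => if v0 \in vs then h v0 else upd st v i v0)) // => w.
  rewrite inE /upd; case: (eqVneq w v) => [->|wv] /=; first by rewrite (negbTE vn).
  by [].
move=> [h hh he]; exists (h v); first by apply: hh; rewrite inE eqxx.
apply/(IH _ uvs un); exists h.
  by move=> w hw; rewrite /upd (negbTE uv); apply: hh; rewrite inE hw orbT.
rewrite -(ev_eq f (st := fun v0 => if v0 \in v :: vs then h v0 else st v0)) // => w.
rewrite inE /upd; case: (eqVneq w v) => [->|wv] //=; by rewrite (negbTE vn).
Qed.
End Eval.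

Lemma fvb_Ands l d : fvb (Ands l) d = all (fun f => fvb f d) l.
Proof. by elim: l => //= f l ->. Qed.
Lemma fvb_Ors l d : fvb (Ors l) d = all (fun f => fvb f d) l.
Proof. by elim: l => //= f l ->. Qed.
Lemma fvb_Exs vs t f d : tvb t d -> all (fun v => 1 < v < d) vs -> fvb (Exs vs t f) d = fvb f d.
Proof.
by move=> ht; elim: vs => //= v vs IH /andP [/andP [-> ->] /IH ->]; rewrite ht.
Qed.

(** * Words encoding graphs and pairs *)

Lemma size_graph_enc n (g : rel 'I_n) : size (graph_enc g) = n * n.
Proof. by rewrite size_allpairs size_enum_ord. Qed.

Lemma nth_graph_enc n (g : rel 'I_n) (i j : 'I_n) : nth false (graph_enc g) (i * n + j) = g i j.
Proof.
rewrite /graph_enc.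
have key : forall s : seq 'I_n, forall a, a < size s ->
   nth false [seq g i j | i <- s, j <- enum 'I_n] (a * n + j) = g (nth i s a) j.
  elim=> [//|b s IH] [|a] ha /=; rewrite nth_cat size_map size_enum_ord.
    by rewrite mul0n add0n ltn_ord (nth_map i) ?size_enum_ord // nth_ord_enum.
  rewrite ifN; last by rewrite -leqNgt mulSn; lia.
  by rewrite mulSn -addnA addKn IH.
by rewrite key ?size_enum_ord // nth_ord_enum.
Qed.

Lemma graph_encP n (g : rel 'I_n) x : size x = n * n ->
  (forall i j : 'I_n, nth false x (i * n + j) = g i j) -> x = graph_enc g.
Proof.
move=> sx h; apply: (@eq_from_nth _ false); first by rewrite sx size_graph_enc.
move=> p; rewrite sx => hp.
have n0 : 0 < n by case: (n) hp => //; lia.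
have hi : p %/ n < n by rewrite ltn_divLR.
have hj : p %% n < n by rewrite ltn_mod.
by rewrite (divn_eq p n) (h (Ordinal hi) (Ordinal hj)) (nth_graph_enc g (Ordinal hi) (Ordinal hj)).
Qed.

Lemma nth_pair_enc x w :
  [/\ forall i, i < size x -> nth false (pair_enc x w) (2 * i) = nth false x i,
      forall i, i < size x -> nth false (pair_enc x w) (2 * i).+1 = nth false x i,
      nth false (pair_enc x w) (2 * size x) = false,
      nth false (pair_enc x w) (2 * size x).+1 = true &
      forall i, nth false (pair_enc x w) (2 * size x + 2 + i) = nth false w i] /\
  size (pair_enc x w) = 2 * size x + 2 + size w.
Proof.
elim: x => [|b x [[h1 h2 h3 h4 h5] h6]]; first by split; [split|].
have -> : pair_enc (b :: x) w = b :: b :: pair_enc x w by [].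
have E m : 2 * m.+1 = (2 * m).+2 by lia.
have S : size (b :: x) = (size x).+1 by [].
rewrite S E; split; last by rewrite [LHS]/= h6; lia.
split.
- by case=> [|i] hi; rewrite ?muln0 ?E ?[nth _ _ _]/= ?h1.
- by case=> [|i] hi; rewrite ?muln0 ?E ?[nth _ _ _]/= ?h2.
- by [].
- by [].
- by move=> i; exact: h5.
Qed.

(** * Membership in NP *)

Section InNP.
Variables (ind : bool) (k : nat) (f : rel 'I_k).

(* Variable 3 is the number of vertices, the input is [pair_enc x w] with [x] the
   adjacency matrix and [w] the matrix of the order. *)
Let sq := Mul (V 3) (V 3).
Let two t := Mul (K 2) t.
Let ga a b := Bit (two (Add (Mul a (V 3)) b)).
Let lo a b := Bit (Add (Add (two sq) (K 2)) (Add (Mul a (V 3)) b)).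
Let v4 := V 4.
Let v5 := V 5.
Let v6 := V 6.
Let pv (i : 'I_k) := V (10 + i).

Let pairs := [seq (i, j) | i <- enum 'I_k, j <- enum 'I_k].
Let copyf : fm := Exs (iota 10 k) (V 3) (Ands
  ([seq (if ij.1 < ij.2 then lo (pv ij.1) (pv ij.2) else Tru) | ij : 'I_k * 'I_k <- pairs] ++
   [seq (if f ij.1 ij.2 then ga (pv ij.1) (pv ij.2) else
         if ind then Not (ga (pv ij.1) (pv ij.2)) else Tru) | ij : 'I_k * 'I_k <- pairs])).

Definition verifier : fm := Ex 3 (Add (V 2) (K 1)) (Ands [::
  All 4 sq (Iff (Bit (two v4)) (Bit (Add (two v4) (K 1))));
  Not (Bit (two sq)); Bit (Add (two sq) (K 1));
  All 4 (V 3) (Not (ga v4 v4));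
  All 4 (V 3) (All 5 (V 3) (Iff (ga v4 v5) (ga v5 v4)));
  All 4 (V 3) (Not (lo v4 v4));
  All 4 (V 3) (All 5 (V 3) (All 6 (V 3) (Or (Not (And (lo v4 v5) (lo v5 v6))) (lo v4 v6))));
  All 4 (V 3) (All 5 (V 3) (Or (Eq v4 v5) (Or (lo v4 v5) (lo v5 v4))));
  Not copyf]).

Lemma verifier_fvb : fvb verifier (10 + k).
Proof.
rewrite /verifier /= fvb_Exs //; last first.
  by apply/allP => v; rewrite mem_iota; lia.
rewrite fvb_Ands all_cat !all_map; apply/andP; split=> //; apply/andP; split.
  apply/allP => -[i j] _ /=; case: ifP => //= _; rewrite !andbT; have := ltn_ord i; have := ltn_ord j; lia.
apply/allP => -[i j] _ /=; case: ifP => _; last case: (ind) => //=;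
  rewrite /= ?andbT; have := ltn_ord i; have := ltn_ord j; lia.
Qed.

(** Missing bits read as false, so a certificate of any length defines a relation. *)
Definition word_rel (x : seq bool) n : rel 'I_n := fun i j => nth false x (i * n + j).
Arguments word_rel : clear implicits.

Lemma verifierP x w : ev verifier (pair_enc x w) (env0 (size (pair_enc x w))) <->
  exists n, [/\ size x = n * n, simple_graph (word_rel x n), linear_order (word_rel w n) &
    ~ ord_contains ind f (word_rel x n) (word_rel w n)].
Proof.
set y := pair_enc x w; have [[y1 y2 y3 y4 y5] y6] := nth_pair_enc x w.
(* Up to position [2 * size x] all bits are doubled, and there the separator 01 follows; this lets
   the formula recognize the length of [x] inside the paired word. *)
have sz n : n * n = size x <-> [/\ forall i, i < n * n -> nth false y (2 * i) = nth false y (2 * i).+1,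
    nth false y (2 * (n * n)) = false & nth false y (2 * (n * n)).+1 = true].
  split=> [->|[h1 h2 h3]]; first by split=> // i hi; rewrite y1 // y2.
  case: (ltngtP (n * n) (size x)) => // h.
    by move: h2 h3; rewrite y1 // y2 // => ->.
  by have := h1 _ h; rewrite y3 y4.
have core n st : size x = n * n -> st 3 = n ->
   [/\ (forall a b, teval a st < n -> teval b st < n -> ev (ga a b) y st = nth false x (teval a st * n + teval b st)) &
       (forall a b, ev (lo a b) y st = nth false w (teval a st * n + teval b st))].
  move=> sx s3; split=> a b; rewrite /= s3.
    move=> ha hb; rewrite y1 // sx.
    have : (teval a st).+1 * n <= n * n by rewrite leq_mul2r ha orbT.
    by rewrite mulSnr; lia.
  by rewrite -sx y5.
have mp (i j : 'I_k) : (i, j) \in pairs by apply/allpairsP; exists (i, j); rewrite !mem_enum.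
have cpy n st : size x = n * n -> st 3 = n -> linear_order (word_rel w n) ->
    ev copyf y st <-> ord_contains ind f (word_rel x n) (word_rel w n).
  move=> sx s3 [lirr _]; have un : uniq (iota 10 k) by exact: iota_uniq.
  have n3 : 3 \notin iota 10 k by rewrite mem_iota.
  have inK (i : 'I_k) : 10 + i \in iota 10 k by rewrite mem_iota; have := ltn_ord i; lia.
  pose st' h v := if v \in iota 10 k then h v else st v.
  have st3 h : st' h 3 = n by rewrite /st' (negbTE n3).
  have stp h (i : 'I_k) : st' h (10 + i) = h (10 + i) by rewrite /st' inK.
  split.
    case/(ev_ExsP y _ st un n3) => h hb; rewrite s3 in hb.
    rewrite ev_Ands all_cat !all_map -/(st' h) => /andP [/allP a1 /allP a2].
    have [cg cl] := core n (st' h) sx (st3 h).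
    pose phi (i : 'I_k) : 'I_n := Ordinal (hb _ (inK i)).
    have pl (i j : 'I_k) : i < j -> word_rel w n (phi i) (phi j).
      by move=> ij; have := a1 _ (mp i j); rewrite /= ij cl /= !stp.
    have pg (i j : 'I_k) : ev (ga (pv i) (pv j)) y (st' h) = word_rel x n (phi i) (phi j).
      have hn (l : 'I_k) : h (10 + l) < n := hb _ (inK l).
      by rewrite cg; rewrite /= !stp.
    exists phi; split; first last.
      split=> //; have a2' i j := a2 _ (mp i j).
      case: (ind) a2' => a2' i j; have := a2' i j; rewrite /=; case: ifP => fij; rewrite ?pg.
      - by move=> ->.
      - by move=> /negP h'; apply/negP; rewrite -pg.
      - by [].
      - by [].
    move=> i j E; apply: ord_inj; case: (ltngtP i j) => // /pl; rewrite E; exact/contraTeq/(fun _ => lirr _).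
  case=> phi [pinj [pl pf]]; apply/(ev_ExsP y _ st un n3).
  pose h v := if insub (v - 10) is Some i then nat_of_ord (phi i) else 0.
  have hE (i : 'I_k) : h (10 + i) = phi i by rewrite /h addKn insubT //= => ?; congr (_ (phi _)); apply: ord_inj.
  exists h.
    move=> v; rewrite mem_iota s3 => hv; have kv : v - 10 < k by lia.
    have -> : v = 10 + Ordinal kv by move=> /=; lia.
    by rewrite hE.
  have [cg cl] := core n (st' h) sx (st3 h).
  have pg (i j : 'I_k) : ev (ga (pv i) (pv j)) y (st' h) = word_rel x n (phi i) (phi j).
    by rewrite cg /= !stp !hE.
  rewrite ev_Ands all_cat !all_map -/(st' h); apply/andP; split; apply/allP => -[i j] _ /=.
    by case: ifP => // ij; rewrite cl /= !stp !hE; exact: pl.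
  have nE g : ev (Not g) y (st' h) = ~~ ev g y (st' h) by [].
  suff : ev (if f i j then ga (pv i) (pv j) else if ind then Not (ga (pv i) (pv j)) else Tru) y (st' h) by [].
  case: (ind) pf => pf; case: ifP => fij //; rewrite ?nE pg; [by rewrite pf|by rewrite pf fij|exact: pf].
pose S n := upd (env0 (size y)) 3 n.
have S3 n : S n 3 = n by [].
have allv v t g n (Q : nat -> Prop) : (forall i, i < teval t (S n) -> ev g y (upd (S n) v i) <-> Q i) ->
    ev (All v t g) y (S n) <-> forall i, i < teval t (S n) -> Q i.
  by move=> h; split=> [/(ev_AllP y v t g) h' i hi|h']; [exact/h/h'|apply/ev_AllP => i hi; exact/h/h'].
have i1 n : ev (All 4 sq (Iff (Bit (two v4)) (Bit (Add (two v4) (K 1))))) y (S n) <->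
    forall i, i < n * n -> nth false y (2 * i) = nth false y (2 * i).+1.
  by apply: allv => i _; rewrite ev_Iff /= addn1; split=> [/eqP|->].
have i3 n : ev (Bit (Add (two sq) (K 1))) y (S n) = nth false y (2 * (n * n)).+1 by rewrite /= addn1.
have i4 n : size x = n * n -> ev (All 4 (V 3) (Not (ga v4 v4))) y (S n) <-> forall i : 'I_n, ~~ word_rel x n i i.
  move=> sx.
  have evE i : i < n -> ev (Not (ga v4 v4)) y (upd (S n) 4 i) = ~~ nth false x (i * n + i).
    have [cg _] := core n (upd (S n) 4 i) sx erefl => hi.
    by have -> : ev (Not (ga v4 v4)) y (upd (S n) 4 i) = ~~ ev (ga v4 v4) y (upd (S n) 4 i) by []; rewrite cg.
  split; first by move=> /ev_AllP h i; have := h i (ltn_ord i); rewrite evE.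
  by move=> h; apply/ev_AllP => i hi; rewrite evE //; exact: (h (Ordinal hi)).
have i5 n : size x = n * n -> ev (All 4 (V 3) (All 5 (V 3) (Iff (ga v4 v5) (ga v5 v4)))) y (S n) <->
    forall i j : 'I_n, word_rel x n i j = word_rel x n j i.
  move=> sx; split.
    move=> /ev_AllP h i j; have /ev_AllP /(_ j (ltn_ord j)) := h i (ltn_ord i).
    have [cg _] := core n (upd (upd (S n) 4 i) 5 j) sx erefl.
    by rewrite ev_Iff (cg v4 v5 (ltn_ord i) (ltn_ord j)) (cg v5 v4 (ltn_ord j) (ltn_ord i)) => /eqP.
  move=> h; apply/ev_AllP => i hi; apply/ev_AllP => j hj.
  have [cg _] := core n (upd (upd (S n) 4 i) 5 j) sx erefl.
  rewrite ev_Iff (cg v4 v5 hi hj) (cg v5 v4 hj hi); apply/eqP; exact: (h (Ordinal hi) (Ordinal hj)).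
have i6 n : size x = n * n -> ev (All 4 (V 3) (Not (lo v4 v4))) y (S n) <-> forall i : 'I_n, ~~ word_rel w n i i.
  move=> sx.
  have evE i : i < n -> ev (Not (lo v4 v4)) y (upd (S n) 4 i) = ~~ nth false w (i * n + i).
    have [_ cl] := core n (upd (S n) 4 i) sx erefl => hi.
    by have -> : ev (Not (lo v4 v4)) y (upd (S n) 4 i) = ~~ ev (lo v4 v4) y (upd (S n) 4 i) by []; rewrite cl.
  split; first by move=> /ev_AllP h i; have := h i (ltn_ord i); rewrite evE.
  by move=> h; apply/ev_AllP => i hi; rewrite evE //; exact: (h (Ordinal hi)).
have i7 n : size x = n * n -> ev (All 4 (V 3) (All 5 (V 3) (All 6 (V 3) (Or (Not (And (lo v4 v5) (lo v5 v6))) (lo v4 v6))))) y (S n) <->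
    forall i j l : 'I_n, word_rel w n i j -> word_rel w n j l -> word_rel w n i l.
  move=> sx.
  have evE i j l : ev (Or (Not (And (lo v4 v5) (lo v5 v6))) (lo v4 v6)) y (upd (upd (upd (S n) 4 i) 5 j) 6 l) =
     (~~ (nth false w (i * n + j) && nth false w (j * n + l)) || nth false w (i * n + l)).
    have [_ cl] := core n (upd (upd (upd (S n) 4 i) 5 j) 6 l) sx erefl.
    by rewrite ev_Or -/(ev (lo v4 v6) y _) cl; congr (~~ (_ && _) || _); rewrite -[LHS]/(ev (lo _ _) y _) cl.
  split.
    move=> /ev_AllP h i j l h1 h2; have /ev_AllP /(_ j (ltn_ord j)) /ev_AllP /(_ l (ltn_ord l)) := h i (ltn_ord i).
    by rewrite evE -!/(word_rel w n _ _) h1 h2.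
  move=> h; apply/ev_AllP => i hi; apply/ev_AllP => j hj; apply/ev_AllP => l hl; rewrite evE.
  case: (boolP (nth false w (i * n + j))) => //= h1; case: (boolP (nth false w (j * n + l))) => //= h2.
  exact: (h (Ordinal hi) (Ordinal hj) (Ordinal hl)).
have i8 n : size x = n * n -> ev (All 4 (V 3) (All 5 (V 3) (Or (Eq v4 v5) (Or (lo v4 v5) (lo v5 v4))))) y (S n) <->
    forall i j : 'I_n, i != j -> word_rel w n i j || word_rel w n j i.
  move=> sx.
  have evE i j : ev (Or (Eq v4 v5) (Or (lo v4 v5) (lo v5 v4))) y (upd (upd (S n) 4 i) 5 j) =
     [|| i == j, nth false w (i * n + j) | nth false w (j * n + i)].
    have [_ cl] := core n (upd (upd (S n) 4 i) 5 j) sx erefl.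
    by rewrite !ev_Or !cl.
  split.
    move=> /ev_AllP h i j ij; have /ev_AllP /(_ j (ltn_ord j)) := h i (ltn_ord i).
    rewrite evE; case: eqP => [/ord_inj E|_ //]; by rewrite E eqxx in ij.
  move=> h; apply/ev_AllP => i hi; apply/ev_AllP => j hj; rewrite evE.
  case: eqP => //= ij; apply: (h (Ordinal hi) (Ordinal hj)).
  by apply/eqP => -[].
have ac (T : Type) (p : pred T) z l : all p (z :: l) = p z && all p l by [].
split.
  case/ev_ExP => n _; rewrite -/(S n) ev_Ands !ac.
  case/andP => /i1 h1 /andP [h2 /andP [h3 /andP [h4 /andP [h5 /andP [h6 /andP [h7 /andP [h8 /andP [h9 _]]]]]]]].
  have sx : size x = n * n.
    by apply/esym/sz; split=> //; [apply/negbTE|rewrite -i3].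
  have lin : linear_order (word_rel w n) by split; [apply/(i6 n sx)|split; [apply/(i7 n sx)|apply/(i8 n sx)]].
  exists n; split=> //; first by split; [apply/(i4 n sx)|apply/(i5 n sx)].
  by move=> /(cpy n (S n) sx (S3 n) lin); move: h9 => /negP.
case=> n [sx [g1 g2] lin nc]; have [l1 [l2 l3]] := lin.
have [z1 z2 z3] := proj1 (sz n) (esym sx).
apply/ev_ExP; exists n.
  rewrite [teval _ _]/= /env0 upd_eq y6 sx; case: (n) => // n'; nia.
rewrite -/(S n) ev_Ands !ac; do ! (apply/andP; split) => //.
- exact/i1.
- by move: z2 => /negbT.
- by rewrite i3.
- exact/(i4 n sx).
- exact/(i5 n sx).
- exact/(i6 n sx).
- exact/(i7 n sx).
- exact/(i8 n sx).
- by apply/negP => /(cpy n (S n) sx (S3 n) lin).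
Qed.

Theorem ordering_in_NP : in_NP (free_ordering_problem ind f).
Proof.
exists (fun y => ev verifier y (env0 (size y))), 1; split.
  by apply: formula_in_P verifier_fvb; lia.
move=> x; split.
  case=> n [g [gs [-> [lt [ll nc]]]]]; exists (graph_enc lt); rewrite !size_graph_enc; split.
    by rewrite expn1 leq_addr.
  have Eg : word_rel (graph_enc g) n = g by apply/funext => i; apply/funext => j; exact: nth_graph_enc.
  have El : word_rel (graph_enc lt) n = lt by apply/funext => i; apply/funext => j; exact: nth_graph_enc.
  by apply/verifierP; exists n; rewrite Eg El size_graph_enc.
case=> w [_ /verifierP [n [sx gs ll nc]]]; exists n, (word_rel x n); split=> //; split.
  exact: graph_encP.
by exists (word_rel w n).
Qed.
End InNP.

(** * The Cook-Levin theorem *)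

Definition pos v := 2 * v.
Definition neg v := 2 * v + 1.
Lemma half_pos v : (pos v)./2 = v. Proof. rewrite /pos; lia. Qed.
Lemma half_neg v : (neg v)./2 = v. Proof. rewrite /neg; lia. Qed.
Lemma pos_lt v m : v < m -> pos v < 2 * m. Proof. rewrite /pos; lia. Qed.
Lemma neg_lt v m : v < m -> neg v < 2 * m. Proof. rewrite /neg; lia. Qed.
Lemma ltrue_pos al v : ltrue al (pos v) = al v.
Proof. by rewrite /ltrue half_pos /pos oddM addbF. Qed.
Lemma ltrue_neg al v : ltrue al (neg v) = ~~ al v.
Proof. by rewrite /ltrue half_neg /neg oddD oddM addbT. Qed.

Section CookLevin.
Variables (M : TM) (c d : nat).
Hypothesis Mwf : tm_wf M.
Let Q := tm_state M.
Let S := tm_sym M.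

(** Bounds on the certificate, the paired word and the time. The final summand of [bT] makes the
    [bT n + 2] cells that are described contain the paired word. *)
Definition bW n := n ^ d + d.
Definition bY n := 2 * n + 2 + bW n.
Definition bT n := bY n ^ c + c + bY n.
Definition gg := #|S| + #|Q|.
Definition cS (s : S) : nat := enum_rank s.
Definition cQ (q : Q) : nat := #|S| + enum_rank q.

(** Halting configurations are frozen, so acceptance can be tested at the single time [bT n]. *)
Definition dl (q : Q) (s : S) : Q * S * option bool :=
  if tm_halting M q then (q, s, None) else
  let: (q', s', r) := tm_delta M q s in (q', s', Some r).
Definition np (o : option bool) i := match o with None => i | Some true => i + 1 | Some false => i.-1 end.

Lemma tm_stepE (cf : config M) : let: (q, h, tp) := cf in let: (q', s', o) := dl q (tp h) in
  [/\ (tm_step cf).1.1 = q', (tm_step cf).1.2 = np o h &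
      forall i, (tm_step cf).2 i = if i == h then s' else tp i].
Proof.
case: cf => [[q h] tp]; rewrite /dl /=; case: (tm_halting M q).
  by split=> // i; case: eqP => // ->.
by case: (tm_delta M q (tp h)) => [[q' s'] []]; split=> //=; rewrite addn1.
Qed.

Section Clauses.
Variable x : seq bool.
Let n := size x.
Let T := bT n.
(* [A t i s]: cell [i] holds [s] at time [t]; [H t i q]: the head is on cell [i] in state [q] at time [t]. *)
Definition var n t i e := (t * (bT n + 2) + i) * gg + e.
Definition nvar n := (bT n + 1) * (bT n + 2) * gg.
Let A t i s := var n t i (cS s).
Let H t i q := var n t i (cQ q).

(* The cells of the initial tape that do not depend on the certificate. *)
Inductive fixed : nat -> S -> Prop :=
| Fix0 j : j < n -> fixed (2 * j) (bit_sym M (nth false x j))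
| Fix1 j : j < n -> fixed (2 * j + 1) (bit_sym M (nth false x j))
| Fix2 : fixed (2 * n) (tm_zero M)
| Fix3 : fixed (2 * n + 1) (tm_one M)
| Fix4 j : j < bY n ^ c + c + 2 -> fixed (bY n + j) (tm_blank M).

Inductive unitc : nat -> Prop :=
| Unit0 : unitc (pos (H 0 0 (tm_start M)))
| Unit1 i s : fixed i s -> unitc (pos (A 0 i s))
| Unit2 i q : i < T + 2 -> q != tm_accept M -> unitc (neg (H T i q)).

(* Units and binary clauses are padded with the dummy variables [nvar n] and [nvar n + 1] in all signs. *)
Inductive clause : nat -> nat -> nat -> Prop :=
| ClA t i q s : t < T -> i < T + 1 -> clause (neg (H t i q)) (neg (A t i s)) (pos (A (t + 1) i (dl q s).1.2))
| ClB t i q s : t < T -> i < T + 1 ->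
    clause (neg (H t i q)) (neg (A t i s)) (pos (H (t + 1) (np (dl q s).2 i) (dl q s).1.1))
| ClC t i j q s : t < T -> i < T + 2 -> j < T + 1 -> i != j ->
    clause (neg (H t j q)) (neg (A t i s)) (pos (A (t + 1) i s))
| ClU l l2 l3 : unitc l -> l2./2 = nvar n -> l3./2 = nvar n + 1 -> clause l l2 l3
| ClD j b l3 : j < bW n -> l3./2 = nvar n ->
    clause (neg (A 0 (2 * n + 2 + j) (tm_blank M))) (neg (A 0 (2 * n + 2 + j + 1) (bit_sym M b))) l3
| ClF j : j < bW n ->
    clause (pos (A 0 (2 * n + 2 + j) (tm_zero M))) (pos (A 0 (2 * n + 2 + j) (tm_one M)))
           (pos (A 0 (2 * n + 2 + j) (tm_blank M))).

Lemma cS_lt s : cS s < gg. Proof. by rewrite /cS /gg; apply: (leq_trans (ltn_ord _)); rewrite leq_addr. Qed.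
Lemma cQ_lt q : cQ q < gg. Proof. by rewrite /cQ /gg ltn_add2l ltn_ord. Qed.
Lemma cS_inj : injective cS. Proof. by move=> s s' /ord_inj /enum_rank_inj. Qed.
Lemma cQ_inj : injective cQ. Proof. by move=> s s' /addnI /ord_inj /enum_rank_inj. Qed.
Lemma cSQ s q : cS s <> cQ q. Proof. by move=> E; have : cS s < #|S| := ltn_ord _; rewrite E /cQ ltnNge leq_addr. Qed.

Lemma var_inj t i e t' i' e' : i < T + 2 -> i' < T + 2 -> e < gg -> e' < gg ->
  var n t i e = var n t' i' e' -> [/\ t = t', i = i' & e = e'].
Proof. by move=> hi hi' he he' /(pair_inj he he') [/(pair_inj hi hi') [-> ->] ->]. Qed.

Lemma var_lt t i e : t <= T -> i < T + 2 -> e < gg -> var n t i e < nvar n.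
Proof. by move=> ht hi he; apply: pair_lt => //; apply: pair_lt => //; rewrite addn1 ltnS. Qed.

Lemma YT : bY n <= T. Proof. by rewrite /T /bT leq_addl. Qed.

Lemma fixed_lt i s : fixed i s -> i < T + 2.
Proof.
have hY : 2 * n + 2 <= bY n by rewrite leq_addr.
by rewrite /T /bT; case=> [j|j|||j]; move: (bY n ^ c) (bY n) hY => X Z; lia.
Qed.

Lemma unitc_lt l : unitc l -> l < 2 * nvar n.
Proof.
case=> [|i s /fixed_lt hi|i q hi _].
- by apply/pos_lt/var_lt; [|lia|exact: cQ_lt].
- by apply/pos_lt/var_lt; [|lia|exact: cS_lt].
- by apply/neg_lt/var_lt; [|lia|exact: cQ_lt].
Qed.

Lemma np_lt o i : i < T + 1 -> np o i < T + 2.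
Proof. by case: o => [[]|] /=; lia. Qed.

Lemma clause_wf l1 l2 l3 : clause l1 l2 l3 -> [&& l1 < 2 * (nvar n + 2), l2 < 2 * (nvar n + 2), l3 < 2 * (nvar n + 2),
    l1./2 != l2./2, l1./2 != l3./2 & l2./2 != l3./2].
Proof.
have big v : v < nvar n -> v < nvar n + 2 by lia.
have yT := YT.
have A_lt t i s : t <= T -> i < T + 2 -> A t i s < nvar n + 2 by move=> h1 h2; apply/big/var_lt => //; exact: cS_lt.
have H_lt t i q : t <= T -> i < T + 2 -> H t i q < nvar n + 2 by move=> h1 h2; apply/big/var_lt => //; exact: cQ_lt.
have AH t i s t' i' q : i < T + 2 -> i' < T + 2 -> H t i q != A t' i' s.
  move=> h1 h2; apply/eqP => /var_inj [] //; [exact: cQ_lt|exact: cS_lt|].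
  by move=> _ _ /esym /cSQ.
have AA t i s t' i' s' : i < T + 2 -> i' < T + 2 -> (t != t') || (i != i') || (s != s') -> A t i s != A t' i' s'.
  move=> h1 h2; apply: contraTN => /eqP /var_inj [] //; [exact: cS_lt|exact: cS_lt|].
  by move=> -> -> /cS_inj ->; rewrite !eqxx.
have HH t i s t' i' s' : i < T + 2 -> i' < T + 2 -> (t != t') -> H t i s != H t' i' s'.
  move=> h1 h2; apply: contraTN => /eqP /var_inj [] //; [exact: cQ_lt|exact: cQ_lt|].
  by move=> ->; rewrite eqxx.
case.
- move=> t i q s ht hi; rewrite !half_pos !half_neg pos_lt ?neg_lt ?AH ?AA ?A_lt ?H_lt //; try lia.
- move=> t i q s ht hi; have h := np_lt (dl q s).2 hi.
  by rewrite !half_pos !half_neg pos_lt ?neg_lt ?AH ?HH ?A_lt ?H_lt // 1?eq_sym ?AH //; lia.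
- move=> t i j q s ht hi hj ij; rewrite !half_pos !half_neg pos_lt ?neg_lt ?AH ?AA ?A_lt ?H_lt //; try lia.
- by move=> l l2' l3' /unitc_lt h h2 h3; lia.
- move=> j b l3' hj h3; have hY : 2 * n + 2 + j + 1 < T + 2 by move: yT hj; rewrite /bY; lia.
  rewrite !half_neg !neg_lt ?A_lt ?AA ?h3 //; try lia.
  have := @var_lt 0 (2 * n + 2 + j) (cS (tm_blank M)) isT _ (cS_lt _).
  have := @var_lt 0 (2 * n + 2 + j + 1) (cS (bit_sym M b)) isT _ (cS_lt _).
  by rewrite -/(A _ _ _) -/(A _ _ _); lia.
- move=> j hj; have hY : 2 * n + 2 + j < T + 2 by move: yT hj; rewrite /bY; lia.
  have /and3P [] : [&& tm_zero M != tm_one M, tm_zero M != tm_blank M & tm_one M != tm_blank M].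
    move: Mwf; rewrite /tm_wf /= !inE !negb_or => /andP [/and3P [/andP [h1 h2] h3 _] _].
    by rewrite h3 eq_sym h1 eq_sym h2.
  by move=> h1 h2 h3; rewrite !half_pos !pos_lt ?A_lt ?AA ?h1 ?h2 ?h3 ?orbT.
Qed.

Definition csat := exists al, forall l1 l2 l3, clause l1 l2 l3 -> [|| ltrue al l1, ltrue al l2 | ltrue al l3].
Definition accepts (w : seq bool) := (tm_run M (pair_enc x w) T).1.1 = tm_accept M.

(** No clause says that a cell holds a single symbol. The clauses force every variable that
    describes the actual run to be true, whatever else is true, and the last units then exclude
    every final state but the accepting one. *)
Lemma csat_sound : csat -> exists2 w, size w <= bW n & accepts w.
Proof.
case=> al hal.
have unit_true l : unitc l -> ltrue al l.
  move=> ul; have := hal l (if al (nvar n) then neg (nvar n) else pos (nvar n))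
    (if al (nvar n + 1) then neg (nvar n + 1) else pos (nvar n + 1)).
  move=> /(_ _); case: ifP => h2; case: ifP => h3; rewrite ?ltrue_pos ?ltrue_neg ?h2 ?h3 /= ?orbF; apply;
    by apply: ClU => //; rewrite ?half_pos ?half_neg.
pose fr j s := al (A 0 (2 * n + 2 + j) s).
(* The certificate stops at the first cell marked blank; [ClD] and [ClF] propagate blanks from
   there. Before it, a cell marked with both bits is read as one. *)
pose len := find (fun j => fr j (tm_blank M)) (iota 0 (bW n)).
have lenW : len <= bW n by apply: leq_trans (find_size _ _) _; rewrite size_iota.
pose w := mkseq (fun j => fr j (tm_one M)) len.
have before j : j < len -> ~~ fr j (tm_blank M).
  move=> hj; have := before_find 0 hj; rewrite nth_iota ?add0n //; [by move=> ->|exact: leq_trans lenW].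
have exj j : j < bW n -> [|| fr j (tm_zero M), fr j (tm_one M) | fr j (tm_blank M)].
  by move=> hj; have := hal _ _ _ (ClF hj); rewrite !ltrue_pos.
have blk j b : j < bW n -> fr j (tm_blank M) -> ~~ fr j.+1 (bit_sym M b).
  move=> hj h1; pose l3 := if al (nvar n) then neg (nvar n) else pos (nvar n).
  have h3 : l3./2 = nvar n by rewrite /l3; case: ifP; rewrite ?half_pos ?half_neg.
  have f3 : ltrue al l3 = false by rewrite /l3; case: ifP => h; rewrite ?ltrue_pos ?ltrue_neg h.
  have := hal _ _ _ (ClD b hj h3); rewrite !ltrue_neg f3 orbF.
  have -> : 2 * n + 2 + j + 1 = 2 * n + 2 + j.+1 by lia.
  by rewrite /fr in h1 *; rewrite h1.
have after j : len <= j -> j < bW n -> fr j (tm_blank M).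
  elim: j => [|j IH] lj jW.
    have E : len = 0 by lia.
    have hh : has (fun j => fr j (tm_blank M)) (iota 0 (bW n)).
      by rewrite has_find -/len E size_iota.
    by have := nth_find 0 hh; rewrite -/len E nth_iota.
  move: lj; rewrite leq_eqVlt => /orP [/eqP E|lj].
    have hh : has (fun j => fr j (tm_blank M)) (iota 0 (bW n)) by rewrite has_find -/len E size_iota.
    by have := nth_find 0 hh; rewrite -/len E nth_iota.
  have jW' := ltnW jW; have h1 := IH lj jW'.
  have := exj _ jW; have := blk _ false jW' h1; have := blk _ true jW' h1.
  by rewrite /= => /negbTE -> /negbTE ->.
exists w; first by rewrite size_mkseq.
set y := pair_enc x w; have [[y1 y2 y3 y4 y5] y6] := nth_pair_enc x w.
have init i : i < T + 2 -> al (A 0 i ((init_config M y).2 i)).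
  move=> hi /=; rewrite -/y y6 size_mkseq -/n.
  have fx s : fixed i s -> al (A 0 i s) by move=> /Unit1 /unit_true; rewrite ltrue_pos.
  case: (ltnP i (2 * n)) => h1.
    rewrite ifT; last by lia.
    have hj : i./2 < size x by move: h1; rewrite /n; lia.
    case: (boolP (odd i)) => oi.
      have E : i = 2 * i./2 + 1 by lia.
      by apply: fx; rewrite E addn1 y2 // -addn1; exact: Fix1.
    have E : i = 2 * i./2 by lia.
    by apply: fx; rewrite E y1 //; exact: Fix0.
  case: (eqVneq i (2 * n)) => [E|n1].
    by rewrite ifT; [apply: fx; rewrite E y3; exact: Fix2|lia].
  case: (eqVneq i (2 * n + 1)) => [E|n2].
    by rewrite ifT; [apply: fx; rewrite E addn1 y4 -addn1; exact: Fix3|lia].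
  have [j Ei] : exists j, i = 2 * n + 2 + j by exists (i - (2 * n + 2)); lia.
  rewrite Ei ltn_add2l y5; case: (ltnP j len) => jl.
    rewrite nth_mkseq // -/(fr j _); case E: (fr j (tm_one M)) => //=.
    by have := exj j (leq_trans jl lenW); rewrite E (negbTE (before _ jl)) /= orbF.
  case: (ltnP j (bW n)) => jW; first exact: after.
  rewrite -Ei; apply: fx; have -> : i = bY n + (j - bW n) by rewrite Ei /bY; lia.
  by apply: Fix4; move: hi; rewrite Ei /T /bT /bY; lia.
have run t : t <= T -> [/\ (tm_run M y t).1.2 <= t, al (H t (tm_run M y t).1.2 (tm_run M y t).1.1) &
    forall i, i < T + 2 -> al (A t i ((tm_run M y t).2 i))].
  elim: t => [|t IH] tT.
    split=> //.
    by have := unit_true _ Unit0; rewrite ltrue_pos.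
  have [] := IH (ltnW tT); rewrite /tm_run iterS -/(tm_run M y t).
  have := tm_stepE (tm_run M y t); case: (tm_run M y t) => [[q h] tp] /=.
  case E: (dl q (tp h)) => [[q' s'] o] /= [-> -> tE] ht hH hA.
  have hT : h < T + 1 by lia.
  have hT2 : h < T + 2 by lia.
  split.
  - by case: o {E} => [[]|] /=; lia.
  - have := hal _ _ _ (ClB q (tp h) tT hT); rewrite !ltrue_neg ltrue_pos hH hA //= E /= addn1; exact.
  - move=> i hi; rewrite tE; case: (eqVneq i h) => [->|ih].
      have := hal _ _ _ (ClA q (tp h) tT hT); rewrite !ltrue_neg ltrue_pos hH hA //= E /= addn1; exact.
    have := hal _ _ _ (ClC q (tp i) tT hi hT ih); rewrite !ltrue_neg ltrue_pos hH hA //= addn1; exact.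
have [h1 h2 _] := run T (leqnn T).
rewrite /accepts -/y; apply/eqP; apply: contraT => nq.
have hT2 : (tm_run M y T).1.2 < T + 2 by lia.
by have := unit_true _ (Unit2 hT2 nq); rewrite ltrue_neg h2.
Qed.

Lemma csat_complete w : size w <= bW n -> accepts w -> csat.
Proof.
move=> sw acc; set y := pair_enc x w; have [[y1 y2 y3 y4 y5] y6] := nth_pair_enc x w.
pose R t := tm_run M y t.
(* Divisions undo the numbering [var], and the variable gets its truth value in the actual run. *)
pose al v := let e := v %% gg in let i := v %/ gg %% (T + 2) in let t := v %/ gg %/ (T + 2) in
  if e < #|S| then cS ((R t).2 i) == e else ((R t).1.2 == i) && (cQ (R t).1.1 == e).
have dec t i e : i < T + 2 -> e < gg -> [/\ var n t i e %% gg = e, var n t i e %/ gg %% (T + 2) = i &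
    var n t i e %/ gg %/ (T + 2) = t].
  move=> hi he; have g0 : 0 < gg by lia.
  rewrite /var modnMDl modn_small // divnMDl // divn_small // addn0.
  by rewrite modnMDl modn_small // divnMDl ?divn_small ?addn0 // addn2.
have alA t i s : i < T + 2 -> al (A t i s) = ((R t).2 i == s).
  move=> hi; rewrite /al; have [-> -> ->] := dec t i _ hi (cS_lt s).
  by rewrite ltn_ord (inj_eq cS_inj).
have alH t i q : i < T + 2 -> al (H t i q) = ((R t).1.2 == i) && ((R t).1.1 == q).
  move=> hi; rewrite /al; have [-> -> ->] := dec t i _ hi (cQ_lt q).
  by rewrite ifN ?(inj_eq cQ_inj) // -leqNgt leq_addr.
have step t : let: (q, h, tp) := R t in let: (q', s', o) := dl q (tp h) in
    [/\ (R t.+1).1.1 = q', (R t.+1).1.2 = np o h & forall i, (R t.+1).2 i = if i == h then s' else tp i].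
  have -> : R t.+1 = tm_step (R t) by [].
  by have := tm_stepE (R t); case: (R t) => [[q h] tp]; case: (dl _ _) => [[q' s'] o].
have yT := YT.
have fx i s : fixed i s -> (R 0).2 i = s.
  have E0 i' : (R 0).2 i' = if i' < 2 * n + 2 + size w then bit_sym M (nth false y i') else tm_blank M.
    by rewrite /= y6.
  case=> [j hj|j hj|||j hj]; rewrite E0.
  - by rewrite y1 // ifT //; lia.
  - by rewrite addn1 y2 // ifT //; lia.
  - by rewrite y3 ifT //; lia.
  - by rewrite addn1 y4 ifT //; lia.
  - by rewrite ifN // -leqNgt /bY; move: sw; clear; move: (bW n) (size w) => *; lia.
exists al => l1 l2 l3 [].
- move=> t i q s tT hi; rewrite !ltrue_neg ltrue_pos alH ?alA; try lia.
  have := step t; case: (R t) => [[q0 h] tp] /=.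
  case: (eqVneq h i) => //= <-; case: (eqVneq q0 q) => //= <-; case: (eqVneq (tp h) s) => //= <-.
  by case: (dl _ _) => [[q' s'] o] [_ _]; rewrite addn1 => -> /=; rewrite !eqxx.
- move=> t i q s tT hi; rewrite !ltrue_neg ltrue_pos !alH ?alA ?np_lt //; try lia.
  have := step t; case: (R t) => [[q0 h] tp] /=.
  case: (eqVneq h i) => //= <-; case: (eqVneq q0 q) => //= <-; case: (eqVneq (tp h) s) => //= <-.
  by case: (dl _ _) => [[q' s'] o] [h1 h2 _]; rewrite addn1 h1 h2 /= !eqxx.
- move=> t i j q s tT hi hj ij; rewrite !ltrue_neg ltrue_pos alH ?alA; try lia.
  have := step t; case: (R t) => [[q0 h] tp] /=.
  case: (eqVneq h j) => //= hj'; case: (eqVneq q0 q) => //= _; case: (eqVneq (tp i) s) => //= <-.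
  by case: (dl _ _) => [[q' s'] o] [_ _]; rewrite addn1 => ->; rewrite hj' (negbTE ij) eqxx.
- move=> l l2' l3' ul _ _; suff -> : ltrue al l by [].
  case: ul => [|i s h|i q hi nq].
  + by rewrite ltrue_pos alH ?eqxx //; lia.
  + by rewrite ltrue_pos alA ?(fx _ _ h) ?eqxx //; exact: fixed_lt h.
  + rewrite ltrue_neg alH // negb_and; apply/orP; right; apply: contra nq => /eqP <-; exact/eqP.
- move=> j b l3' hj _; have hY : 2 * n + 2 + j + 1 < T + 2 by move: yT hj; rewrite /bY; lia.
  rewrite !ltrue_neg !alA //; try lia.
  case: (eqVneq ((R 0).2 (2 * n + 2 + j)) (tm_blank M)) => //= E.
  have jw : size w <= j.
    rewrite leqNgt; apply/negP => jw; move: E; rewrite /= y6 ltn_add2l jw /bit_sym.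
    move: Mwf; rewrite /tm_wf /= !inE !negb_or => /andP [/and3P [/andP [h1 h2] h3 _] _].
    by case: ifP => _ E; rewrite E eqxx in h1 h2.
  rewrite y6 ifN; last by rewrite -leqNgt -/n; move: jw; clear; move: (size w) => *; lia.
  move: Mwf; rewrite /tm_wf /= !inE !negb_or => /andP [/and3P [/andP [h1 h2] h3 _] _].
  by apply/orP; left; rewrite /bit_sym; case: b.
- move=> j hj; have hY : 2 * n + 2 + j < T + 2 by move: yT hj; rewrite /bY; lia.
  rewrite !ltrue_pos !alA //= y6; case: ifP => _; last by rewrite eqxx !orbT.
  by rewrite /bit_sym; case: (nth _ _ _); rewrite eqxx ?orbT.
Qed.
End Clauses.
End CookLevin.

(** * The clauses as a bounded arithmetic formula *)

Fixpoint Pow t e := if e is e'.+1 then Mul t (Pow t e') else K 1.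
Lemma teval_Pow t e st : teval (Pow t e) st = teval t st ^ e.
Proof. by elim: e => //= e ->; rewrite expnS. Qed.
Lemma tvb_Pow t e d : tvb t d -> tvb (Pow t e) d.
Proof. by move=> h; elim: e => //= e ->; rewrite h. Qed.

Lemma ev_OrsP (I : eqType) (F : I -> fm) (l : seq I) x st :
  reflect (exists2 i, i \in l & ev (F i) x st) (ev (Ors (map F l)) x st).
Proof. by rewrite ev_Ors has_map; exact: hasP. Qed.

Lemma ev_Ors_cons f l x st : ev (Ors (f :: l)) x st = ev f x st || ev (Ors l) x st.
Proof. exact: ev_Or. Qed.

Lemma ev_And f g x st : ev (And f g) x st = ev f x st && ev g x st. Proof. by []. Qed.

Lemma fvb_Ors_map (I : Type) (F : I -> fm) l d : (forall i, fvb (F i) d) -> fvb (Ors (map F l)) d.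
Proof. by move=> h; rewrite fvb_Ors all_map; elim: l => //= i l ->; rewrite h. Qed.

Section ClauseFormula.
Variables (M : TM) (c d : nat).

Definition tW := Add (Pow (V 2) d) (K d).
Definition tY := Add (Add (Mul (K 2) (V 2)) (K 2)) tW.
Definition tT := Add (Add (Pow tY c) (K c)) tY.
Definition tR := Add (Add (Pow tY c) (K c)) (K 2).
Definition tvar a b e := Add (Mul (Add (Mul a (Add tT (K 2))) b) (K (gg M))) (K e).
Definition tN := Mul (Mul (Add tT (K 1)) (Add tT (K 2))) (K (gg M)).

Lemma teval_tW st : teval tW st = bW d (st 2).
Proof. by rewrite /tW /= teval_Pow. Qed.
Lemma teval_tY st : teval tY st = bY d (st 2).
Proof. by rewrite -[LHS]/(2 * st 2 + 2 + teval tW st) teval_tW. Qed.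
Lemma teval_tT st : teval tT st = bT c d (st 2).
Proof. by rewrite -[LHS]/(teval (Pow tY c) st + c + teval tY st) teval_Pow !teval_tY. Qed.
Lemma teval_tR st : teval tR st = bY d (st 2) ^ c + c + 2.
Proof. by rewrite -[LHS]/(teval (Pow tY c) st + c + 2) teval_Pow !teval_tY. Qed.
Lemma teval_tvar a b e st : teval (tvar a b e) st = var M c d (st 2) (teval a st) (teval b st) e.
Proof.
by rewrite -[LHS]/((teval a st * (teval tT st + 2) + teval b st) * gg M + e) teval_tT.
Qed.
Lemma teval_tN st : teval tN st = nvar M c d (st 2).
Proof. by rewrite -[LHS]/((teval tT st + 1) * (teval tT st + 2) * gg M) teval_tT. Qed.

Opaque tW tY tT tR tvar tN.
Let tE := (teval_tW, teval_tY, teval_tT, teval_tR, teval_tvar, teval_tN).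

Let tA a b (s : tm_sym M) := tvar a b (cS s).
Let tH a b (q : tm_state M) := tvar a b (cQ q).
Let tpos t := Mul (K 2) t.
Let tneg t := Add (Mul (K 2) t) (K 1).
Let T1 := Add (V 13) (K 1).
Let cell := Add (Add (Mul (K 2) (V 2)) (K 2)) (V 13).

Definition E3 a b e := And (Eq (V 10) a) (And (Eq (V 11) b) (Eq (V 12) e)).
Lemma E3P a b e x st : reflect [/\ st 10 = teval a st, st 11 = teval b st & st 12 = teval e st] (ev (E3 a b e) x st).
Proof. by apply: (iffP and3P) => -[] => [/eqP h1 /eqP h2 /eqP h3|h1 h2 h3]; split=> //; exact/eqP. Qed.

Let QS := enum {: tm_state M * tm_sym M}.
(** The predecessor is not a term, whence the equation [V 15 + 1 = V 14] and the separate case of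
    cell 0. *)
Definition npf (o : option bool) := match o with
  | None => Eq (V 15) (V 14)
  | Some true => Eq (V 15) (Add (V 14) (K 1))
  | Some false => Or (Eq (Add (V 15) (K 1)) (V 14)) (And (Eq (V 14) (K 0)) (Eq (V 15) (K 0))) end.
Lemma ev_npf o x st : ev (npf o) x st = (st 15 == np o (st 14)).
Proof. by case: o => [[]|] //; rewrite ev_Or /=; case: (st 14) => [|i] /=; lia. Qed.

(* Variable 2 is the input length, 10, 11, 12 are the literals of the clause, and 13, 14, 15
   stand for the time [t] (or an index [j]) and the cells [i] and [j]. *)
Definition clA := Ex 13 tT (Ex 14 (Add tT (K 1)) (Ors [seq
  E3 (tneg (tH (V 13) (V 14) qs.1)) (tneg (tA (V 13) (V 14) qs.2)) (tpos (tA T1 (V 14) (dl qs.1 qs.2).1.2)) | qs <- QS])).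
Definition clB := Ex 13 tT (Ex 14 (Add tT (K 1)) (Ex 15 (Add tT (K 2)) (Ors [seq And (npf (dl qs.1 qs.2).2)
  (E3 (tneg (tH (V 13) (V 14) qs.1)) (tneg (tA (V 13) (V 14) qs.2)) (tpos (tH T1 (V 15) (dl qs.1 qs.2).1.1))) | qs <- QS]))).
Definition clC := Ex 13 tT (Ex 14 (Add tT (K 2)) (Ex 15 (Add tT (K 1)) (And (Not (Eq (V 14) (V 15))) (Ors [seq
  E3 (tneg (tH (V 13) (V 15) qs.1)) (tneg (tA (V 13) (V 14) qs.2)) (tpos (tA T1 (V 14) qs.2)) | qs <- QS])))).
Definition dummy v t := Or (Eq (V v) (tpos t)) (Eq (V v) (tneg t)).
Definition unitf := Ors [::
  Eq (V 10) (tpos (tH (K 0) (K 0) (tm_start M)));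
  Ex 13 (V 2) (Ors [seq And (if eb.2 then Bit (V 13) else Not (Bit (V 13)))
     (Eq (V 10) (tpos (tA (K 0) (if eb.1 then Add (Mul (K 2) (V 13)) (K 1) else Mul (K 2) (V 13)) (bit_sym M eb.2))))
     | eb <- enum {: bool * bool}]);
  Eq (V 10) (tpos (tA (K 0) (Mul (K 2) (V 2)) (tm_zero M)));
  Eq (V 10) (tpos (tA (K 0) (Add (Mul (K 2) (V 2)) (K 1)) (tm_one M)));
  Ex 13 tR (Eq (V 10) (tpos (tA (K 0) (Add tY (V 13)) (tm_blank M))));
  Ex 14 (Add tT (K 2)) (Ors [seq Eq (V 10) (tneg (tH tT (V 14) q)) | q <- enum [pred q | q != tm_accept M]])].
Definition clU := And unitf (And (dummy 11 tN) (dummy 12 (Add tN (K 1)))).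
Definition clD := Ex 13 tW (Ors [seq And (Eq (V 10) (tneg (tA (K 0) cell (tm_blank M))))
  (And (Eq (V 11) (tneg (tA (K 0) (Add cell (K 1)) (bit_sym M b)))) (dummy 12 tN)) | b <- [:: true; false]]).
Definition clF := Ex 13 tW (E3 (tpos (tA (K 0) cell (tm_zero M))) (tpos (tA (K 0) cell (tm_one M))) (tpos (tA (K 0) cell (tm_blank M)))).
Definition clf := Ors [:: clA; clB; clC; clU; clD; clF].

Lemma ev_dummy v t x st : ev (dummy v t) x st <-> (st v)./2 = teval t st.
Proof. rewrite ev_Or /=; split; [case/orP => /eqP ->; lia|lia]. Qed.

Lemma ev_unitf x st : st 2 = size x -> ev unitf x st <-> unitc M c d x (st 10).
Proof.
move=> s2; split.
  rewrite /unitf !ev_Ors_cons => /orP [/eqP|].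
    by rewrite /= tE s2 => ->; exact: Unit0.
  case/orP => [/ev_ExP [j hj /ev_OrsP [[e b] _ /andP [hb /eqP]]]|].
    rewrite /= tE /upd /= s2 => ->; apply: Unit1; rewrite /= s2 in hj.
    have -> : b = nth false x j by case: b hb => /= hb; [rewrite [RHS]hb|rewrite [RHS](negbTE hb)].
    by case: (e); [exact: Fix1|exact: Fix0].
  case/orP => [/eqP|].
    by rewrite /= tE /= s2 => ->; apply: Unit1; exact: Fix2.
  case/orP => [/eqP|].
    by rewrite /= tE /= s2 => ->; apply: Unit1; exact: Fix3.
  case/orP => [/ev_ExP [j hj /eqP]|].
    rewrite /= !tE /upd /= s2 => ->; apply: Unit1; rewrite tE s2 in hj.
    by rewrite tE /= s2; apply: Fix4.
  case/orP => // /ev_ExP [i hi /ev_OrsP [q]]; rewrite mem_enum inE => nq /eqP.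
  rewrite /= !tE /upd /= ?tE s2 => ->; rewrite /= tE s2 in hi; exact: Unit2.
rewrite /unitf; move E: (st 10) => l h; case: h E => [|i s hf|i q hi nq] E; rewrite !ev_Ors_cons.
- by apply/orP; left; rewrite /= tE s2 E.
- case: hf E => [j hj|j hj|||j hj] E.
  + do 1 (apply/orP; right); apply/orP; left; apply/ev_ExP; exists j; first by rewrite /= s2.
    apply/ev_OrsP; exists (false, nth false x j); first by rewrite mem_enum.
    by rewrite /= tE /upd /= s2 E eqxx; case: ifP => //= ->.
  + do 1 (apply/orP; right); apply/orP; left; apply/ev_ExP; exists j; first by rewrite /= s2.
    apply/ev_OrsP; exists (true, nth false x j); first by rewrite mem_enum.
    by rewrite /= tE /upd /= s2 E eqxx; case: ifP => //= ->.
  + by do 2 (apply/orP; right); apply/orP; left; apply/eqP; rewrite /= tE /= s2.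
  + by do 3 (apply/orP; right); apply/orP; left; apply/eqP; rewrite /= tE /= s2.
  + do 4 (apply/orP; right); apply/orP; left; apply/ev_ExP; exists j; first by rewrite tE s2.
    by rewrite /= !tE /upd /= tE /= s2 E.
- do 5 (apply/orP; right); apply/orP; left; apply/ev_ExP; exists i; first by rewrite /= tE s2.
  apply/ev_OrsP; exists q; first by rewrite mem_enum.
  by rewrite /= !tE /upd /= ?tE /= s2 E.
Qed.

Lemma ev_clf x st : st 2 = size x -> ev clf x st <-> clause M c d x (st 10) (st 11) (st 12).
Proof.
move=> s2; rewrite /clf !ev_Ors_cons; split.
  case/orP => [/ev_ExP [t ht] /ev_ExP [i hi] /ev_OrsP [[q s] _ /E3P]|].
    rewrite /= !tE /upd /= s2 => -[-> -> ->]; rewrite /= ?tE /upd /= s2 in ht hi; exact: ClA.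
  case/orP => [/ev_ExP [t ht] /ev_ExP [i hi] /ev_ExP [j hj] /ev_OrsP [[q s] _ ]|].
    rewrite ev_And ev_npf => /andP [/eqP + /E3P].
    rewrite /= !tE /upd /= s2 => -> [-> -> ->]; rewrite /= ?tE /upd /= s2 in ht hi; exact: ClB.
  case/orP => [/ev_ExP [t ht] /ev_ExP [i hi] /ev_ExP [j hj] /andP [ij] /ev_OrsP [[q s] _ /E3P]|].
    rewrite /= !tE /upd /= s2 => -[-> -> ->]; rewrite /= ?tE /upd /= s2 in ht hi hj ij; exact: ClC.
  case/orP => [/andP [/(ev_unitf s2) hu /andP [/(ev_dummy _ _ x) h2 /(ev_dummy _ _ x) h3]]|].
    by rewrite /= tE s2 in h2 h3; exact: ClU.
  case/orP => [/ev_ExP [j hj] /ev_OrsP [b _ /andP [/eqP h1 /andP [/eqP h2 /(ev_dummy _ _ x) h3]]]|].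
    rewrite /= ?tE /upd /= s2 in hj h1 h2 h3; rewrite h1 h2; exact: ClD.
  rewrite orbF => /ev_ExP [j hj /E3P].
  rewrite /= !tE /upd /= s2 => -[-> -> ->]; rewrite tE s2 in hj; exact: ClF.
move E1: (st 10) => l1; move E2: (st 11) => l2; move E3': (st 12) => l3 h.
have mq qs : qs \in QS by rewrite mem_enum.
case: h E1 E2 E3' => [t i q s ht hi|t i q s ht hi|t i j q s ht hi hj ij|l l2' l3' hu h2 h3|j b l3' hj h3|j hj] E1 E2 E3'.
- apply/orP; left; apply/ev_ExP; exists t; first by rewrite tE s2.
  apply/ev_ExP; exists i; first by rewrite /= tE /upd /= s2.
  by apply/ev_OrsP; exists (q, s) => //; apply/E3P; rewrite /= !tE /upd /= s2.
- do 1 (apply/orP; right); apply/orP; left; apply/ev_ExP; exists t; first by rewrite tE s2.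
  apply/ev_ExP; exists i; first by rewrite /= tE /upd /= s2.
  apply/ev_ExP; exists (np (dl q s).2 i); first by rewrite /= tE /upd /= s2; case: (dl q s).2 => [[]|] /=; lia.
  apply/ev_OrsP; exists (q, s) => //; rewrite ev_And ev_npf eqxx andTb.
  by apply/E3P; rewrite /= !tE /upd /= s2.
- do 2 (apply/orP; right); apply/orP; left; apply/ev_ExP; exists t; first by rewrite tE s2.
  apply/ev_ExP; exists i; first by rewrite /= tE /upd /= s2.
  apply/ev_ExP; exists j; first by rewrite /= tE /upd /= s2.
  apply/andP; split; first by [].
  by apply/ev_OrsP; exists (q, s) => //; apply/E3P; rewrite /= !tE /upd /= s2.
- do 3 (apply/orP; right); apply/orP; left; apply/andP; split; first by apply/(ev_unitf s2); rewrite E1.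
  by apply/andP; split; apply/(ev_dummy _ _ x); rewrite /= tE s2 ?E2 ?E3'.
- do 4 (apply/orP; right); apply/orP; left; apply/ev_ExP; exists j; first by rewrite tE s2.
  apply/ev_OrsP; exists b; first by case: (b).
  apply/andP; split; first by rewrite /= tE /upd /= s2 E1.
  apply/andP; split; first by rewrite /= tE /upd /= s2 E2.
  by apply/(ev_dummy _ _ x); rewrite tE /upd /= s2 E3'.
- do 5 (apply/orP; right); apply/orP; left; apply/ev_ExP; exists j; first by rewrite tE s2.
  by apply/E3P; rewrite /= !tE /upd /= s2.
Qed.

Transparent tW tY tT tR tvar tN.
Lemma tvb_bounds e : 2 < e -> [/\ tvb tW e, tvb tY e, tvb tT e, tvb tR e & tvb tN e].
Proof.
move=> he; have hP : tvb (Pow (V 2) d) e by exact: tvb_Pow.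
have hY : tvb tY e by rewrite /= he hP.
by have hPY : tvb (Pow tY c) e; [exact: tvb_Pow|split; rewrite /= ?hPY ?hP ?he].
Qed.
Opaque tW tY tT tR tN.

Lemma fvb_clf : fvb clf 16.
Proof.
have [hW hY hT hR hN] := tvb_bounds (isT : 2 < 16).
have hv a b e : tvb (tvar a b e) 16 = tvb a 16 && tvb b 16 by rewrite /= hT !andbT.
have E3v a b e : fvb (E3 a b e) 16 = [&& tvb a 16, tvb b 16 & tvb e 16] by [].
Opaque tvar.
have o o' : fvb (npf o') 16 by case: o' => [[]|].
rewrite /clf /= !fvb_Ors_map /= ?hv ?hW ?hY ?hT ?hR ?hN /= ?hY //.
all: by move=> i; rewrite /= ?hv /= ?hT ?o //; case: i => [[] []].
Qed.
Transparent tW tY tT tR tvar tN.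
End ClauseFormula.

(** * The reduction *)

Lemma tm_run_halting (M : TM) y t m : tm_halting M (tm_run M y t).1.1 ->
  tm_run M y (m + t) = tm_run M y t.
Proof.
move=> h; elim: m => // m IH; rewrite addSn [LHS]iterS -/(tm_run M y (m + t)) IH.
by move: h; rewrite /tm_step; case: (tm_run M y t) => [[q h] tp] /= ->.
Qed.

Lemma in_NP_csat (L : language) : in_NP L ->
  exists (M : TM) (c d : nat), tm_wf M /\ forall x, L x <-> csat M c d x.
Proof.
case=> Ver [d [[M [Mwf [c hM]]] hL]]; exists M, c, d; split=> // x; rewrite hL.
have acc w : size w <= bW d (size x) -> Ver (pair_enc x w) <-> accepts M c d x w.
  move=> hw; have [t [ht [hh <-]]] := hM (pair_enc x w).
  have [_ sy] := nth_pair_enc x w.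
  have tT : t <= bT c d (size x).
    apply: (leq_trans ht); rewrite /bT -addnA leq_add ?leq_addr //.
    have hy : size (pair_enc x w) <= bY d (size x) by rewrite sy leq_add2l.
    by case: (c) => // c'; rewrite leq_exp2r.
  by rewrite /accepts -(subnK tT) tm_run_halting.
split=> [[w [hw /(acc w hw)]]|/(csat_sound Mwf) [w hw /(acc w hw)]]; last by exists w.
exact: csat_complete.
Qed.

Section Reduction.
Variables (k : nat) (U : finType) (e : rel U) (tau : 'I_(M k) + 'I_6 -> U).
Variables (Mc : TM) (c d : nat).
Hypothesis Mwf : tm_wf Mc.

Definition cl_of (x : seq bool) l1 l2 l3 : bool := `[< clause Mc c d x l1 l2 l3 >].
Definition N_of (x : seq bool) := nvar Mc c d (size x) + 2.

Lemma wf3_of x : wf3 (N_of x) (cl_of x).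
Proof.
split; last by move=> l1 l2 l3 /asboolP; exact: clause_wf.
exists (pos (var Mc c d (size x) 0 0 (cQ (tm_start Mc)))), (pos (nvar Mc c d (size x))), (pos (nvar Mc c d (size x) + 1)).
by apply/asboolP; apply: (ClU (Unit0 _ _ _ _)); exact: half_pos.
Qed.

Lemma sat3_of x : sat3 (cl_of x) <-> csat Mc c d x.
Proof.
by split=> -[al h]; exists al => l1 l2 l3 hc; apply: h; [apply/asboolP|move/asboolP: hc].
Qed.

Definition tN2 := Add (tN Mc c d) (K 2).
Definition t2N := Mul (K 2) tN2.
Definition gsz := Add (Add (K (M k)) t2N) (Mul (Mul (Mul t2N t2N) t2N) (K #|U|)).
(* Variables 6, 7, 8 are the negations of the literals 10, 11, 12. *)
Definition pt (u : U) := match [pick x | tau x == u] with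
  | Some (inl a) => K a
  | Some (inr i) => Add (K (M k)) (V (nth 0 [:: 10; 6; 11; 7; 12; 8] i))
  | None => Add (Add (Add (K (M k)) t2N) (Mul (Add (Mul (Add (Mul (V 10) t2N) (V 11)) t2N) (V 12)) (K #|U|)))
      (K (enum_rank u))
  end.
(** Parity and halving are not terms; variable 9 guesses the propositional variable behind the
    literal. *)
Definition flipf a b := Ex 9 tN2 (Or (And (Eq (V a) (Mul (K 2) (V 9))) (Eq (V b) (Add (Mul (K 2) (V 9)) (K 1))))
  (And (Eq (V a) (Add (Mul (K 2) (V 9)) (K 1))) (Eq (V b) (Mul (K 2) (V 9))))).
Definition edgef := Ex 10 t2N (Ex 11 t2N (Ex 12 t2N (Ex 6 t2N (Ex 7 t2N (Ex 8 t2N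
  (And (flipf 10 6) (And (flipf 11 7) (And (flipf 12 8) (And (clf Mc c d)
   (Ors [seq And (Eq (V 4) (pt uv.1)) (Eq (V 5) (pt uv.2)) | uv <- enum [pred uv | e uv.1 uv.2]])))))))))).
Definition outf := Ex 4 gsz (Ex 5 gsz (And (Eq (V 3) (Add (Mul (V 4) gsz) (V 5))) edgef)).

Lemma teval_tN2 st : teval tN2 st = nvar Mc c d (st 2) + 2.
Proof. by rewrite -[LHS]/(teval (tN Mc c d) st + 2) teval_tN. Qed.
Lemma teval_t2N st : teval t2N st = 2 * (nvar Mc c d (st 2) + 2).
Proof. by rewrite -[LHS]/(2 * teval tN2 st) teval_tN2. Qed.
Lemma teval_gsz st : teval gsz st = gsize k U (nvar Mc c d (st 2) + 2).
Proof.
rewrite -[LHS]/(M k + teval t2N st + teval t2N st * teval t2N st * teval t2N st * #|U|).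
by rewrite teval_t2N.
Qed.
Opaque tN2 t2N gsz clf.

Lemma ev_flipf a b x st : a != 9 -> b != 9 -> st a < 2 * (nvar Mc c d (st 2) + 2) ->
  ev (flipf a b) x st <-> st b = flip (st a).
Proof.
move=> a9 b9 ha; split.
  case/ev_ExP => i _; rewrite ev_Or /= !upd_eq !upd_neq // /flip.
  by case/orP => /andP [/eqP -> /eqP ->]; case: ifP; lia.
move=> E; apply/ev_ExP; exists (st a)./2; first by rewrite teval_tN2; lia.
rewrite ev_Or /= !upd_eq !upd_neq // E /flip; case: ifP; lia.
Qed.

Lemma teval_pt u st : st 6 = flip (st 10) -> st 7 = flip (st 11) -> st 8 = flip (st 12) ->
  teval (pt u) st = vpos tau (nvar Mc c d (st 2) + 2) (st 10) (st 11) (st 12) u.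
Proof.
move=> h6 h7 h8; rewrite /pt /vpos; case: pickP => [[a|i] _|_] //; last by rewrite /= !teval_t2N.
by rewrite /=; case: i => [[|[|[|[|[|[|//]]]]]] hi] /=; rewrite ?h6 ?h7 ?h8.
Qed.

Lemma ev_clfE x st : st 2 = size x -> ev (clf Mc c d) x st = cl_of x (st 10) (st 11) (st 12).
Proof. by move=> s2; apply/idP/asboolP => /(ev_clf _ _ _ s2). Qed.

Lemma ev_edgef x st : st 2 = size x -> ev edgef x st = gedge e tau (N_of x) (cl_of x) (st 4) (st 5).
Proof.
move=> s2.
pose S l1 l2 l3 l6 l7 l8 := upd (upd (upd (upd (upd (upd st 10 l1) 11 l2) 12 l3) 6 l6) 7 l7) 8 l8.
have body l1 l2 l3 l6 l7 l8 : l1 < 2 * N_of x -> l2 < 2 * N_of x -> l3 < 2 * N_of x ->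
   ev (And (flipf 10 6) (And (flipf 11 7) (And (flipf 12 8) (And (clf Mc c d)
   (Ors [seq And (Eq (V 4) (pt uv.1)) (Eq (V 5) (pt uv.2)) | uv <- enum [pred uv | e uv.1 uv.2]])))))
    x (S l1 l2 l3 l6 l7 l8) <-> [/\ l6 = flip l1, l7 = flip l2, l8 = flip l3, cl_of x l1 l2 l3 &
      exists u v, [/\ e u v, st 4 = vpos tau (N_of x) l1 l2 l3 u & st 5 = vpos tau (N_of x) l1 l2 l3 v]].
  move=> h1 h2 h3; set T := S _ _ _ _ _ _.
  have T2 : T 2 = size x by [].
  have f1 : ev (flipf 10 6) x T <-> l6 = flip l1 by apply: ev_flipf => //; rewrite T2.
  have f2 : ev (flipf 11 7) x T <-> l7 = flip l2 by apply: ev_flipf => //; rewrite T2.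
  have f3 : ev (flipf 12 8) x T <-> l8 = flip l3 by apply: ev_flipf => //; rewrite T2.
  rewrite !ev_And (ev_clfE T2); split.
    case/and5P => /f1 E1 /f2 E2 /f3 E3 hc /ev_OrsP [[u v]]; rewrite mem_enum inE => /= uv /andP [/eqP h4 /eqP h5].
    split=> //; exists u, v; split=> //; [move: h4|move: h5]; by rewrite /= teval_pt // T2.
  case=> E1 E2 E3 hc [u [v [uv h4 h5]]]; apply/and5P; split; [exact/f1|exact/f2|exact/f3|by []|].
  apply/ev_OrsP; exists (u, v); first by rewrite mem_enum inE.
  by apply/andP; split; apply/eqP; rewrite /= teval_pt // T2.
apply/idP/idP.
  case/ev_ExP => l1 h1 /ev_ExP [l2 h2] /ev_ExP [l3 h3] /ev_ExP [l6 h6] /ev_ExP [l7 h7] /ev_ExP [l8 h8].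
  rewrite !teval_t2N /= /upd /= s2 in h1 h2 h3.
  case/(body _ _ _ _ _ _ h1 h2 h3) => _ _ _ hc [u [v [uv h4 h5]]].
  apply/existsP; exists (Ordinal h1, Ordinal h2, Ordinal h3); rewrite hc /=.
  by apply/existsP; exists u; apply/existsP; exists v; rewrite uv h4 h5 !eqxx.
case/existsP => -[[l1 l2] l3] /andP [hc /existsP [u /existsP [v /and3P [uv /eqP h4 /eqP h5]]]].
apply/ev_ExP; exists l1; first by rewrite teval_t2N s2.
apply/ev_ExP; exists l2; first by rewrite teval_t2N /upd /= s2.
apply/ev_ExP; exists l3; first by rewrite teval_t2N /upd /= s2.
apply/ev_ExP; exists (flip l1); first by rewrite teval_t2N /upd /= s2 flip_lt.
apply/ev_ExP; exists (flip l2); first by rewrite teval_t2N /upd /= s2 flip_lt.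
apply/ev_ExP; exists (flip l3); first by rewrite teval_t2N /upd /= s2 flip_lt.
by apply/body => //; split=> //; exists u, v.
Qed.

(** By [pair_inj] a position in the adjacency matrix determines its row and column, so the two outer
    quantifiers of [outf] have a single candidate. *)
Lemma reduction_wordE x :
  mkseq (fun i => ev outf x (upd (env0 (size x)) 3 i)) (teval (Mul gsz gsz) (env0 (size x))) =
  graph_enc (@gE k U e tau (N_of x) (cl_of x)).
Proof.
have gE0 : teval (Mul gsz gsz) (env0 (size x)) = gsize k U (N_of x) * gsize k U (N_of x).
  by rewrite -[LHS]/(teval gsz _ * teval gsz _) teval_gsz.
apply: graph_encP; first by rewrite size_mkseq gE0.
move=> i j; rewrite nth_mkseq; last by rewrite gE0 pair_lt.
rewrite /gE; apply/idP/idP.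
  case/ev_ExP => a ha /ev_ExP [b hb]; rewrite ev_And ev_edgef // => /andP [/eqP E].
  rewrite teval_gsz in ha; rewrite teval_gsz in hb.
  move: E; rewrite /= teval_gsz /upd /= => /pair_inj [] //.
  by move=> -> ->.
move=> h; apply/ev_ExP; exists i; first by rewrite teval_gsz.
apply/ev_ExP; exists j; first by rewrite teval_gsz.
by rewrite ev_And ev_edgef // /= teval_gsz /upd /= eqxx.
Qed.

Transparent tN2 t2N gsz clf.
Opaque tN.
Lemma tvb_terms : [/\ tvb tN2 16, tvb t2N 16 & tvb gsz 16].
Proof. by have [_ _ _ _ h] := tvb_bounds Mc c d (isT : 2 < 16); split; rewrite /= h. Qed.
Opaque tN2 t2N gsz clf.

Lemma fvb_outf : fvb outf 16.
Proof.
have [hN h2N hg] := tvb_terms.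
have hp u : tvb (pt u) 16.
  rewrite /pt; case: pickP => [[a|i] _|_] //=; last by rewrite h2N.
  by case: i => [[|[|[|[|[|[|//]]]]]] hi].
by rewrite /= hg h2N hN fvb_clf fvb_Ors_map //= => uv; rewrite !hp.
Qed.
Transparent tN2 t2N gsz tN clf.

Lemma poly_computable_reduction :
  poly_computable (fun x => graph_enc (@gE k U e tau (N_of x) (cl_of x))).
Proof.
have [_ _ hg] := tvb_terms.
have [Mo hMo] := @formula_computable outf (Mul gsz gsz) 16 isT fvb_outf (introT andP (conj hg hg)).
exists Mo; rewrite -(_ : (fun x => mkseq (fun i => ev outf x (upd (env0 (size x)) 3 i))
  (teval (Mul gsz gsz) (env0 (size x)))) = (fun x => graph_enc (@gE k U e tau (N_of x) (cl_of x)))) //.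
by apply/funext => x; exact: reduction_wordE.
Qed.
End Reduction.

(** * Clean graphs and the two ordering problems *)

Lemma linear_order_rank n (lt : rel 'I_n) : linear_order lt ->
  exists r : 'I_n -> nat, forall i j, lt i j = (r i < r j).
Proof.
case=> irr [tr tot]; pose r i := #|[pred j | lt j i]|.
have mono i j : lt i j -> r i < r j.
  move=> ij; apply: proper_card; apply/properP; split.
    by apply/fintype.subsetP => l; rewrite !inE => li; exact: tr li ij.
  by exists i; rewrite !inE ?ij ?(negbTE (irr i)).
exists r => i j; apply/idP/idP; first exact: mono.
case: (eqVneq i j) => [->|/tot /orP [//|/mono ji]]; first by rewrite ltnn.
by move=> ij; have := ltn_trans ij ji; rewrite ltnn.
Qed.

(** In a clean graph every copy of F is induced, so both problems have the same answer. The length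
    of the word determines [n], hence the encoded graph. *)
Lemma free_ordering_graph_enc ind k (f : rel 'I_k) n (g : rel 'I_n) : simple_graph g -> clean f g ->
  free_ordering_problem ind f (graph_enc g) <-> orderable f g.
Proof.
move=> gs gc; split.
  case=> n' [g' [_ [E [lt [ll nc]]]]].
  have En : n = n'.
    by have := congr1 size E; rewrite !size_graph_enc !mulnn => /eqP; rewrite eqn_sqr => /eqP.
  case: n' / En in g' E lt ll nc *.
  have Eg i j : g' i j = g i j by rewrite -!nth_graph_enc E.
  have [r hr] := linear_order_rank ll; have [irr [_ tot]] := ll.
  exists r; split.
    move=> i j rij; apply/eqP; apply: contraT => /tot; by rewrite !hr rij ltnn.
  move=> phi [phi_inj phi_hom] phi_incr; apply: nc; exists phi; split=> //; split.
    by move=> i j ij; rewrite hr; exact: phi_incr.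
  case: ind => i j; rewrite Eg; last exact: phi_hom.
  by apply/idP/idP; [apply: gc|apply: phi_hom].
case=> r [ri fr]; exists n, g; split=> //; split=> //; exists (fun i j => r i < r j); split.
  split; first by move=> i; rewrite ltnn.
  split; first by move=> i j l; exact: ltn_trans.
  by move=> i j ij; case: ltngtP => // /ri E; rewrite E eqxx in ij.
case=> phi [phi_inj [phi_incr phi_f]]; apply: (fr phi) => //; split=> // a b fab.
by case: ind phi_f => h; [rewrite h|exact: h].
Qed.

Lemma ordering_NP_hard ind k (f : rel 'I_k) : simple_graph f -> biconnected f -> ~ complete_graph f ->
  NP_hard (free_ordering_problem ind f).
Proof.
move=> fs fb fc L /in_NP_csat [Mc [c [d [Mwf hL]]]].
have [U [e [tau hG]]] := hard_graph fs fb fc.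
exists (fun x => graph_enc (@gE k U e tau (N_of Mc c d x) (@cl_of Mc c d x))); split.
  exact: poly_computable_reduction.
move=> x; have [gs gi gc go] := hG _ _ (wf3_of c d Mwf x).
rewrite hL -sat3_of -go free_ordering_graph_enc //.
by split=> [i|i j]; [rewrite gi|exact: gs].
Qed.

Theorem theorem1p5 (k : nat) (f : rel 'I_k) :
  simple_graph f -> biconnected f -> ~ complete_graph f ->
  NP_complete (free_ordering_problem false f) /\
  NP_complete (free_ordering_problem true f).
Proof.
by move=> fs fb fc; split; (split; [exact: ordering_in_NP|exact: ordering_NP_hard]).
Qed.
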